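(* Let $T>0$, let $\Omega\subset\mathbb{R}^d$ ($d\ge 1$) be a bounded domain such that the embedding $H^1(\Omega)\subset L^2(\Omega)$ is compact, and let $J,K$ be positive integers. Let $f\colon\mathbb{R}\to\mathbb{R}$ be globally Lipschitz continuous with constant $L$ and $f(0)=f_0$; for $k=1,\ldots,K$ let $w_k\colon\mathbb{R}\to\mathbb{R}$ be globally Lipschitz continuous with constant $L_k$ and $w_k(0)=w_{k0}$. Let $D>0$, $\beta_1,\ldots,\beta_J>0$ and $y^*\in L^\infty(0,T;L^2(\Omega))$. Let $R^U>0$ and $R^0>0$. Let $\hat u=(g_j,h_k,\alpha_{jk})_{j=1,\ldots,J}^{k=1,\ldots,K}\in U$ with $\|\hat u\|_U\le R^U$ and let $(y_0,\kappa_{10},\ldots,\kappa_{J0})\in X^0$ with $\|(y_0,\kappa_{10},\ldots,\kappa_{J0})\|_{X^0}\le R^0$. Let $(y,\kappa_1,\ldots,\kappa_J)\in X^2$ be a weak solution of the thermostat control system corresponding to the control $\hat u$ and the initial condition $(y_0,\kappa_{10},\ldots,\kappa_{J0})$. Then $$\|(y,\kappa_1,\ldots,\kappa_J)\|_{X^2}<C,$$ where the constant $C$ depends only on $T$, $|\Omega|$, $K$, $J$, $L$, $f_0$, $L_1,\ldots,L_K$, $w_{10},\ldots,w_{K0}$, $R^U$, $R^0$, $\|y^*\|_{L^2(0,T;L^2(\Omega))}$, $D$, $\beta_1,\ldots,\beta_J$.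
   Context: Write $Q_T=\Omega\times(0,T)$; $|\Omega|$ is the Lebesgue measure of $\Omega$. The thermostat control system is, formally, $$y_t-D\Delta y=f(y)+\sum_{j=1}^J g_j(x)\kappa_j(t)\ \text{ on }Q_T,\qquad \frac{\partial y}{\partial n}=0\ \text{ on }\partial\Omega\times(0,T),\qquad y(\cdot,0)=y_0,$$ $$\beta_j\kappa_j'(t)+\kappa_j(t)=W_j(y(\cdot,t),y^*(\cdot,t))\ \text{ on }[0,T],\qquad \kappa_j(0)=\kappa_{j0},\qquad j=1,\ldots,J,$$ where $$W_j(y(\cdot,t),y^*(\cdot,t))=\sum_{k=1}^K\alpha_{jk}\,w_k\Big(\int_\Omega h_k(x)\,(y(x,t)-y^*(x,t))\,dx\Big).$$ Spaces. The control space is $U=(L^2(\Omega))^J\times(L^2(\Omega))^K\times\mathbb{R}^{KJ}$ with the standard product Hilbert norm; its elements (controls) are written $(g_j,h_k,\alpha_{jk})_{j=1,\ldots,J}^{k=1,\ldots,K}$. $X^0=L^2(\Omega)\times\mathbb{R}^J$ with the standard product Hilbert norm. $X^2$ is the space of tuples $(y,\kappa_1,\ldots,\kappa_J)$ with $y\in L^\infty(0,T;L^2(\Omega))$, $\nabla y\in (L^2(Q_T))^d$ (weak gradient in the space variables), $y'\in L^2(0,T;H^1(\Omega)^* )$, and $\kappa_j\in L^\infty(0,T)$, $\kappa_j'\in L^2(0,T)$ for $j=1,\ldots,J$ (time derivatives in the sense of (vector-valued) distributions), with the natural norm $$\|(y,\kappa_1,\ldots,\kappa_J)\|_{X^2}=\|y\|_{L^\infty(0,T;L^2(\Omega))}+\|\nabla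 y\|_{L^2(Q_T)}+\|y'\|_{L^2(0,T;H^1(\Omega)^* )}+\sum_{j=1}^J\big(\|\kappa_j\|_{L^\infty(0,T)}+\|\kappa_j'\|_{L^2(0,T)}\big).$$ If $(y,\kappa_1,\ldots,\kappa_J)\in X^2$ then $y$ has a representative in $C([0,T];L^2(\Omega))$ and $\kappa_j$ has one in $C([0,T])$, so initial values make sense. A weak solution of the system (corresponding to the control $(g_j,h_k,\alpha_{jk})$ and the initial condition $(y_0,\kappa_{10},\ldots,\kappa_{J0})$) is a tuple $(y,\kappa_1,\ldots,\kappa_J)\in X^2$ such that $y(0)=y_0$ in $L^2(\Omega)$, $\kappa_j(0)=\kappa_{j0}$ for all $j$, and: (i) $\int_0^T \big[\langle y',\phi\rangle + D(\nabla y,\nabla\phi)_{L^2(\Omega)} - (f(y)+\sum_{j=1}^J\kappa_j g_j,\phi)_{L^2(\Omega)}\big]\,dt=0$ for all $\phi\in L^2(0,T;H^1(\Omega))$, where $\langle\cdot,\cdot\rangle$ is the duality pairing between $H^1(\Omega)^*$ and $H^1(\Omega)$; (ii) $\int_0^T(\beta_j\kappa_j'+\kappa_j-W_j(y,y^* ))\,\xi\,dt=0$ for all $\xi\in L^2(0,T)$ and all $j=1,\ldots,J$. *)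

(* Defs.v *)
From HB Require Import structures.
From mathcomp Require Import all_boot all_order all_algebra.
From mathcomp Require Import all_classical all_reals all_analysis.

Set Implicit Arguments.
Unset Strict Implicit.
Unset Printing Implicit Defensive.
Import Order.TTheory GRing.Theory Num.Theory.
Import numFieldNormedType.Exports.

Local Open Scope classical_set_scope.
Local Open Scope ring_scope.

(* R^n is 'rV[R]_n with the sigma-algebra generated by the coordinates, i.e. the
   Borel sets, and Lebesgue measure is the iterated product of the
   one-dimensional one (see lebesgue_rV_box) *)
Definition rV_coord (R : realType) (n : nat) (i : 'I_n) (v : 'rV[R]_n) : R :=
  v ord0 i.

Definition rV_measurable (R : realType) (n : nat) : set (set 'rV[R]_n) :=
  g_sigma_preimage (@rV_coord R n).

Lemma rV_measurable0 (R : realType) (n : nat) : @rV_measurable R n set0.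
Proof. exact: sigma_algebra0. Qed.

Lemma rV_measurableC (R : realType) (n : nat) (A : set 'rV[R]_n) :
  rV_measurable A -> rV_measurable (~` A).
Proof. exact: sigma_algebraC. Qed.

Lemma rV_measurable_bigcup (R : realType) (n : nat) (F : (set 'rV[R]_n)^nat) :
  (forall i, rV_measurable (F i)) -> rV_measurable (\bigcup_i F i).
Proof. exact: sigma_algebra_bigcup. Qed.

HB.instance Definition _ (R : realType) (n : nat) :=
  @isMeasurable.Build (measure_tuple_display default_measure_display)
    'rV[R]_n (@rV_measurable R n) (@rV_measurable0 R n)
    (@rV_measurableC R n) (@rV_measurable_bigcup R n).

Definition cons_rV (R : realType) (n : nat)
    (p : measurableTypeR R * 'rV[R]_n) : 'rV[R]_n.+1 :=
  \row_i (if unlift ord0 i is Some j then p.2 ord0 j else p.1).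

Lemma measurable_coord (R : realType) n (i : 'I_n) :
  measurable_fun [set: 'rV[R]_n] (@rV_coord R n i).
Proof.
move=> _ Y mY; rewrite setTI; apply: sub_sigma_algebra => /=.
rewrite -bigcup_seq/=; exists i => /=; first by rewrite mem_index_enum.
by exists Y => //; rewrite setTI.
Qed.

Lemma measurable_fun_coordP d (T : measurableType d) (R : realType) n
    (f : T -> 'rV[R]_n) :
  (forall i, measurable_fun setT (@rV_coord R n i \o f)) ->
  measurable_fun setT f.
Proof.
move=> mf _ A mA; rewrite setTI.
suff : (@rV_measurable R n `<=` [set A | measurable (f @^-1` A)]) by exact.
apply: smallest_sub.
  split => /=; first by rewrite preimage_set0.
    by move=> B mB; rewrite setTD -preimage_setC; exact: measurableC.
  by move=> F mF; rewrite preimage_bigcup; exact: bigcup_measurable.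
rewrite -bigcup_seq => B /= [i _ [C mC <-]] /=.
by rewrite setTI -comp_preimage -[_ @^-1` _]setTI; exact: mf.
Qed.

Lemma measurable_cons_rV (R : realType) (n : nat) :
  measurable_fun [set: measurableTypeR R * 'rV[R]_n] (@cons_rV R n).
Proof.
apply: measurable_fun_coordP => i.
case: (unliftP ord0 i) => [j ->|->].
  rewrite (_ : _ \o _ = @rV_coord R n j \o snd); last first.
    by apply/funext => p /=; rewrite /rV_coord mxE liftK.
  by apply: measurableT_comp; [exact: measurable_coord|exact: measurable_snd].
rewrite (_ : _ \o _ = fst) //.
by apply/funext => p /=; rewrite /rV_coord mxE unlift_none.
Qed.


Definition push_cons (R : realType) (n : nat)
    (mu : {sigma_finite_measure set 'rV[R]_n -> \bar R}) :
    set 'rV[R]_n.+1 -> \bar R :=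
  pushforward (lebesgue_measure \x mu)%E (@cons_rV R n).


Section push_cons.
Context (R : realType) (n : nat).
Variable mu : {sigma_finite_measure set 'rV[R]_n -> \bar R}.
Local Open Scope ereal_scope.

Let m : {measure set (measurableTypeR R * 'rV[R]_n)%type -> \bar R} :=
  (@lebesgue_measure R \x mu)%E.

Let measurable_preimage_cons (A : set 'rV[R]_n.+1) :
  measurable A -> measurable (@cons_rV R n @^-1` A).
Proof. by move=> mA; rewrite -[X in measurable X]setTI; exact: measurable_cons_rV. Qed.

Let push0 : push_cons mu set0 = 0.
Proof. by rewrite /push_cons /pushforward preimage_set0; exact: (@measure0 _ _ _ m). Qed.

Let push_ge0 A : 0 <= push_cons mu A.
Proof. exact: (@measure_ge0 _ _ _ m). Qed.

Let push_sigma_additive : semi_sigma_additive (push_cons mu).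
Proof.
move=> F mF tF mUF; rewrite /push_cons /pushforward preimage_bigcup.
apply: (@measure_semi_sigma_additive _ _ _ m).
- by move=> i; exact: measurable_preimage_cons.
- apply/trivIsetP => /= i j _ _ ij; rewrite -preimage_setI.
  by move/trivIsetP : tF => /(_ _ _ _ _ ij) ->//; rewrite preimage_set0.
- by rewrite -preimage_bigcup; exact: measurable_preimage_cons.
Qed.

HB.instance Definition _ := isMeasure.Build _ _ _
  (push_cons mu) push0 push_ge0 push_sigma_additive.

Lemma cons_rVE (x : measurableTypeR R) (v : 'rV[R]_n) :
  cons_rV (x, v) ord0 ord0 = x.
Proof. by rewrite mxE unlift_none. Qed.

Lemma cons_rVS (x : measurableTypeR R) (v : 'rV[R]_n) i :
  cons_rV (x, v) ord0 (lift ord0 i) = v ord0 i.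
Proof. by rewrite mxE liftK. Qed.

Let sigma_finite_prod : sigma_finite setT m.
Proof.
have /sigma_finiteP[F [TF ndF Foo]] := sigma_finiteT (@lebesgue_measure R).
have /sigma_finiteP[G [TG ndG Goo]] := sigma_finiteT mu.
exists (fun k => F k `*` G k).
  rewrite -setXTT TF TG predeqE => -[x y]; split.
    move=> [/= [i _ Fix] [k _ Gky]]; exists (maxn i k) => //; split.
    - by move: x Fix; exact/subsetPset/ndF/leq_maxl.
    - by move: y Gky; exact/subsetPset/ndG/leq_maxr.
  by move=> [i _ []/= ? ?]; split; exists i.
move=> k; have [? ?] := Foo k; have [? ?] := Goo k.
split; first exact: measurableX.
by rewrite /m /= product_measure1E// lte_mul_pinfty// ge0_fin_numE.
Qed.

Let push_sigma_finite : sigma_finite setT (push_cons mu).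
Proof.
have [F TF Foo] := sigma_finite_prod.
pose un (v : 'rV[R]_n.+1) : measurableTypeR R * 'rV[R]_n :=
  (v ord0 ord0, \row_i v ord0 (lift ord0 i)).
have unK : cancel un (@cons_rV R n).
  move=> v; apply/rowP => i; case: (unliftP ord0 i) => [j ->|->].
    by rewrite cons_rVS mxE.
  by rewrite cons_rVE.
have cK : cancel (@cons_rV R n) un.
  move=> [x v]; rewrite /un cons_rVE; congr pair.
  by apply/rowP => i; rewrite mxE cons_rVS.
have mun : measurable_fun setT un.
  apply/prod_measurable_funP; split; first exact: measurable_coord.
  apply: measurable_fun_coordP => i.
  rewrite (_ : _ \o _ = @rV_coord R n.+1 (lift ord0 i)).
    exact: measurable_coord.
  by apply/funext => v /=; rewrite /rV_coord mxE.
exists (fun k => un @^-1` F k).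
  by rewrite -preimage_bigcup -TF preimage_setT.
move=> k; have [mF Fk] := Foo k; split.
  by rewrite -[X in measurable X]setTI; exact: mun.
rewrite /push_cons /pushforward -comp_preimage.
by rewrite (_ : un \o _ = id) // funeqE => p /=; rewrite cK.
Qed.

HB.instance Definition _ := Measure_isSigmaFinite.Build _ _ _
  (push_cons mu) push_sigma_finite.

End push_cons.

Fixpoint lebesgue_rV (R : realType) (n : nat) :
    {sigma_finite_measure set 'rV[R]_n -> \bar R} :=
  if n is m.+1 then push_cons (lebesgue_rV R m) else \d_(0 : 'rV[R]_0).

Lemma measurable_rV_box (R : realType) (n : nat)
    (A : 'I_n -> set (measurableTypeR R)) :
  (forall i, measurable (A i)) ->
  measurable [set v : 'rV[R]_n | forall i, A i (v ord0 i)].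
Proof.
move=> mA.
rewrite (_ : [set v | _] = \bigcap_(i : 'I_n) (@rV_coord R n i @^-1` A i)).
  apply: fin_bigcap_measurable; first exact: (@finite_finset _ [set: 'I_n]).
  move=> i _.
  by rewrite -[X in measurable X]setTI; exact: (@measurable_coord R n i measurableT (A i) (mA i)).
by apply/seteqP; split => v /= vA i; [move=> _; exact: vA|exact: (vA i I)].
Qed.

Lemma lebesgue_rV_box (R : realType) (n : nat)
    (A : 'I_n -> set (measurableTypeR R)) :
  (forall i, measurable (A i)) ->
  lebesgue_rV R n [set v | forall i, A i (v ord0 i)] =
    (\prod_(i < n) lebesgue_measure (A i))%E.
Proof.
elim: n A => [|n IH] A mA.
  by rewrite big_ord0 /= diracE mem_set //; case.
have boxE : @cons_rV R n @^-1` [set v | forall i, A i (v ord0 i)] =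
    A ord0 `*` [set v : 'rV[R]_n | forall i, A (lift ord0 i) (v ord0 i)].
  apply/seteqP; split => [[x v] /= Av|[x v] [/= Ax Av] i].
    split; first by have := Av ord0; rewrite cons_rVE.
    by move=> i; have := Av (lift ord0 i); rewrite cons_rVS.
  by case: (unliftP ord0 i) => [j ->|->]; rewrite ?cons_rVE ?cons_rVS.
rewrite big_ord_recl -IH //= /push_cons /pushforward boxE.
rewrite product_measure1E; first by [].
  exact: mA.
by have := @measurable_rV_box R n (fun i => A (lift ord0 i)) (fun i => mA (lift ord0 i)).
Qed.

Section function_spaces.
Context (R : realType) (d : nat).
Implicit Types (Omega : set 'rV[R]_d) (u v phi : 'rV[R]_d -> R).
Implicit Types (G H : 'rV[R]_d -> 'rV[R]_d) (l : ('rV[R]_d -> R) -> R).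

Definition L2norm Omega u : \bar R :=
  Lnorm (lebesgue_rV R d) 2%:E (EFin \o (u \_ Omega)).

Definition in_L2 Omega u : Prop :=
  measurable_fun Omega u /\ (L2norm Omega u < +oo)%E.

Definition L2inner Omega u v : R :=
  \int[lebesgue_rV R d]_(x in Omega) (u x * v x).

Definition dotv (a b : 'rV[R]_d) : R := \sum_i a ord0 i * b ord0 i.

Definition partial (i : 'I_d) u : 'rV[R]_d -> R := 'D_(delta_mx ord0 i) u.

Definition smooth u : Prop :=
  forall s : seq 'I_d, let v := foldr partial u s in
    continuous v /\ forall i x, derivable v x (delta_mx ord0 i).

Definition test_function Omega phi : Prop :=
  let supp := closure [set x | phi x != 0] in
  [/\ smooth phi, compact supp & supp `<=` Omega].

(* u belongs to H^1(Omega) and G is its weak gradient (unique up to a null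
   set); functions stand for their classes modulo equality a.e. in Omega *)
Definition in_H1 Omega u G : Prop :=
  [/\ in_L2 Omega u,
      forall i, in_L2 Omega (fun x => G x ord0 i) &
      forall i phi, test_function Omega phi ->
        L2inner Omega u (partial i phi) =
        - L2inner Omega (fun x => G x ord0 i) phi].

Definition H1norm Omega u G : \bar R :=
  (sqrte (L2norm Omega u ^+ 2 +
          \sum_i L2norm Omega (fun x => G x ord0 i) ^+ 2))%E.

(* elements of H^1(Omega)^* are functionals on functions; only their values
   on H^1(Omega) matter *)
Definition H1dual_norm Omega l : \bar R :=
  ereal_sup [set z | exists u G,
    [/\ in_H1 Omega u G, (H1norm Omega u G <= 1)%E & z = `|l u|%:E]].

Definition in_H1dual Omega l : Prop :=
  (forall (a : R) u v G H, in_H1 Omega u G -> in_H1 Omega v H ->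
     l (fun x => a * u x + v x) = a * l u + l v) /\
  (H1dual_norm Omega l < +oo)%E.

Definition compact_H1_L2 Omega : Prop :=
  forall (u_ : nat -> 'rV[R]_d -> R) (G_ : nat -> 'rV[R]_d -> 'rV[R]_d) (M : R),
    (forall m, in_H1 Omega (u_ m) (G_ m)) ->
    (forall m, (H1norm Omega (u_ m) (G_ m) <= M%:E)%E) ->
    exists (s : nat -> nat) v,
      [/\ {homo s : i j / (i < j)%N}, in_L2 Omega v &
          L2norm Omega (fun x => u_ (s m) x - v x) @[m --> \oo] --> 0%E].

End function_spaces.

Section evolution_spaces.
Context (R : realType) (d : nat) (T : R) (Omega : set 'rV[R]_d).
Implicit Types (y phi : R -> 'rV[R]_d -> R).
Implicit Types (G : R -> 'rV[R]_d -> 'rV[R]_d).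
Implicit Types (F : R -> ('rV[R]_d -> R) -> R).

Definition ae_time (P : R -> Prop) : Prop :=
  {ae lebesgue_measure, forall t : R, `]0, T[%classic t -> P t}.

(* the norm of L^p(0,T;V), where N t is the V-norm of the value at t *)
Definition time_norm (p : \bar R) (N : R -> \bar R) : \bar R :=
  Lnorm lebesgue_measure p (N \_ `]0, T[).

Definition Q_T : set (measurableTypeR R * 'rV[R]_d) := `]0, T[ `*` Omega.

(* elements of L^p(0,T;L^2(Omega)) are represented, as usual, by functions that
   are jointly measurable on Q_T *)
Definition measurable_Q y : Prop :=
  measurable_fun Q_T (fun p : measurableTypeR R * 'rV[R]_d => y p.1 p.2).

Definition in_LpL2 (p : \bar R) y : Prop :=
  measurable_Q y /\ (time_norm p (fun t => L2norm Omega (y t)) < +oo)%E.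

(* G(t) is the weak gradient of y(t) on Omega for a.e. t in ]0, T[ *)
Definition space_grad y G : Prop :=
  [/\ measurable_Q y, forall i, measurable_Q (fun t x => G t x ord0 i) &
      ae_time (fun t => in_H1 Omega (y t) (G t))].

Definition gradQ_norm G : \bar R :=
  Lnorm (lebesgue_measure \x lebesgue_rV R d)%E 2%:E
    (EFin \o ((fun p : measurableTypeR R * 'rV[R]_d =>
                 Num.sqrt (dotv (G p.1 p.2) (G p.1 p.2))) \_ Q_T)).

Definition in_L2H1 phi G : Prop :=
  space_grad phi G /\
  (time_norm 2%:E (fun t => H1norm Omega (phi t) (G t)) < +oo)%E.

(* Bochner measurability with values in H^1(Omega)^* *)
Definition strongly_measurable F : Prop :=
  exists s : nat -> R -> ('rV[R]_d -> R) -> R,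
    [/\ forall m, finite_set (range (s m)),
        forall m l, measurable (s m @^-1` [set l]),
        forall m t, in_H1dual Omega (s m t) &
        ae_time (fun t =>
          H1dual_norm Omega (fun u => s m t u - F t u) @[m --> \oo] --> 0%E)].

Definition in_L2H1dual F : Prop :=
  [/\ strongly_measurable F, ae_time (fun t => in_H1dual Omega (F t)) &
      (time_norm 2%:E (fun t => H1dual_norm Omega (F t)) < +oo)%E].

Definition time_test (eta : R -> R) : Prop :=
  let supp := closure [set t | eta t != 0] in
  [/\ forall m t, derivable (derive1n m eta) t 1, compact supp &
      supp `<=` `]0, T[].

(* y' = F as H^1(Omega)^*-valued distributions on ]0, T[, where y(t) in
   L^2(Omega) acts on H^1(Omega) by the L^2 inner product; equality of the two
   Bochner integrals in H^1(Omega)^* is tested against all of H^1(Omega) *)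
Definition time_deriv y F : Prop :=
  forall eta, time_test eta -> forall v H, in_H1 Omega v H ->
    \int[lebesgue_measure]_(t in `]0, T[) (L2inner Omega (y t) v * derive1 eta t) =
    - \int[lebesgue_measure]_(t in `]0, T[) (F t v * eta t).

Definition scalar_deriv (k k' : R -> R) : Prop :=
  forall eta, time_test eta ->
    \int[lebesgue_measure]_(t in `]0, T[) (k t * derive1 eta t) =
    - \int[lebesgue_measure]_(t in `]0, T[) (k' t * eta t).

Definition in_Lp (p : \bar R) (k : R -> R) : Prop :=
  measurable_fun `]0, T[ k /\ (time_norm p (EFin \o k) < +oo)%E.

(* an element of X^2, given together with its weak derivatives, which are
   determined by X_y and X_kappa up to null sets *)
Record X2 (J : nat) := MkX2 {
  X_y : R -> 'rV[R]_d -> R;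
  X_grad : R -> 'rV[R]_d -> 'rV[R]_d;
  X_dy : R -> ('rV[R]_d -> R) -> R;
  X_kappa : 'I_J -> R -> R;
  X_dkappa : 'I_J -> R -> R;
  X_yP : in_LpL2 +oo X_y;
  X_gradP : space_grad X_y X_grad;
  X_grad_fin : (gradQ_norm X_grad < +oo)%E;
  X_dyP : in_L2H1dual X_dy;
  X_dyE : time_deriv X_y X_dy;
  X_kappaP : forall j, in_Lp +oo (X_kappa j);
  X_dkappaP : forall j, in_Lp 2%:E (X_dkappa j);
  X_dkappaE : forall j, scalar_deriv (X_kappa j) (X_dkappa j)
}.

Definition X2norm (J : nat) (z : X2 J) : \bar R :=
  (time_norm +oo (fun t => L2norm Omega (X_y z t)) +
   gradQ_norm (X_grad z) +
   time_norm 2%:E (fun t => H1dual_norm Omega (X_dy z t)) +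
   \sum_(j < J) (time_norm +oo (EFin \o X_kappa z j) +
                 time_norm 2%:E (EFin \o X_dkappa z j)))%E.

(* y(0) = y0 for the representative of y in C([0,T];L^2(Omega)) *)
Definition initial_value y (y0 : 'rV[R]_d -> R) : Prop :=
  exists z : R -> 'rV[R]_d -> R,
    [/\ forall t, `[0, T]%classic t -> in_L2 Omega (z t),
        forall t, `[0, T]%classic t ->
          L2norm Omega (fun x => z s x - z t x)
            @[s --> within `[0, T] (nbhs t)] --> 0%E,
        ae_time (fun t => L2norm Omega (fun x => z t x - y t x) = 0%E) &
        L2norm Omega (fun x => z 0 x - y0 x) = 0%E].

Definition scalar_initial_value (k : R -> R) (k0 : R) : Prop :=
  exists c : R -> R,
    [/\ {within `[0, T], continuous c}, ae_time (fun t => c t = k t) & c 0 = k0].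

End evolution_spaces.

Section thermostat.
Context (R : realType) (d : nat) (T : R) (Omega : set 'rV[R]_d) (J K : nat).

Record control := MkControl {
  g_ : 'I_J -> 'rV[R]_d -> R;
  h_ : 'I_K -> 'rV[R]_d -> R;
  alpha_ : 'I_J -> 'I_K -> R;
  g_L2 : forall j, in_L2 Omega (g_ j);
  h_L2 : forall k, in_L2 Omega (h_ k)
}.

Definition Unorm (c : control) : \bar R :=
  (sqrte (\sum_(j < J) L2norm Omega (g_ c j) ^+ 2 +
          \sum_(k < K) L2norm Omega (h_ c k) ^+ 2 +
          (\sum_(j < J) \sum_(k < K) alpha_ c j k ^+ 2)%R%:E))%E.

Definition X0norm (y0 : 'rV[R]_d -> R) (kappa0 : 'I_J -> R) : \bar R :=
  (sqrte (L2norm Omega y0 ^+ 2 + (\sum_(j < J) kappa0 j ^+ 2)%R%:E))%E.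

Definition W_ (w : 'I_K -> R -> R) (c : control) (j : 'I_J)
    (v vstar : 'rV[R]_d -> R) : R :=
  \sum_(k < K) alpha_ c j k *
    w k (L2inner Omega (h_ c k) (fun x => v x - vstar x)).

Definition weak_solution (f : R -> R) (w : 'I_K -> R -> R) (D : R)
    (beta : 'I_J -> R) (ystar : R -> 'rV[R]_d -> R) (c : control)
    (y0 : 'rV[R]_d -> R) (kappa0 : 'I_J -> R) (z : X2 T Omega J) : Prop :=
  [/\ initial_value T Omega (X_y z) y0,
      forall j, scalar_initial_value T (X_kappa z j) (kappa0 j),
      forall phi G, in_L2H1 T Omega phi G ->
        \int[lebesgue_measure]_(t in `]0, T[)
          (X_dy z t (phi t)
           + D * \int[lebesgue_rV R d]_(x in Omega) dotv (X_grad z t x) (G t x)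
           - L2inner Omega
               (fun x => f (X_y z t x) + \sum_(j < J) X_kappa z j t * g_ c j x)
               (phi t)) = 0 &
      forall j xi, in_Lp T 2%:E xi ->
        \int[lebesgue_measure]_(t in `]0, T[)
          ((beta j * X_dkappa z j t + X_kappa z j t
            - W_ w c j (X_y z t) (ystar t)) * xi t) = 0].

End thermostat.

(* Main.v *)
Require Import Defs.
From HB Require Import structures.
From mathcomp Require Import all_boot all_order all_algebra.
From mathcomp Require Import all_classical all_reals all_analysis.
From mathcomp Require Import measurable_realfun ess_sup_inf.
From mathcomp Require Import ring lra.
Import Order.TTheory GRing.Theory Num.Theory.
Import numFieldNormedType.Exports.
Local Open Scope classical_set_scope.
Local Open Scope ring_scope.

Set Implicit Arguments.
Unset Strict Implicit.
Unset Printing Implicit Defensive.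

(** Testing the weak formulation with [1_B(t) v(x)] shows that for almost every
    [t] the functional [y'(t)] is [v |-> (p(t), v) - D (grad y(t), grad v)], where
    [p = f(y) + \sum_j kappa_j g_j]; hence the continuous representative [z] of
    [y] satisfies [(z(t) - z(s), v) = \int_s^t <y', v>] for all [v] in [H^1].
    Taking [v = y(t)] and [s = t - h], dividing by [h], integrating over [t] and
    letting [h] tend to [0] gives the energy inequality
    [|z(b)|^2 + 2 D \int_0^b |grad y|^2 <= |z(0)|^2 + \int_0^b (|p|^2 + |y|^2)].
    The ODEs bound [kappa_j'] by [|y|], [|y*|] and [|kappa|], so Gronwall's
    inequality applies to [|z|^2 + \sum_j kappa_j^2].  The bounds on the gradient,
    on [kappa_j'] and, through the formula for [y'(t)], on the dual norm follow. *)

(** The formula for [y'(t)] holds off a null set of times that depends on the test function [v], so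
    [v = y(t)] cannot be inserted into it directly. Its integrated form is free of this defect: [z]
    is continuous, so for fixed [v] the increment formula holds for every pair of times, and [v] may
    then be chosen after [t]. This takes the place of a chain rule for [|y(t)|^2], and only an
    inequality is wanted from it. Elements of the dual of H^1 are arbitrary functions on functions,
    so [t |-> F t (phi t)] is not known to be measurable; such integrands are handled through almost
    everywhere equality alone. Null sets that depend on [v] also stand between the formula for
    [y'(t)] and its dual norm, until the norm is reduced to countably many test functions. The
    constant has to be fixed before the dimension and the domain. For this reason the last estimate
    speaks of real functions of time only, and the domain enters it through numerical bounds. *)

(** * Real-valued integrals and localization *)

Section real_integrals.
Context (R : realType) (dX : measure_display) (X : measurableType dX).
Variable m : {measure set X -> \bar R}.

Lemma integrable_addR (D : set X) (f g : X -> R) : measurable D ->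
  m.-integrable D (EFin \o f) -> m.-integrable D (EFin \o g) ->
  m.-integrable D (EFin \o (fun x => f x + g x)).
Proof. by move=> mD fi gi; have := integrableD mD fi gi; exact: eq_integrable. Qed.

Lemma integrable_subR (D : set X) (f g : X -> R) : measurable D ->
  m.-integrable D (EFin \o f) -> m.-integrable D (EFin \o g) ->
  m.-integrable D (EFin \o (fun x => f x - g x)).
Proof. by move=> mD fi gi; have := integrableB mD fi gi; exact: eq_integrable. Qed.

Lemma integrable_scaleR (D : set X) (a : R) (f : X -> R) : measurable D ->
  m.-integrable D (EFin \o f) -> m.-integrable D (EFin \o (fun x => a * f x)).
Proof. by move=> mD fi; have := integrableZl mD a fi; exact: eq_integrable. Qed.

Lemma ae_le_Rintegral (D : set X) (f g : X -> R) : measurable D ->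
  m.-integrable D (EFin \o f) -> m.-integrable D (EFin \o g) ->
  {ae m, forall x, D x -> f x <= g x} ->
  \int[m]_(x in D) f x <= \int[m]_(x in D) g x.
Proof.
move=> mD fi gi fg; rewrite -subr_ge0 -RintegralB//.
have mgf : measurable_fun D (fun x => g x - f x).
  by apply: measurable_funB; apply/measurable_EFinP; apply: measurable_int;
    [exact: gi|exact: fi].
rewrite /Rintegral.
rewrite (@ae_eq_integral _ _ _ _ D (fun x => (Num.max (g x - f x) 0)%:E))//.
- by apply: fine_ge0; apply: integral_ge0 => x _; rewrite lee_fin le_max lexx orbT.
- exact/measurable_EFinP.
- by apply/measurable_EFinP; apply: measurable_maxr.
- apply: filterS fg => x /[apply] fgx.
  by rewrite max_l// subr_ge0.
Qed.

(** Both weak formulations, tested with indicators of sets of times, become identities for almost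
    every time through this localization. *)
Lemma null_integral_ae0 (D : set X) (f : X -> R) : measurable D ->
  measurable_fun D f -> (m D < +oo)%E ->
  (forall B, measurable B -> B `<=` D -> \int[m]_(x in B) f x = 0) ->
  {ae m, forall x, D x -> f x = 0}.
Proof.
move=> mD mf Doo f0.
have half (g : X -> R) : measurable_fun D g ->
    (forall B, measurable B -> B `<=` D -> m.-integrable B (EFin \o g) ->
      \int[m]_(x in B) g x = 0) ->
    {ae m, forall x, D x -> g x <= 0}.
  move=> mg g0.
  (* Above the lower level a zero integral forces measure zero; below the upper level [g] is
     bounded, hence integrable on a set of finite measure. *)
  pose B (n : nat) := D `&` g @^-1` `[n.+1%:R^-1, n.+1%:R]%classic.
  have mB n : measurable (B n) by apply: mg.
  have BD n : B n `<=` D by move=> x [].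
  have B0 n : m (B n) = 0%E.
    have Boo : (m (B n) < +oo)%E.
      by apply: le_lt_trans Doo; apply: le_measure; rewrite ?inE.
    have n0 : 0 < n.+1%:R^-1 :> R by rewrite invr_gt0.
    have ig : m.-integrable (B n) (EFin \o g).
      apply: measurable_bounded_integrable => //.
        exact: measurable_funS mg.
      exists n.+1%:R; split => // M nM x [_] /=; rewrite in_itv/= => /andP[a b].
      rewrite ger0_norm; first exact: le_trans b (ltW nM).
      exact: le_trans (ltW n0) a.
    have : \int[m]_(x in B n) (cst (n.+1%:R^-1) x) <= \int[m]_(x in B n) g x.
      apply: le_Rintegral => //.
        apply: measurable_bounded_integrable => //.
        by exists `|n.+1%:R^-1|; split => // M nM x _; exact: ltW.
      by move=> x [_] /=; rewrite in_itv/= => /andP[].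
    rewrite (g0 _ (mB n) (BD n) ig) Rintegral_cst// pmulr_rle0// => h.
    have fB : m (B n) \is a fin_num by rewrite ge0_fin_numE.
    by apply/eqP; rewrite -(fineK fB) eqe eq_le h fine_ge0.
  have : m.-negligible (\bigcup_n B n).
    by apply: negligible_bigcup => n; exists (B n); split.
  move=> [N [mN N0 BN]]; exists N; split => // x /= /not_implyP[Dx] /negP.
  rewrite -ltNge => gx; apply: BN.
  exists (maxn (Num.truncn (g x)) (Num.truncn (g x)^-1)) => //; split => //=.
  rewrite in_itv/=; apply/andP; split.
    rewrite invf_ple ?posrE//; apply: le_trans (ltW (truncnS_gt _)) _.
    by rewrite ler_nat ltnS leq_maxr.
  apply: le_trans (ltW (truncnS_gt _)) _.
  by rewrite ler_nat ltnS leq_maxl.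
have h1 := half _ mf (fun B mB BD _ => f0 B mB BD).
have h2 : {ae m, forall x, D x -> - f x <= 0}.
  apply: half; first exact: measurableT_comp mf.
  move=> B mB BD /(integrable_scaleR (-1) mB) ifB.
  have ifB' : m.-integrable B (EFin \o f).
    by apply: eq_integrable ifB => // x _ /=; rewrite mulN1r opprK.
  under eq_Rintegral do rewrite -mulN1r.
  by rewrite RintegralZl// f0// mulr0.
by apply: filterS2 h1 h2 => x + + Dx => /(_ Dx) a /(_ Dx) b; lra.
Qed.

End real_integrals.

(** * Square-integrable functions and their inner product *)

Section square_integrable.
Context (R : realType) (dX : measure_display) (X : measurableType dX).
Variable m : {measure set X -> \bar R}.
Implicit Types u v : X -> R.

(** Functions are defined on the whole space and not taken modulo null sets. Members of L^2(Omega)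
    enter extended by zero, so the algebra below carries no domain. *)
Definition L2 u := measurable_fun setT u /\
  m.-integrable setT (fun x => (u x ^+ 2)%:E).

Definition ip u v : R := \int[m]_x (u x * v x).

Lemma L2_lty u : measurable_fun setT u ->
  (\int[m]_x (u x ^+ 2)%:E < +oo)%E -> L2 u.
Proof.
move=> mu ui; split => //; apply/integrableP; split.
  by apply/measurable_EFinP; exact: measurable_funX.
rewrite (eq_integral (fun x => (u x ^+ 2)%:E))// => x _.
by rewrite gee0_abs// lee_fin sqr_ge0.
Qed.

Lemma L2_integral_lty u : L2 u -> (\int[m]_x (u x ^+ 2)%:E < +oo)%E.
Proof.
move=> [mu /integrableP[_]].
rewrite (eq_integral (fun x => (u x ^+ 2)%:E))// => x _.
by rewrite gee0_abs// lee_fin sqr_ge0.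
Qed.

Lemma L2_dominated u (g : X -> R) : measurable_fun setT u ->
  m.-integrable setT (EFin \o g) -> (forall x, u x ^+ 2 <= g x) -> L2 u.
Proof.
move=> mu ig ug; split => //; apply: le_integrable ig => //.
  by apply/measurable_EFinP; exact: measurable_funX.
move=> x _ /=; rewrite lee_fin ger0_norm ?sqr_ge0//.
by rewrite (le_trans (ug x))// ler_norm.
Qed.

Lemma L2_prod u v : L2 u -> L2 v ->
  m.-integrable setT (fun x => (u x * v x)%:E).
Proof.
move=> [mu iu] [mv iv]; have := integrableD measurableT iu iv.
apply: le_integrable => //.
  by apply/measurable_EFinP; exact: measurable_funM.
move=> x _ /=; rewrite lee_fin [leRHS]ger0_norm ?addr_ge0 ?sqr_ge0//.
rewrite normrM -(real_normK (num_real (u x))) -(real_normK (num_real (v x))).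
have := sqr_ge0 (`|u x| - `|v x|).
have := sqr_ge0 (`|u x|); have := sqr_ge0 (`|v x|); nra.
Qed.

Lemma L2_add u v : L2 u -> L2 v -> L2 (fun x => u x + v x).
Proof.
move=> Lu Lv; apply: (@L2_dominated _ (fun x => u x ^+ 2 + v x ^+ 2 +
    (u x * v x + u x * v x))).
- by apply: measurable_funD; [exact: Lu.1|exact: Lv.1].
- by apply: integrable_addR => //; apply: integrable_addR => //;
    [exact: Lu.2|exact: Lv.2|exact: L2_prod|exact: L2_prod].
- by move=> x; nra.
Qed.

Lemma L2_scale (a : R) u : L2 u -> L2 (fun x => a * u x).
Proof.
move=> Lu; apply: (@L2_dominated _ (fun x => a ^+ 2 * (u x ^+ 2))).
- by apply: measurable_funM => //; exact: Lu.1.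
- by have := integrableZl measurableT (a ^+ 2) Lu.2; apply: eq_integrable.
- by move=> x; nra.
Qed.

Lemma L2_opp u : L2 u -> L2 (fun x => - u x).
Proof.
by move=> /(L2_scale (-1)); under eq_fun do rewrite mulN1r.
Qed.

Lemma L2_sub u v : L2 u -> L2 v -> L2 (fun x => u x - v x).
Proof. by move=> Lu /L2_opp; exact: L2_add. Qed.

Lemma L2_0 : L2 (fun=> 0).
Proof.
split; first exact: measurable_cst.
by rewrite expr0n; exact: integrable0.
Qed.

Lemma L2_sum (I : Type) (s : seq I) (F : I -> X -> R) :
  (forall i, L2 (F i)) -> L2 (fun x => \sum_(i <- s) F i x).
Proof.
move=> LF; elim: s => [|i s IH].
  by under eq_fun do rewrite big_nil; exact: L2_0.
by under eq_fun do rewrite big_cons; exact: L2_add.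
Qed.

Lemma ipC u v : ip u v = ip v u.
Proof. by apply: eq_Rintegral => x _; rewrite mulrC. Qed.

Lemma ipDl u v w : L2 u -> L2 v -> L2 w ->
  ip (fun x => u x + v x) w = ip u w + ip v w.
Proof.
move=> Lu Lv Lw; rewrite /ip -RintegralD//; try exact: L2_prod.
by apply: eq_Rintegral => x _; rewrite mulrDl.
Qed.

Lemma ipZl (a : R) u w : L2 u -> L2 w ->
  ip (fun x => a * u x) w = a * ip u w.
Proof.
move=> Lu Lw; rewrite /ip -RintegralZl//; try exact: L2_prod.
by apply: eq_Rintegral => x _; rewrite mulrA.
Qed.

Lemma ipBl u v w : L2 u -> L2 v -> L2 w ->
  ip (fun x => u x - v x) w = ip u w - ip v w.
Proof.
move=> Lu Lv Lw; rewrite /ip -RintegralB//; try exact: L2_prod.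
by apply: eq_Rintegral => x _; rewrite mulrBl.
Qed.

Lemma ipDr u v w : L2 u -> L2 v -> L2 w ->
  ip w (fun x => u x + v x) = ip w u + ip w v.
Proof. by move=> *; rewrite ipC ipDl// ![ip _ w]ipC. Qed.

Lemma ipBr u v w : L2 u -> L2 v -> L2 w ->
  ip w (fun x => u x - v x) = ip w u - ip w v.
Proof. by move=> *; rewrite ipC ipBl// ![ip _ w]ipC. Qed.

Lemma ipZr (a : R) u w : L2 u -> L2 w ->
  ip w (fun x => a * u x) = a * ip w u.
Proof. by move=> *; rewrite ipC ipZl// ipC. Qed.

Lemma ip_ge0 u : 0 <= ip u u.
Proof. by apply: Rintegral_ge0 => x _; rewrite -expr2 sqr_ge0. Qed.

Lemma ip_sqrE u : L2 u -> (\int[m]_x (u x ^+ 2)%:E = (ip u u)%:E)%E.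
Proof.
move=> Lu; rewrite /ip /Rintegral fineK.
  by apply: eq_integral => x _; rewrite expr2.
exact/integrable_fin_num/L2_prod.
Qed.

Lemma ip_addsq u v : L2 u -> L2 v ->
  ip (fun x => u x + v x) (fun x => u x + v x) =
  ip u u + 2 * ip u v + ip v v.
Proof.
move=> Lu Lv; have Luv := L2_add Lu Lv.
by rewrite ipDl// !ipDr// (ipC v u); ring.
Qed.

Lemma ip_subsq u v : L2 u -> L2 v ->
  ip (fun x => u x - v x) (fun x => u x - v x) =
  ip u u - 2 * ip u v + ip v v.
Proof.
move=> Lu Lv; have Luv := L2_sub Lu Lv.
by rewrite ipBl// !ipBr// (ipC v u); ring.
Qed.

Lemma ip_young u v : L2 u -> L2 v -> 2 * ip u v <= ip u u + ip v v.
Proof.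
by move=> Lu Lv; have := ip_ge0 (fun x => u x - v x); rewrite ip_subsq//; lra.
Qed.

Lemma ip_addsq_le u v : L2 u -> L2 v ->
  ip (fun x => u x + v x) (fun x => u x + v x) <= 2 * ip u u + 2 * ip v v.
Proof. by move=> Lu Lv; rewrite ip_addsq//; have := ip_young Lu Lv; lra. Qed.

(** Nonnegativity of [|a u - b v|^2] at [a = (v, v)], [b = (u, v)], where a factor [(v, v)] can be
    divided out. *)
Lemma cauchy_schwarz_sqr u v : L2 u -> L2 v ->
  ip u v ^+ 2 <= ip u u * ip v v.
Proof.
move=> Lu Lv.
have key (a b : R) : 0 <= a ^+ 2 * ip u u - 2 * (a * b) * ip u v + b ^+ 2 * ip v v.
  have La := L2_scale a Lu; have Lb := L2_scale b Lv.
  have := ip_ge0 (fun x => a * u x - b * v x).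
  by rewrite ip_subsq// !(ipZl, ipZr)//; nra.
have u0 := ip_ge0 u; have v0 := ip_ge0 v.
have [vz|vz] := eqVneq (ip v v) 0.
  (* If [(v, v) = 0], this choice of [b] makes the quadratic form equal to [-3 (u, v)^2], so
     [(u, v)] vanishes. *)
  have k1 := key (ip u v) ((ip u u + 1) / 2 + 1).
  rewrite vz in k1 *; nra.
have := key (ip v v) (ip u v).
rewrite (_ : _ + _ = ip v v * (ip u u * ip v v - ip u v ^+ 2)); last by ring.
by rewrite pmulr_rge0 ?lt_neqAle ?v0 1?eq_sym ?vz// subr_ge0.
Qed.

Lemma cauchy_schwarz u v : L2 u -> L2 v ->
  `|ip u v| <= Num.sqrt (ip u u) * Num.sqrt (ip v v).
Proof.
move=> Lu Lv; rewrite -sqrtrM ?ip_ge0// -sqrtr_sqr.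
by rewrite ler_wsqrtr// cauchy_schwarz_sqr.
Qed.

Lemma ip_ae_eq u u' v v' : measurable_fun setT u -> measurable_fun setT u' ->
  measurable_fun setT v -> measurable_fun setT v' ->
  {ae m, forall x, u x = u' x} -> {ae m, forall x, v x = v' x} ->
  ip u v = ip u' v'.
Proof.
move=> mu mu' mv mv' uu' vv'; rewrite /ip /Rintegral; congr fine.
apply: ae_eq_integral => //.
- exact/measurable_EFinP/measurable_funM.
- exact/measurable_EFinP/measurable_funM.
- by apply: filterS2 uu' vv' => x -> ->.
Qed.

Lemma ip_sub_eq0 u v : L2 u -> L2 v ->
  ip (fun x => u x - v x) (fun x => u x - v x) = 0 -> {ae m, forall x, u x = v x}.
Proof.
move=> Lu Lv h; have Luv := L2_sub Lu Lv.
have mq : measurable_fun setT (fun x => ((u x - v x) ^+ 2)%:E).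
  by apply/measurable_EFinP/measurable_funX; exact: Luv.1.
have := (ae_eq_integral_abs m measurableT mq).1.
have -> : (\int[m]_x `|((u x - v x) ^+ 2)%:E| = 0)%E.
  rewrite (eq_integral (fun x => ((u x - v x) ^+ 2)%:E)).
    by rewrite ip_sqrE// h.
  by move=> x _; rewrite gee0_abs// lee_fin sqr_ge0.
move=> /(_ erefl); apply: filterS => x /(_ I) [] /eqP.
by rewrite sqrf_eq0 subr_eq0 => /eqP.
Qed.

End square_integrable.

(** * A smooth step function on the line *)

Section smooth_steps.
Context (R : realType).
Implicit Types (f g : R -> R) (q : {poly R}).

(** The rules below are stated on lambda terms, so that derivatives are built by application and
    brought to the wanted form at the end by [has_deriv_eq]. *)
Definition has_deriv f (x df : R) : Prop := is_derive x (1 : R) f df.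

Lemma has_deriv_eq f x df df' : has_deriv f x df -> df = df' -> has_deriv f x df'.
Proof. by move=> h <-. Qed.

Lemma has_deriv_add f g x df dg : has_deriv f x df -> has_deriv g x dg ->
  has_deriv (fun x => f x + g x) x (df + dg).
Proof. exact: is_deriveD. Qed.

Lemma has_deriv_sub f g x df dg : has_deriv f x df -> has_deriv g x dg ->
  has_deriv (fun x => f x - g x) x (df - dg).
Proof. exact: is_deriveB. Qed.

Lemma has_deriv_mul f g x df dg : has_deriv f x df -> has_deriv g x dg ->
  has_deriv (fun x => f x * g x) x (df * g x + f x * dg).
Proof.
move=> hf hg; apply: has_deriv_eq (is_deriveM hf hg) _.
by rewrite /GRing.scale/= addrC mulrC.
Qed.

Lemma has_deriv_comp f g x df dg : has_deriv f (g x) df -> has_deriv g x dg ->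
  has_deriv (fun x => f (g x)) x (df * dg).
Proof.
move=> hf hg.
exact: (@is_derive1_comp _ f g x _ _ hf hg).
Qed.

Lemma has_deriv_cst (a x : R) : has_deriv (fun=> a) x 0.
Proof. exact: is_derive_cst. Qed.

Lemma has_deriv_id (x : R) : has_deriv (fun x => x) x 1.
Proof. exact: is_derive_id. Qed.

Lemma has_deriv_derivable f x df : has_deriv f x df -> derivable f x 1.
Proof. by case. Qed.

Lemma has_deriv_derive1 f x df : has_deriv f x df -> f^`()%classic x = df.
Proof. by move=> h; rewrite derive1E; exact: (@derive_val _ _ _ _ _ _ _ h). Qed.

Lemma derivable_has_deriv f x : derivable f x 1 -> has_deriv f x (f^`()%classic x).
Proof. by move=> /derivableP; rewrite derive1E. Qed.

Lemma has_deriv_continuous f x df : has_deriv f x df -> {for x, continuous f}.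
Proof.
by move=> /has_deriv_derivable h; exact/differentiable_continuous/derivable1_diffP.
Qed.

(* The functions [q(1/x) exp(-1/x)], extended by [0], are closed under derivation. *)
Definition flat q (x : R) : R :=
  if 0 < x then q.[x^-1] * expR (- x^-1) else 0.

Lemma flat_pos q x : 0 < x -> flat q x = q.[x^-1] * expR (- x^-1).
Proof. by rewrite /flat => ->. Qed.

Lemma flat_nonpos q x : x <= 0 -> flat q x = 0.
Proof. by rewrite /flat leNgt => /negbTE ->. Qed.

(** Induction on the polynomial: half of the rate [k] bounds [q], and the other half absorbs the new
    factor [y] through [1 + x <= expR x]. *)
Lemma poly_expR_bound q (k : R) : 0 < k ->
  exists2 C, 0 <= C & forall y, 0 <= y -> `|q.[y]| <= C * expR (k * y).
Proof.
elim/poly_ind: q k => [|q c IH] k k0.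
  by exists 0 => // y y0; rewrite horner0 normr0 mul0r.
have k2 : 0 < k / 2 by rewrite divr_gt0.
have [C C0 qC] := IH _ k2.
exists (C * (k / 2)^-1 + `|c|).
  by rewrite addr_ge0 ?normr_ge0// mulr_ge0// invr_ge0 ltW.
move=> y y0; rewrite hornerMXaddC; apply: le_trans (ler_normD _ _) _.
rewrite mulrDl lerD//; last first.
  rewrite ler_peMr ?normr_ge0// -expR0 ler_expR.
  by rewrite mulr_ge0// ltW.
rewrite normrM (ger0_norm y0).
have -> : k * y = k / 2 * y + k / 2 * y by field.
rewrite expRD -mulrA mulrA [C * _ * _]mulrA.
have yE : y <= (k / 2)^-1 * expR (k / 2 * y).
  rewrite ler_pdivlMl//; apply: le_trans (expR_ge1Dx _).
  by rewrite lerDr ler01.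
have e0 := expR_gt0 (k / 2 * y).
have := qC y y0 => qCy.
apply: le_trans (ler_pM _ _ qCy yE) _ => //.
by rewrite -!mulrA ler_wpM2l// mulrCA.
Qed.

(** The exponential bound applied to ['X^2 * q] at [1/x]. The factor [x ^+ 2] is what yields a zero
    derivative at the junction point 0. *)
Lemma flat_bound q : exists2 C, 0 <= C & forall x, `|flat q x| <= C * x ^+ 2.
Proof.
have [C C0 qC] := poly_expR_bound ('X^2 * q) (@ltr01 R).
exists C => // x; rewrite /flat; case: ifPn => [x0|_]; last first.
  by rewrite normr0 mulr_ge0// sqr_ge0.
have := qC x^-1; rewrite invr_ge0 (ltW x0) mul1r => /(_ isT).
rewrite hornerM hornerXn normrM normrX (gtr0_norm (x := x^-1)) ?invr_gt0// => h.
rewrite normrM (gtr0_norm (expR_gt0 _)) expRN ler_pdivrMr ?expR_gt0//.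
move: h; rewrite exprVn mulrC ler_pdivrMr ?exprn_gt0//.
by rewrite mulrAC.
Qed.

Lemma quadratic_has_deriv0 f C : (forall x, `|f x| <= C * x ^+ 2) ->
  has_deriv f 0 0.
Proof.
move=> fC; have f0 : f 0 = 0.
  by have := fC 0; rewrite expr0n mulr0 normr_le0 => /eqP.
have lim0 : h^-1 *: ((f \o shift 0) (h *: (1 : R)) - f 0) @[h --> 0^'] --> (0 : R).
  apply: norm_cvg0.
  have C0 : C * `|h| @[h --> (0 : R)^'] --> (0 : R).
    rewrite -[X in _ --> X](mulr0 C); apply: cvgM; first exact: cvg_cst.
    rewrite -[X in _ --> X](normr0 R); apply: cvg_norm.
    exact: cvg_within.
  apply: (squeeze_cvgr _ (cvg_cst 0) C0).
  near=> h; rewrite normr_ge0/= f0 subr0 /GRing.scale/= mulr1 addr0 normrM normfV.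
  have h0 : h != 0 by near: h; exact: nbhs_dnbhs_neq.
  rewrite ler_pdivrMl ?normr_gt0//; apply: le_trans (fC h) _.
  by rewrite -(real_normK (num_real h)) expr2 mulrCA.
by apply: DeriveDef; [apply/cvg_ex; exists 0|apply/cvg_lim].
Unshelve. all: by end_near. Qed.

(** For positive arguments differentiation acts on the polynomial as [q |-> X^2 (q - q')]. At 0 the
    quadratic bound gives derivative 0, which is the value of the new function there. *)
Lemma has_deriv_flat q (x : R) :
  has_deriv (flat q) x (flat ('X^2 * (q - q^`())) x).
Proof.
have [x0|x0|<-] := ltgtP 0 x.
- have x1 : x != 0 by rewrite gt_eqF.
  apply: (@near_eq_is_derive _ _ _ (fun y : R => q.[y^-1] * expR (- y^-1))).
    near=> y; rewrite flat_pos//; near: y.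
    exact: lt_nbhsr.
  have dV : has_deriv (fun y : R => y^-1) x (- x ^- 2).
    have := @is_deriveV R id x 1 1 x1 (is_derive_id _ _).
    by rewrite /GRing.scale/= mulr1.
  have dq : has_deriv (fun y : R => q.[y^-1]) x (q^`().[x^-1] * (- x ^- 2)).
    by apply: has_deriv_comp dV; exact: is_derive_poly.
  have dN : has_deriv (fun y : R => - y^-1) x (x ^- 2).
    by rewrite -[X in has_deriv _ _ X]opprK; exact: is_deriveN dV.
  have de := has_deriv_comp (g := fun y : R => - y^-1) (is_derive_expR (- x^-1)) dN.
  apply: has_deriv_eq (has_deriv_mul dq de) _.
  by rewrite flat_pos// hornerM hornerXn hornerD hornerN exprVn; ring.
- rewrite [X in has_deriv _ _ X]flat_nonpos ?ltW//.
  have h := has_deriv_cst 0 x; apply: near_eq_is_derive h.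
  near=> y; rewrite flat_nonpos//; apply: ltW; near: y.
  exact: lt_nbhsl.
- rewrite [X in has_deriv _ _ X]flat_nonpos//; have [C _ qC] := flat_bound q.
  exact: quadratic_has_deriv0 qC.
Unshelve. all: by end_near. Qed.

Definition smooth1 f := forall n t, derivable (derive1n n f) t 1.

(** Spares closed formulas for iterated derivatives: a single derivative has to be computed, inside
    a class closed under derivation. *)
Lemma smooth1_coind (P : (R -> R) -> Prop) :
  (forall f, P f -> (forall x, derivable f x 1) /\ P f^`()%classic) ->
  forall f, P f -> smooth1 f.
Proof.
move=> H f Pf n; have : P (derive1n n f).
  by elim: n => [|n IH]//; rewrite derive1nS; exact: (H _ IH).2.
by move=> /H[].
Qed.

Lemma smooth1_derive f : smooth1 f -> smooth1 f^`()%classic.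
Proof. by move=> sf n t; rewrite -derive1Sn; exact: sf. Qed.

Lemma smooth1_prim f : (forall x, derivable f x 1) -> smooth1 f^`()%classic ->
  smooth1 f.
Proof.
by move=> df sf [|n] t; [exact: df|rewrite derive1Sn; exact: sf].
Qed.

Lemma smooth1_continuous f : smooth1 f -> continuous f.
Proof.
by move=> sf x; apply/differentiable_continuous/derivable1_diffP; exact: sf 0%N x.
Qed.

Lemma has_deriv_affine f (a b s x : R) : derivable f (b * (x - s)) 1 ->
  has_deriv (fun x => a * f (b * (x - s))) x (a * b * f^`()%classic (b * (x - s))).
Proof.
move=> /derivable_has_deriv df.
have d2 : has_deriv (fun x => b * (x - s)) x b.
  apply: has_deriv_eq (has_deriv_mul (has_deriv_cst b x)
    (has_deriv_sub (has_deriv_id x) (has_deriv_cst s x))) _.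
  by ring.
apply: has_deriv_eq (has_deriv_mul (has_deriv_cst a x) (has_deriv_comp (g := fun x => b * (x - s)) df d2)) _.
by ring.
Qed.

Lemma smooth1_affine f (a b s : R) : smooth1 f ->
  smooth1 (fun x => a * f (b * (x - s))).
Proof.
move=> sf; apply: (@smooth1_coind (fun g => exists f a, smooth1 f /\
  g = fun x => a * f (b * (x - s)))); last by exists f, a.
move=> g [{}f [{}a [{}sf ->]]]; split=> [x|].
  exact: has_deriv_derivable (has_deriv_affine a (sf 0%N (b * (x - s)))).
exists f^`()%classic, (a * b); split; first exact: smooth1_derive.
by apply/funext => x; apply/has_deriv_derive1/has_deriv_affine; exact: sf 0%N _.
Qed.

Lemma smooth1_sub f g : smooth1 f -> smooth1 g -> smooth1 (fun x => f x - g x).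
Proof.
move=> sf sg; apply: (@smooth1_coind (fun h => exists f g, smooth1 f /\ smooth1 g /\
  h = fun x => f x - g x)); last by exists f, g.
move=> h [{}f [{}g [{}sf [{}sg ->]]]].
have D x := has_deriv_sub (derivable_has_deriv (sf 0%N x)) (derivable_has_deriv (sg 0%N x)).
split=> [x|]; first exact: has_deriv_derivable (D x).
exists f^`()%classic, g^`()%classic; split; first exact: smooth1_derive.
split; first exact: smooth1_derive.
by apply/funext => x; exact: has_deriv_derive1 (D x).
Qed.

(** Derivatives of the bump [flat 1 x * flat 1 (1 - x)] are no longer single products but remain
    finite sums of such products; this is the class to which [smooth1_coind] applies. *)
Inductive bumplike : (R -> R) -> Prop :=
| bumplike_prod p q : bumplike (fun x => flat p x * flat q (1 - x))
| bumplike_add f g : bumplike f -> bumplike g -> bumplike (fun x => f x + g x).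

Lemma bumplike_smooth f : bumplike f -> smooth1 f.
Proof.
apply: smooth1_coind => {}f; elim=> [p q|{}f g _ [df bf] _ [dg bg]].
  have D x : has_deriv (fun x => flat p x * flat q (1 - x)) x
     (flat ('X^2 * (p - p^`())) x * flat q (1 - x) +
      flat p x * flat (- ('X^2 * (q - q^`()))) (1 - x)).
    have d1 : has_deriv (fun x : R => 1 - x) x (-1).
      by have := has_deriv_sub (has_deriv_cst 1 x) (has_deriv_id x); rewrite sub0r.
    have d2 := has_deriv_comp (g := fun x : R => 1 - x) (has_deriv_flat q (1 - x)) d1.
    apply: has_deriv_eq (has_deriv_mul (has_deriv_flat p x) d2) _.
    by rewrite /flat; do !case: ifP => _; rewrite ?hornerN; ring.
  split=> [x|]; first exact: has_deriv_derivable (D x).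
  rewrite (_ : _^`()%classic = fun x => flat ('X^2 * (p - p^`())) x * flat q (1 - x) +
      flat p x * flat (- ('X^2 * (q - q^`()))) (1 - x)).
    by apply: bumplike_add; exact: bumplike_prod.
  by apply/funext => x; exact: has_deriv_derive1 (D x).
have D x := has_deriv_add (derivable_has_deriv (df x)) (derivable_has_deriv (dg x)).
split=> [x|]; first exact: has_deriv_derivable (D x).
rewrite (_ : _^`()%classic = fun x => f^`()%classic x + g^`()%classic x).
  exact: bumplike_add.
by apply/funext => x; exact: has_deriv_derive1 (D x).
Qed.

(** A bump vanishing outside []0, 1[], integrated from minus infinity and divided by its total mass.
    The mean value theorem gives positivity of the mass, monotonicity, and constancy beyond 1. *)
Lemma smooth_step : exists sigma : R -> R,
  [/\ smooth1 sigma, forall x, x <= 0 -> sigma x = 0,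
      forall x, 1 <= x -> sigma x = 1,
      forall x, 0 <= sigma x <= 1 &
      forall x, 0 <= sigma^`()%classic x /\
        (~~ (0 < x < 1) -> sigma^`()%classic x = 0)].
Proof.
pose rho x := flat 1 x * flat 1 (1 - x).
have rho_s : smooth1 rho by apply: bumplike_smooth; exact: bumplike_prod.
have flat0 x : 0 <= flat 1 x.
  by rewrite /flat; case: ifP => // _; rewrite hornerC mul1r expR_ge0.
have rho0 x : 0 <= rho x by rewrite mulr_ge0.
have rhoz x : ~~ (0 < x < 1) -> rho x = 0.
  rewrite negb_and /rho /flat subr_gt0 => /orP[/negbTE ->|/negbTE ->];
    by rewrite ?mul0r ?mulr0.
have rhop x : 0 < x < 1 -> 0 < rho x.
  move=> /andP[x0 x1]; rewrite /rho /flat x0 subr_gt0 x1.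
  by rewrite !hornerC !mul1r mulr_gt0// expR_gt0.
have rho_c := smooth1_continuous rho_s.
have rho_i : lebesgue_measure.-integrable setT (EFin \o rho).
  have : lebesgue_measure.-integrable `[0, 1] (EFin \o rho).
    apply: continuous_compact_integrable; first exact: segment_compact.
    exact: continuous_subspaceT.
  rewrite integrable_mkcond//; apply: eq_integrable => // x _.
  rewrite patchE; case: ifPn => //; rewrite notin_setE /= in_itv/= => /negP h.
  rewrite rhoz//; apply: contra h => /andP[a b].
  by rewrite (ltW a) (ltW b).
pose F x := \int[lebesgue_measure]_(t in `]-oo, x]) rho t.
have DF x : has_deriv F x (rho x).
  have [] := @continuous_FTC1 _ rho -oo%O x (x + 1) _ _ _ (rho_c x).
  - by rewrite ltrDl.
  - exact: integrableS rho_i.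
  - by rewrite ltNyr.
  - by move=> dF <-; exact: derivable_has_deriv dF.
have Fmono x y : x < y -> exists2 c, x < c < y & F y - F x = rho c * (y - x).
  move=> xy; have [|c] := MVT xy (fun z _ => DF z).
    apply: derivable_within_continuous => z _.
    exact: has_deriv_derivable (DF z).
  by rewrite in_itv/= => cxy ->; exists c.
have F0 x : x <= 0 -> F x = 0.
  move=> x0; rewrite /F (@eq_Rintegral _ _ _ _ _ (cst 0)).
    by rewrite Rintegral_cst// mul0r.
  move=> t; rewrite inE/= in_itv/= => tx; rewrite rhoz//.
  by rewrite negb_and -leNgt (le_trans tx x0).
have I0 : 0 < F 1.
  have [c c01] := Fmono 0 1 ltr01; rewrite (F0 0)// !subr0 mulr1 => ->.
  exact: rhop.
have F1 x : 1 <= x -> F x = F 1.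
  rewrite le_eqVlt => /orP[/eqP <-//|x1].
  have [c /andP[c1 _]] := Fmono 1 x x1.
  rewrite rhoz ?mul0r; first by move=> /eqP; rewrite subr_eq0 => /eqP.
  by rewrite negb_and -!leNgt (ltW c1) orbT.
have Fle x y : x <= y -> F x <= F y.
  rewrite le_eqVlt => /orP[/eqP ->//|xy].
  have [c _ e] := Fmono x y xy.
  by rewrite -subr_ge0 e mulr_ge0// subr_ge0 ltW.
have Ds x : has_deriv (fun x => (F 1)^-1 * F x) x ((F 1)^-1 * rho x).
  exact: (is_deriveZ (F 1)^-1 (DF x)).
have Dse : (fun x => (F 1)^-1 * F x)^`()%classic = fun x => (F 1)^-1 * rho x.
  by apply/funext => x; exact: has_deriv_derive1.
exists (fun x => (F 1)^-1 * F x); split.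
- apply: smooth1_prim; first by move=> x; exact: has_deriv_derivable (Ds x).
  rewrite Dse; have := smooth1_affine (a := (F 1)^-1) (b := 1) (s := 0) rho_s.
  by under eq_fun do rewrite subr0 mul1r.
- by move=> x x0; rewrite (F0 _ x0) mulr0.
- by move=> x x1; rewrite (F1 _ x1) mulVf// gt_eqF.
- move=> x; rewrite mulr_ge0 ?invr_ge0 ?(ltW I0)//=.
    rewrite ler_pdivrMl// mulr1; have [x1|x1] := leP x 1; first exact: Fle.
    by rewrite (F1 x) ?lexx// ltW.
  have [x0|x0] := leP x 0; first by rewrite F0.
  by rewrite -(F0 0)// Fle// ltW.
- move=> x; rewrite Dse; split; first by rewrite mulr_ge0// invr_ge0 ltW.
  by move=> /rhoz ->; rewrite mulr0.
Qed.

End smooth_steps.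

Lemma Rintegral_dominated_cvg (R : realType) (dX : measure_display)
    (X : measurableType dX) (m : {measure set X -> \bar R}) (D : set X)
    (f_ : nat -> X -> R) (f g : X -> R) : measurable D ->
  (forall n, measurable_fun D (f_ n)) -> measurable_fun D f ->
  (forall x, D x -> f_ n x @[n --> \oo] --> f x) ->
  m.-integrable D (EFin \o g) -> (forall n x, D x -> `|f_ n x| <= g x) ->
  \int[m]_(x in D) f_ n x @[n --> \oo] --> \int[m]_(x in D) f x.
Proof.
move=> mD mf_ mf f_f ig f_g.
have e1 n : measurable_fun D (EFin \o f_ n) by exact/measurable_EFinP.
have e2 : measurable_fun D (EFin \o f) by exact/measurable_EFinP.
have e3 : {ae m, forall x, D x -> (EFin \o f_ n) x @[n --> \oo] --> (EFin \o f) x}.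
  by apply: aeW => x Dx; apply: cvg_EFin; [exact: nearW|exact: f_f].
have e4 : {ae m, forall x n, D x -> (`|(EFin \o f_ n) x| <= (EFin \o g) x)%E}.
  by apply: aeW => x n Dx; rewrite lee_fin f_g.
have [fi _ fc] := dominated_convergence mD e1 e2 e3 ig e4.
apply: fine_cvg; rewrite fineK//.
exact: integrable_fin_num.
Qed.

(** * Continuous functions with an integrable weak derivative *)

Section weak_derivative.
Context (R : realType).
Local Notation mu := (@lebesgue_measure R).

Lemma integrable_oo_cc (a b : R) (f : R -> R) :
  mu.-integrable `]a, b[ (EFin \o f) -> mu.-integrable `[a, b] (EFin \o f).
Proof.
move=> fi.
have mf : measurable_fun `]a, b[ f by apply/measurable_EFinP; exact: measurable_int fi.
have mf2 : measurable_fun `]a, b] f by exact/measurable_fun_itv_bndo_bndcP.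
have mf3 : measurable_fun `[a, b] f by exact/measurable_fun_itv_obnd_cbndP.
have nf D : measurable_fun D f -> measurable_fun D (fun x => `|(f x)%:E|%E).
  by move=> h; apply: measurableT_comp => //; exact/measurable_EFinP.
apply/integrableP; split; first exact/measurable_EFinP.
rewrite -integral_itv_obnd_cbnd; last exact: nf.
rewrite -integral_itv_bndo_bndc; last exact: nf.
by have /integrableP[] := fi.
Qed.

Lemma Rintegral_oo_cc (a b : R) (f : R -> R) :
  mu.-integrable `]a, b[ (EFin \o f) ->
  \int[mu]_(x in `]a, b[) f x = \int[mu]_(x in `[a, b]) f x.
Proof.
move=> fi; rewrite Rintegral_itv_bndo_bndc// Rintegral_itv_obnd_cbnd//.
apply: integrableS (integrable_oo_cc fi) => //.
by apply: subset_itvr; rewrite bnd_simp.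
Qed.

Lemma continuous_itv_integrable (a b : R) (f : R -> R) :
  {within `[a, b], continuous f} -> mu.-integrable `[a, b] (EFin \o f).
Proof.
by move=> cf; apply: continuous_compact_integrable => //; exact: segment_compact.
Qed.

Lemma continuous_itv_oo_integrable (a b : R) (f : R -> R) :
  {within `[a, b], continuous f} -> mu.-integrable `]a, b[ (EFin \o f).
Proof.
move=> /continuous_itv_integrable; apply: integrableS => //.
exact: subset_itv_oo_cc.
Qed.

Variables (T : R) (sigma : R -> R).
Hypotheses (sigma_smooth : smooth1 sigma)
  (sigma0 : forall x, x <= 0 -> sigma x = 0)
  (sigma1 : forall x, 1 <= x -> sigma x = 1)
  (sigma01 : forall x, 0 <= sigma x <= 1)
  (dsigma : forall x, 0 <= sigma^`()%classic x /\
     (~~ (0 < x < 1) -> sigma^`()%classic x = 0)).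

(** A smooth jump from 0 to 1 within [[s, s + 1/(n+1)]]. The difference of two of them is a test
    function close to the indicator of []s, t]], and its derivative acts in the limit as a
    difference of point masses. *)
Let step (n : nat) (s x : R) := sigma (n.+1%:R * (x - s)).
Let dstep (n : nat) (s x : R) := n.+1%:R * sigma^`()%classic (n.+1%:R * (x - s)).

Let step_smooth n s : smooth1 (step n s).
Proof.
have := smooth1_affine (a := 1) (b := n.+1%:R) (s := s) sigma_smooth.
by under eq_fun do rewrite mul1r.
Qed.

Let step_deriv n s x : has_deriv (step n s) x (dstep n s x).
Proof.
have := has_deriv_affine (f := sigma) (1 : R)
  (@sigma_smooth 0%N (n.+1%:R * (x - s))).
by under eq_fun do rewrite mul1r; rewrite mul1r.
Qed.

Let dstep_continuous n s : continuous (dstep n s).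
Proof.
have <- : (step n s)^`()%classic = dstep n s.
  by apply/funext => x; exact: has_deriv_derive1 (step_deriv n s x).
exact: (smooth1_continuous (smooth1_derive (@step_smooth n s))).
Qed.

Let step_le0 n s x : x <= s -> step n s x = 0.
Proof. by move=> xs; rewrite /step sigma0// pmulr_rle0 ?ltr0n// subr_le0. Qed.

Let step_ge1 n s x : s + n.+1%:R^-1 <= x -> step n s x = 1.
Proof.
by move=> xs; rewrite /step sigma1// -ler_pdivrMl ?ltr0n// mulr1 lerBrDl.
Qed.

Let step_time_test n s t : 0 < s -> s <= t -> t + n.+1%:R^-1 < T ->
  time_test T (fun x => step n s x - step n t x).
Proof.
move=> s0 st tT.
have sub : closure [set x | step n s x - step n t x != 0] `<=`
    `[s, t + n.+1%:R^-1].
  rewrite [X in _ `<=` X](closure_id _).1; last exact: interval_closed.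
  apply: closure_subset => x /= xn; rewrite in_itv/=; apply/andP; split.
    rewrite leNgt; apply: contra xn => xs; apply/eqP.
    by rewrite !step_le0 ?subrr// ltW// (lt_le_trans xs).
  rewrite leNgt; apply: contra xn => xs; apply/eqP.
  by rewrite !step_ge1 ?subrr// ltW// (le_lt_trans _ xs)// lerD2r.
split.
- exact: (smooth1_sub (@step_smooth n s) (@step_smooth n t)).
- apply: subclosed_compact sub; first exact: closed_closure.
  exact: segment_compact.
- apply: subset_trans sub _ => x /=; rewrite !in_itv/= => /andP[sx xt].
  by rewrite (lt_le_trans s0 sx) (le_lt_trans xt tT).
Qed.

(** [dstep n s] is nonnegative, has mass 1 and lives within [1/(n+1)] to the right of [s], so only
    values close to [g s] are averaged. *)
Let mollify (g : R -> R) s : {within `[0, T], continuous g} -> 0 < s < T ->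
  \int[mu]_(x in `]0, T[) (g x * dstep n s x) @[n --> \oo] --> g s.
Proof.
move=> cg /andP[s0 sT]; have T0 : 0 < T := lt_trans s0 sT.
have gs : {for s, continuous g}.
  have /continuous_within_itvP[//|+ _ _] := cg.
  by apply; rewrite in_itv/= s0.
have cgd n : {within `[0, T], continuous (fun x => g x * dstep n s x)}.
  by move=> x; apply: cvgM; [exact: cg|exact: continuous_subspaceT].
have cd n : {within `[0, T], continuous (dstep n s)}.
  exact: continuous_subspaceT.
apply/cvgrPdist_le => e e0.
have e2 : 0 < e / 2 by rewrite divr_gt0.
move/cvgrPdist_le : gs => /(_ e e0) /nbhs_ballP[d /= d0 gd].
have Ts0 : 0 < T - s by rewrite subr_gt0.
near=> n.
have nd : n.+1%:R^-1 < d.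
  by near: n; exact: (near_infty_natSinv_lt (PosNum d0)).
have nT : n.+1%:R^-1 < T - s.
  by near: n; exact: (near_infty_natSinv_lt (PosNum Ts0)).
have I1 : \int[mu]_(x in `[0, T]) dstep n s x = 1.
  rewrite /Rintegral (@continuous_FTC2 _ _ (step n s))//=.
  - by rewrite step_ge1 ?step_le0 ?subr0// ?ltW// -ltrBrDl.
  - split.
    + by move=> x _; exact: has_deriv_derivable (step_deriv n s x).
    + exact/cvg_at_right_filter/(smooth1_continuous (@step_smooth n s)).
    + exact/cvg_at_left_filter/(smooth1_continuous (@step_smooth n s)).
  - by move=> x _; exact: has_deriv_derive1 (step_deriv n s x).
rewrite Rintegral_oo_cc; last exact: continuous_itv_oo_integrable.
have id := continuous_itv_integrable (cd n).
have igd := continuous_itv_integrable (cgd n).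
rewrite -[X in X - _]mulr1 -{1}I1 -RintegralZl// -RintegralB//; last first.
  exact: integrable_scaleR.
have isd : mu.-integrable `[0, T]
    (EFin \o (fun x => g s * dstep n s x - g x * dstep n s x)).
  by apply: integrable_subR => //; exact: integrable_scaleR.
apply: le_trans (le_normr_Rintegral _ isd) _ => //.
rewrite -[leRHS]mulr1 -I1 -RintegralZl//; apply: le_Rintegral => //.
- by have := integrable_norm isd; apply: eq_integrable.
- exact: integrable_scaleR.
move=> x _; rewrite -mulrBl normrM [X in _ * X]ger0_norm; last first.
  by rewrite mulr_ge0 ?ler0n//; exact: (dsigma _).1.
have [|out] := boolP (0 < n.+1%:R * (x - s) < 1); last first.
  by rewrite /dstep (dsigma _).2// !mulr0.
rewrite pmulr_rgt0 ?ltr0n// subr_gt0 => /andP[sx].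
rewrite -ltr_pdivlMl ?ltr0n// mulr1 => xs.
apply: ler_wpM2r; first by rewrite mulr_ge0 ?ler0n//; exact: (dsigma _).1.
apply: gd; rewrite /ball/= distrC gtr0_norm ?subr_gt0//.
exact: lt_trans xs nd.
Unshelve. all: by end_near. Qed.

(** Testing with [eta n], the left side tends to [g s - g t] and the right side, by dominated
    convergence, to minus the integral of [a] over []s, t]]. The strict bounds on [s] and [t] keep
    the supports inside []0, T[] for large [n]. *)
Lemma weak_increment_interior (g a : R -> R) s t : {within `[0, T], continuous g} ->
  mu.-integrable `]0, T[ (EFin \o a) ->
  (forall eta, time_test T eta ->
    \int[mu]_(x in `]0, T[) (g x * eta^`()%classic x) =
    - \int[mu]_(x in `]0, T[) (a x * eta x)) ->
  0 < s -> s <= t -> t < T -> g t - g s = \int[mu]_(x in `]s, t]) a x.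
Proof.
move=> cg ia gaE s0 st tT.
have Tt0 : 0 < T - t by rewrite subr_gt0.
have ma : measurable_fun `]0, T[ a by apply/measurable_EFinP; exact: measurable_int ia.
pose eta n x := step n s x - step n t x.
have lim1 : \int[mu]_(x in `]0, T[) (g x * dstep n s x) -
    \int[mu]_(x in `]0, T[) (g x * dstep n t x) @[n --> \oo] --> g s - g t.
  by apply: cvgB; apply: mollify; rewrite // ?s0 ?(le_lt_trans st tT)//
    (lt_le_trans s0 st).
have eqn : \forall n \near \oo, \int[mu]_(x in `]0, T[) (g x * dstep n s x) -
    \int[mu]_(x in `]0, T[) (g x * dstep n t x) =
    - \int[mu]_(x in `]0, T[) (a x * eta n x).
  near=> n.
  have nT : n.+1%:R^-1 < T - t.
    by near: n; exact: (near_infty_natSinv_lt (PosNum Tt0)).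
  rewrite -gaE; last by apply: step_time_test => //; rewrite -ltrBrDl.
  have cgd r : {within `[0, T], continuous (fun x => g x * dstep n r x)}.
    by move=> x; apply: cvgM; [exact: cg|exact: continuous_subspaceT].
  rewrite -RintegralB//; try exact: continuous_itv_oo_integrable.
  apply: eq_Rintegral => x _; rewrite -mulrBr.
  by rewrite (has_deriv_derive1 (has_deriv_sub (step_deriv n s x) (step_deriv n t x))).
have meta n : measurable_fun `]0, T[ (eta n).
  apply: measurable_funTS; apply: continuous_measurable_fun => x.
  by apply: cvgB; exact: (smooth1_continuous (@step_smooth n _)).
have lim2 : \int[mu]_(x in `]0, T[) (a x * eta n x) @[n --> \oo] -->
    \int[mu]_(x in `]0, T[) ((a \_ `]s, t]) x).
  apply: (@Rintegral_dominated_cvg R _ _ mu `]0, T[%classic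
    (fun n x => a x * eta n x) (a \_ `]s, t]) (fun x => `|a x|)) => //.
  - by move=> n; exact: measurable_funM ma (meta n).
  - apply/(measurable_restrict a) => //.
    by apply: measurable_funS ma => // x [].
  - move=> x _; rewrite patchE; have [xs|sx] := leP x s.
      rewrite ifF; last first.
        by apply/negbTE; rewrite notin_setE/= in_itv/= ltNge xs.
      rewrite (_ : (fun n => _) = cst 0); first exact: cvg_cst.
      by apply/funext => n /=; rewrite /eta !step_le0 ?subrr ?mulr0// (le_trans xs).
    have xs0 : 0 < x - s by rewrite subr_gt0.
    have [xt|tx] := leP x t.
      rewrite ifT; last by rewrite inE/= in_itv/= sx.
      apply: cvg_near_cst; near=> n; rewrite /= /eta (step_le0 n xt) subr0 step_ge1 ?mulr1//.
      rewrite -lerBrDl ltW//.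
      by near: n; exact: (near_infty_natSinv_lt (PosNum xs0)).
    have xt0 : 0 < x - t by rewrite subr_gt0.
    rewrite ifF; last first.
      by apply/negbTE; rewrite notin_setE/= in_itv/= (leNgt x t) tx andbF.
    apply: cvg_near_cst; near=> n; rewrite /= /eta !step_ge1 ?subrr ?mulr0//.
      rewrite -lerBrDl ltW//.
      by near: n; exact: (near_infty_natSinv_lt (PosNum xt0)).
    rewrite -lerBrDl ltW//.
    by near: n; exact: (near_infty_natSinv_lt (PosNum xs0)).
  - by have := integrable_norm ia; apply: eq_integrable.
  - move=> n x _; rewrite normrM ler_piMr//.
    rewrite /eta /step.
    have /andP[a0 a1] := sigma01 (n.+1%:R * (x - s)).
    have /andP[b0 b1] := sigma01 (n.+1%:R * (x - t)).
    by rewrite ler_norml; lra.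
have lim3 : \int[mu]_(x in `]0, T[) (g x * dstep n s x) -
    \int[mu]_(x in `]0, T[) (g x * dstep n t x) @[n --> \oo] -->
    - \int[mu]_(x in `]0, T[) ((a \_ `]s, t]) x).
  apply: cvg_trans (cvgN lim2); apply: near_eq_cvg.
  by apply: filterS eqn => n ->.
have e := cvg_unique (@Rhausdorff R) lim1 lim3.
rewrite -(opprB (g s)) e opprK -Rintegral_mkcondr.
congr Rintegral; apply/seteqP; split => [x [_ //]|x /=].
rewrite !in_itv/= => /andP[sx xt]; rewrite (lt_trans s0 sx) (le_lt_trans xt tT).
by rewrite sx xt.
Unshelve. all: by end_near. Qed.

End weak_derivative.

Section weak_derivative_theorem.
Context (R : realType).
Local Notation mu := (@lebesgue_measure R).

(** The difference of [g] and the primitive of [a] is constant in the interior and continuous up to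
    the end points, hence constant on [[0, T]]. *)
Lemma weak_derivative_increment (T : R) (g a : R -> R) : 0 < T ->
  {within `[0, T], continuous g} ->
  mu.-integrable `]0, T[ (EFin \o a) ->
  (forall eta, time_test T eta ->
    \int[mu]_(x in `]0, T[) (g x * eta^`()%classic x) =
    - \int[mu]_(x in `]0, T[) (a x * eta x)) ->
  forall t, 0 <= t <= T -> g t = g 0 + \int[mu]_(x in `]0, t[) a x.
Proof.
move=> T0 cg ia gaE.
have [sigma [s1 s2 s3 s4 s5]] := smooth_step R.
have incr := @weak_increment_interior R T sigma s1 s2 s3 s4 s5 g a _ _ cg ia gaE.
have iac := integrable_oo_cc ia.
pose H := (parameterized_integral mu 0)^~ a.
have cH : {within `[0, T], continuous H}.
  by apply: parameterized_integral_continuous iac; exact: ltW.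
pose h t := g t - H t.
have ch : {within `[0, T], continuous h}.
  by move=> x; apply: cvgB; [exact: cg|exact: cH].
have hE s t : 0 < s -> s <= t -> t < T -> h t = h s.
  move=> s0 st tT; have := incr s t s0 st tT.
  have <- : H t - H s = \int[mu]_(x in `]s, t]) a x.
    rewrite /H /parameterized_integral (@Rintegral_itvB _ _ _ (BRight t))//.
    - apply: integrableS iac => //.
      by apply: subset_itvl; rewrite bnd_simp ltW.
    - by rewrite bnd_simp ltW.
  by rewrite /h; lra.
pose c := h (T / 2).
have T2 : 0 < T / 2 by rewrite divr_gt0.
have T2T : T / 2 < T by rewrite ltr_pdivrMr// mulr2n mulrDr mulr1 ltrDl.
have hc t : 0 < t < T -> h t = c.
  move=> /andP[t0 tT]; have [le|/ltW le] := leP t (T / 2).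
    by rewrite /c (hE _ _ t0 le).
  by rewrite (hE _ _ T2 le).
have /continuous_within_itvP[//|_ h0 hT] := ch.
have h0c : h 0 = c.
  apply: (cvg_unique _ h0); first exact: Rhausdorff.
  apply: cvg_near_cst; near=> x; apply: hc; apply/andP; split; near: x.
    exact: nbhs_right_gt.
  exact: nbhs_right_lt.
have hTc : h T = c.
  apply: (cvg_unique _ hT); first exact: Rhausdorff.
  apply: cvg_near_cst; near=> x; apply: hc; apply/andP; split; near: x.
    exact: nbhs_left_gt.
  exact: nbhs_left_lt.
have H0 : H 0 = 0.
  by rewrite /H /parameterized_integral set_itv1 Rintegral_set1.
move=> t /andP[t0 tT].
have -> : \int[mu]_(x in `]0, t[) a x = H t.
  rewrite Rintegral_oo_cc//; apply: integrableS ia => //.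
  by apply: subset_itvl; rewrite bnd_simp.
have -> : g 0 = c by rewrite -h0c /h H0 subr0.
suff <- : h t = c by rewrite subrK.
move: t0 tT; rewrite le_eqVlt => /orP[/eqP <-//|t0].
by rewrite le_eqVlt => /orP[/eqP ->//|tT]; rewrite hc// t0.
Unshelve. all: by end_near. Qed.

End weak_derivative_theorem.

Lemma integrable_ae_eq (R : realType) (dX : measure_display)
    (X : measurableType dX) (m : {measure set X -> \bar R}) (D : set X)
    (f g : X -> \bar R) : measurable D -> measurable_fun D f ->
  {ae m, forall x, D x -> f x = g x} -> m.-integrable D g -> m.-integrable D f.
Proof.
move=> mD mf fg /integrableP[mg goo]; apply/integrableP; split => //.
rewrite (@ge0_ae_eq_integral _ _ _ m D _ (fun x => `|g x|%E))//.
- exact: measurableT_comp.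
- exact: measurableT_comp.
- by apply: filterS fg => x + Dx => /(_ Dx) ->.
Qed.

(** * Fubini's theorem for real-valued integrals *)

Section product_integrals.
Context (R : realType) (d1 d2 : measure_display).
Context (T1 : measurableType d1) (T2 : measurableType d2).
Variables (m1 : {sigma_finite_measure set T1 -> \bar R})
  (m2 : {sigma_finite_measure set T2 -> \bar R}).
Implicit Types f : T1 * T2 -> R.
Local Notation m12 := (m1 \x m2)%E.

(** The integral is [fine] of a difference of two Tonelli integrals, hence measurable even if some
    slices are not integrable. *)
Lemma measurable_Rintegral_snd f : measurable_fun setT f ->
  measurable_fun setT (fun x => \int[m2]_y f (x, y)).
Proof.
move=> mf; have mfE : measurable_fun setT (EFin \o f) by exact/measurable_EFinP.
apply: (measurableT_comp (fine_measurable measurableT)).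
rewrite (_ : (fun x => _) = (fubini_F m2 (EFin \o f)^\+%E \- fubini_F m2 (EFin \o f)^\-%E)%E).
  apply: emeasurable_funB; apply: measurable_fun_fubini_tonelli_F => //.
  - exact: measurable_funepos.
  - exact: measurable_funeneg.
apply/funext => x; rewrite integralE /fubini_F /fubini_G.
by congr (_ - _)%E; apply: eq_integral => y _; rewrite ?funeposE ?funenegE.
Qed.

Lemma measurable_Rintegral_fst f : measurable_fun setT f ->
  measurable_fun setT (fun y => \int[m1]_x f (x, y)).
Proof.
move=> mf; have mfE : measurable_fun setT (EFin \o f) by exact/measurable_EFinP.
apply: (measurableT_comp (fine_measurable measurableT)).
rewrite (_ : (fun x => _) = (fubini_G m1 (EFin \o f)^\+%E \- fubini_G m1 (EFin \o f)^\-%E)%E).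
  apply: emeasurable_funB; apply: measurable_fun_fubini_tonelli_G => //.
  - exact: measurable_funepos.
  - exact: measurable_funeneg.
apply/funext => x; rewrite integralE /fubini_F /fubini_G.
by congr (_ - _)%E; apply: eq_integral => y _; rewrite ?funeposE ?funenegE.
Qed.

Section fubini.
Variable f : T1 * T2 -> R.
Hypothesis fi : m12.-integrable setT (EFin \o f).

Let mf : measurable_fun setT f.
Proof. by apply/measurable_EFinP; exact: measurable_int fi. Qed.

Let fubini_FE : {ae m1, forall x, setT x ->
  (\int[m2]_y f (x, y))%:E = fubini_F m2 (EFin \o f) x}.
Proof.
apply: filterS (ae_integrable1 fi) => x fx _.
by rewrite /Rintegral fineK//; exact: integrable_fin_num fx.
Qed.

Let fubini_GE : {ae m2, forall y, setT y ->
  (\int[m1]_x f (x, y))%:E = fubini_G m1 (EFin \o f) y}.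
Proof.
apply: filterS (ae_integrable2 fi) => y fy _.
by rewrite /Rintegral fineK//; exact: integrable_fin_num fy.
Qed.

Lemma integrable_Rintegral_snd :
  m1.-integrable setT (fun x => (\int[m2]_y f (x, y))%:E).
Proof.
apply: (integrable_ae_eq measurableT _ _ (integrable_fubini_F fi)).
  by apply/measurable_EFinP; exact: measurable_Rintegral_snd.
by apply: filterS fubini_FE => x h /h.
Qed.

Let integrable_fubiniG : m2.-integrable setT (fubini_G m1 (EFin \o f)).
Proof.
apply/integrableP; split; first exact: (measurable_fubini_G fi).
have mnf : measurable_fun setT (fun z => `|(EFin \o f) z|%E).
  by apply: measurableT_comp => //; exact/measurable_EFinP.
have nf0 z : (0 <= `|(EFin \o f) z|)%E by exact: abse_ge0.
have /integrableP[_] := fi; rewrite (fubini_tonelli2 _ mnf nf0).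
apply: le_lt_trans; apply: ge0_le_integral => //.
- by apply: measurableT_comp => //; exact: (measurable_fubini_G fi).
- exact: measurable_fun_fubini_tonelli_G.
move=> y _; apply: le_abse_integral => //.
exact: measurableT_comp (measurable_int _ fi) (measurable_pair2 y).
Qed.

Lemma integrable_Rintegral_fst :
  m2.-integrable setT (fun y => (\int[m1]_x f (x, y))%:E).
Proof.
apply: (integrable_ae_eq measurableT _ _ integrable_fubiniG).
  by apply/measurable_EFinP; exact: measurable_Rintegral_fst.
by apply: filterS fubini_GE => x h /h.
Qed.

Lemma Rintegral_prod12 :
  \int[m1]_x (\int[m2]_y f (x, y)) = \int[m12]_z f z.
Proof.
rewrite [in RHS]/Rintegral -(integral12_prod_meas1 fi) /Rintegral; congr fine.
have e1 := measurable_int _ integrable_Rintegral_snd.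
have e := @ae_eq_integral _ _ _ m1 setT (fubini_F m2 (EFin \o f)) _
  measurableT e1 (measurable_fubini_F fi) fubini_FE.
exact: e.
Qed.

Lemma Rintegral_prod21 :
  \int[m2]_y (\int[m1]_x f (x, y)) = \int[m12]_z f z.
Proof.
rewrite [in RHS]/Rintegral -(integral21_prod_meas1 fi) /Rintegral; congr fine.
have e1 := measurable_int _ integrable_Rintegral_fst.
have e := @ae_eq_integral _ _ _ m2 setT (fubini_G m1 (EFin \o f)) _
  measurableT e1 (measurable_fubini_G fi) fubini_GE.
exact: e.
Qed.

End fubini.

Section square_integrable_product.
Variable f : T1 * T2 -> R.
Hypothesis Lf : L2 m12 f.

Let fi : m12.-integrable setT (EFin \o (fun z => f z * f z)).
Proof. exact: (L2_prod Lf Lf). Qed.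

Lemma L2_slice_snd : {ae m1, forall x, L2 m2 (fun y => f (x, y))}.
Proof.
apply: filterS (ae_integrable1 fi) => x fx; split.
  exact: measurableT_comp Lf.1 (pair1_measurable x).
by apply: eq_integrable fx => // y _; rewrite /= expr2.
Qed.

Lemma L2_slice_fst : {ae m2, forall y, L2 m1 (fun x => f (x, y))}.
Proof.
apply: filterS (ae_integrable2 fi) => y fy; split.
  exact: measurableT_comp Lf.1 (measurable_pair2 y).
by apply: eq_integrable fy => // x _; rewrite /= expr2.
Qed.

Lemma integrable_ip_snd : m1.-integrable setT
  (EFin \o (fun x => ip m2 (fun y => f (x, y)) (fun y => f (x, y)))).
Proof. exact: (integrable_Rintegral_snd fi). Qed.

Lemma Rintegral_ip_snd :
  \int[m1]_x ip m2 (fun y => f (x, y)) (fun y => f (x, y)) = ip m12 f f.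
Proof. exact: (Rintegral_prod12 fi). Qed.

End square_integrable_product.

Lemma L2_prod_tonelli f : measurable_fun setT f ->
  (\int[m2]_y \int[m1]_x (f (x, y) ^+ 2)%:E < +oo)%E -> L2 m12 f.
Proof.
move=> mf foo; apply: L2_lty => //.
rewrite (@fubini_tonelli2 _ _ _ _ _ m1 m2 (fun z => (f z ^+ 2)%:E))//.
- by apply/measurable_EFinP; exact: measurable_funX.
- by move=> z; rewrite lee_fin sqr_ge0.
Qed.

End product_integrals.

(** * Almost everywhere statements and inferior limits *)

Section almost_everywhere.
Context (R : realType) (dX : measure_display) (X : measurableType dX).
Variable m : {measure set X -> \bar R}.

Lemma ae_imp (P Q : X -> Prop) : {ae m, forall x, P x} ->
  (forall x, P x -> Q x) -> {ae m, forall x, Q x}.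
Proof. by move=> aP PQ; apply: filterS aP. Qed.

Lemma ae_imp2 (P Q S : X -> Prop) : {ae m, forall x, P x} ->
  {ae m, forall x, Q x} -> (forall x, P x -> Q x -> S x) ->
  {ae m, forall x, S x}.
Proof. by move=> aP aQ PQS; apply: filterS2 aP aQ. Qed.

Lemma ae_forall_ord (n : nat) (P : 'I_n -> X -> Prop) :
  (forall i, {ae m, forall x, P i x}) -> {ae m, forall x, forall i, P i x}.
Proof.
move=> aP; have : {ae m, forall x, forall k : nat, forall i : 'I_n, i = k :> nat -> P i x}.
  apply/ae_foralln => k; have [kn|nk] := ltnP k n.
    apply: ae_imp (aP (Ordinal kn)) _ => x Px i ik.
    by rewrite (_ : i = Ordinal kn)//; exact: val_inj.
  by apply: aeW => x i ik; move: (ltn_ord i); rewrite ik ltnNge nk.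
by move=> h; apply: ae_imp h _ => x h i; exact: (h i).
Qed.

End almost_everywhere.

Lemma near_forall_ord (n : nat) (P : 'I_n -> nat -> Prop) :
  (forall i, \forall k \near \oo, P i k) ->
  \forall k \near \oo, forall i, P i k.
Proof.
move=> nP; have /choice[N HN] : forall i, exists N, forall k, (N <= k)%N -> P i k.
  by move=> i; have [N _ HN] := nP i; exists N.
exists (\max_i N i)%N => // k /= Nk i; apply: HN.
exact: leq_trans (leq_bigmax i) Nk.
Qed.

Lemma Rintegral_ae_eq (R : realType) (dX : measure_display)
    (X : measurableType dX) (m : {measure set X -> \bar R}) (D : set X)
    (f g : X -> R) : measurable D -> measurable_fun D f -> measurable_fun D g ->
  {ae m, forall x, D x -> f x = g x} ->
  \int[m]_(x in D) f x = \int[m]_(x in D) g x.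
Proof.
move=> mD mf mg fg; rewrite /Rintegral; congr fine; apply: ae_eq_integral => //.
- exact/measurable_EFinP.
- exact/measurable_EFinP.
- by apply: filterS fg => x /[apply] ->.
Qed.

Lemma limn_einf_near (R : realType) (u : nat -> \bar R) (c : \bar R) :
  (c < limn_einf u)%E -> \forall n \near \oo, (c < u n)%E.
Proof.
rewrite limn_einf_lim.
have /cvg_lim -> // : einfs u @ \oo --> ereal_sup (range (einfs u)).
  by apply: ereal_nondecreasing_cvgn; exact: nondecreasing_einfs.
move=> /ereal_sup_gt[_ [n _ <-] cn].
exists n => // k /= nk; apply: lt_le_trans cn _.
by apply: ereal_inf_lbound; exists k.
Qed.

(** * Steklov averages in time *)

Section steklov_average.
Context (R : realType).
Local Notation mu := (@lebesgue_measure R).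
Implicit Types (g : R -> R) (h t s : R).

(** A real-valued indicator of []t - h, t[] that Tonelli's theorem can read as a function of [s] or
    of [t]. With [h = t = b] it is the indicator of []0, b[]. *)
Definition window h t s : R := if (t - h < s) && (s < t) then 1 else 0.

(** The backward Steklov average, the form in which the integrand reappears when an increment over
    []t - h, t[] is divided by [h]. *)
Definition average h g t : R := h^-1 * \int[mu]_s (window h t s * g s).

Lemma window01 h t s : 0 <= window h t s <= 1.
Proof. by rewrite /window; case: ifP; rewrite ?ler01 ?lexx. Qed.

Lemma window_sqr h t s : window h t s ^+ 2 = window h t s.
Proof. by rewrite /window; case: ifP; rewrite ?expr1n ?expr0n. Qed.

Lemma windowE h t s : window h t s = \1_`]t - h, t[ s.
Proof.
rewrite /window indicE; case: ifP => ts; first by rewrite mem_set//= in_itv.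
by rewrite memNset//= in_itv/= ts.
Qed.

Lemma windowC h t s : window h t s = \1_`]s, s + h[ t.
Proof.
rewrite /window indicE ltrBlDr andbC; case: ifP => ts; first by rewrite mem_set//= in_itv.
by rewrite memNset//= in_itv/= ts.
Qed.

Lemma measurable_window h : measurable_fun
  [set: measurableTypeR R * measurableTypeR R] (fun p => window h p.1 p.2).
Proof.
have m1 := @measurable_fst _ _ (measurableTypeR R) (measurableTypeR R).
have m2 := @measurable_snd _ _ (measurableTypeR R) (measurableTypeR R).
apply: measurable_fun_ifT => //; apply: measurable_and.
  apply: (measurable_fun_ltr _ m2).
  by apply: (measurable_funB m1).
exact: (measurable_fun_ltr m2 m1).
Qed.

Lemma measurable_window2 h t : measurable_fun [set: measurableTypeR R] (window h t).
Proof.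
exact: (measurableT_comp (@measurable_window h)
  (@pair1_measurable _ _ (measurableTypeR R) (measurableTypeR R) t)).
Qed.

Lemma integral_window2 h t : 0 < h ->
  (\int[mu]_s (window h t s)%:E = h%:E)%E.
Proof.
move=> h0; under eq_integral do rewrite windowE.
rewrite integral_indic// setIT [LHS](lebesgue_measure_itv `]t - h, t[)/=.
rewrite lte_fin ltrBlDr ltrDl h0.
by rewrite -EFinB opprB addrC subrK.
Qed.

Lemma integral_window1 h s : 0 < h ->
  (\int[mu]_t (window h t s)%:E = h%:E)%E.
Proof.
move=> h0; under eq_integral do rewrite windowC.
rewrite integral_indic// setIT [LHS](lebesgue_measure_itv `]s, s + h[)/=.
rewrite lte_fin ltrDl h0.
by rewrite -EFinB addrC addKr.
Qed.

Lemma L2_window h t : 0 < h -> L2 mu (window h t).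
Proof.
move=> h0; apply: L2_lty; first exact: measurable_window2.
by under eq_integral do rewrite window_sqr; rewrite integral_window2// ltry.
Qed.

Lemma ip_window h t : 0 < h -> ip mu (window h t) (window h t) = h.
Proof.
move=> h0; apply: EFin_inj; rewrite -ip_sqrE; last exact: L2_window.
by under eq_integral do rewrite window_sqr; rewrite integral_window2.
Qed.

(** Cauchy-Schwarz against the window, whose squared norm is [h]. As [g] is only measurable, an
    infinite right side is treated apart. *)
Lemma average_sqr_le h g t : 0 < h -> measurable_fun setT g ->
  ((average h g t ^+ 2)%:E <= \int[mu]_s (h^-1 * (window h t s * g s ^+ 2))%:E)%E.
Proof.
move=> h0 mg; have hV : 0 < h^-1 by rewrite invr_gt0.
have mw := @measurable_window2 h t.
have mwg : measurable_fun [set: measurableTypeR R] (fun s => window h t s * g s).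
  exact: measurable_funM.
have mwg2 : measurable_fun [set: measurableTypeR R] (fun s => (window h t s * g s ^+ 2)%:E).
  by apply/measurable_EFinP; apply: measurable_funM => //; exact: measurable_funX.
have wg0 s : (0 <= (window h t s * g s ^+ 2)%:E)%E.
  by rewrite lee_fin mulr_ge0 ?sqr_ge0//; case/andP: (window01 h t s).
under eq_integral do rewrite EFinM.
rewrite ge0_integralZl//; last by rewrite lee_fin ltW.
have [foo|] := ltP (\int[mu]_s (window h t s * g s ^+ 2)%:E)%E +oo%E; last first.
  by rewrite leye_eq => /eqP ->; rewrite gt0_muley ?lte_fin// leey.
have wE s : (window h t s * g s) ^+ 2 = window h t s * g s ^+ 2.
  by rewrite exprMn window_sqr.
have Lwg : L2 mu (fun s => window h t s * g s).
  by apply: L2_lty => //; under eq_integral do rewrite wE.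
have -> : (\int[mu]_s (window h t s * g s ^+ 2)%:E =
    (ip mu (fun s => window h t s * g s) (fun s => window h t s * g s))%:E)%E.
  by rewrite -ip_sqrE//; under [RHS]eq_integral do rewrite wE.
rewrite -EFinM lee_fin /average.
have -> : \int[mu]_s (window h t s * g s) =
    ip mu (window h t) (fun s => window h t s * g s).
  by apply: eq_Rintegral => s _; rewrite mulrA -expr2 window_sqr.
rewrite exprMn (expr2 h^-1) -mulrA; apply: ler_wpM2l; first exact: ltW.
rewrite ler_pdivrMl//.
by have := cauchy_schwarz_sqr (L2_window t h0) Lwg; rewrite ip_window.
Qed.

(** After the pointwise bound, Tonelli's theorem exchanges the integrals: each [s] lies in the
    windows of a set of times [t] of length [h], which cancels the factor [h^-1]. *)
Lemma average_L2_le h g : 0 < h -> measurable_fun setT g ->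
  (\int[mu]_t (average h g t ^+ 2)%:E <= \int[mu]_s (g s ^+ 2)%:E)%E.
Proof.
move=> h0 mg; have hV : 0 < h^-1 by rewrite invr_gt0.
have mW : measurable_fun [set: measurableTypeR R * measurableTypeR R]
    (fun p => window h p.1 p.2 * g p.2).
  apply: measurable_funM; first exact: measurable_window.
  exact: measurableT_comp mg measurable_snd.
have mW2 : measurable_fun [set: measurableTypeR R * measurableTypeR R]
    (fun p => (h^-1 * (window h p.1 p.2 * g p.2 ^+ 2))%:E).
  apply/measurable_EFinP; apply: measurable_funM => //; apply: measurable_funM.
    exact: measurable_window.
  by apply: measurable_funX; exact: measurableT_comp mg measurable_snd.
have W0 p : (0 <= (h^-1 * (window h p.1 p.2 * g p.2 ^+ 2))%:E)%E.
  rewrite lee_fin mulr_ge0 ?(ltW hV)// mulr_ge0 ?sqr_ge0//.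
  by case/andP: (window01 h p.1 p.2).
apply: (@le_trans _ _ (\int[mu]_t \int[mu]_s (h^-1 * (window h t s * g s ^+ 2))%:E)%E).
  apply: ge0_le_integral => //.
  - by move=> t _; rewrite lee_fin sqr_ge0.
  - apply/measurable_EFinP; apply: measurable_funX; apply: measurable_funM => //.
    exact: (@measurable_Rintegral_snd _ _ _ _ _ mu _ mW).
  - exact: (@measurable_fun_fubini_tonelli_F _ _ _ _ _ mu _ mW2 W0).
  - by move=> t _; exact: average_sqr_le.
have := @fubini_tonelli _ _ _ _ _ mu mu _ mW2 W0.
rewrite /fubini_F /fubini_G /= => ->.
apply: ge0_le_integral => //.
- by move=> s _; apply: integral_ge0 => t _; exact: (W0 (t, s)).
- exact: (@measurable_fun_fubini_tonelli_G _ _ _ _ _ mu _ mW2 W0).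
- by apply/measurable_EFinP; exact: measurable_funX.
move=> s _.
under eq_integral do rewrite mulrCA EFinM muleC.
rewrite ge0_integralZl//.
- by rewrite integral_window1// -EFinM mulrC mulrA mulfV ?mul1r// gt_eqF.
- apply/measurable_EFinP.
  exact: (measurableT_comp (@measurable_window h)
    (@measurable_pair2 _ _ (measurableTypeR R) (measurableTypeR R) s)).
- by move=> t _; rewrite lee_fin; case/andP: (window01 h t s).
- by rewrite lee_fin mulr_ge0 ?sqr_ge0 ?ltW.
Qed.

Lemma backward_quotient_cvg (F : R -> R) (t l : R) (h : nat -> R) :
  has_deriv F t l -> (forall n, 0 < h n) -> h n @[n --> \oo] --> 0 ->
  (h n)^-1 * (F t - F (t - h n)) @[n --> \oo] --> l.
Proof.
move=> dF h0 hc.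
have FE n : (h n)^-1 * (F t - F (t - h n)) =
    (- h n)^-1 *: ((F \o shift t) ((- h n) *: 1) - F t).
  rewrite /= invrN /GRing.scale/= mulr1 mulNr -mulrN opprB.
  by rewrite [- h n + t]addrC.
under eq_fun do rewrite FE.
have hN0 : - h n @[n --> \oo] --> (0 : R) by rewrite -oppr0; exact: cvgN.
have hN : - h n @[n --> \oo] --> (0 : R)^'.
  move=> A A0.
  have : \forall n \near \oo, - h n != 0 -> A (- h n) := hN0 _ A0.
  by apply: filterS => n; apply; rewrite oppr_eq0 gt_eqF.
have L : x^-1 *: ((F \o shift t) (x *: 1) - F t) @[x --> (0 : R)^'] --> l.
  by rewrite -(has_deriv_derive1 dF) derive1E; exact: has_deriv_derivable dF.
exact: (cvg_comp _ _ hN L).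
Qed.

(** Lebesgue differentiation: the average is a backward difference quotient of the primitive from
    minus infinity, which has derivative [g] almost everywhere. *)
Lemma average_cvg_ae g (h : nat -> R) : mu.-integrable setT (EFin \o g) ->
  (forall n, 0 < h n) -> h n @[n --> \oo] --> 0 ->
  {ae mu, forall t, average (h n) g t @[n --> \oo] --> g t}.
Proof.
move=> ig h0 hc.
have iy y : mu.-integrable `]-oo, y] (EFin \o g) by exact: integrableS ig.
have lg : locally_integrable setT g.
  have := integrable_locally measurableT ig.
  by rewrite patch_setT.
have := FTC1Ny iy lg; apply: filterS; first exact: (ae_filter_ringOfSetsType mu).
move=> t [dF dFE].
set F := fun x => _ in dF dFE.
have FE n : average (h n) g t = (h n)^-1 * (F t - F (t - h n)).
  rewrite /average; congr (_ * _).
  rewrite [RHS](_ : _ = \int[mu]_(x in `]t - h n, t]) g x); last first.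
    by rewrite /F Rintegral_itvB// ?bnd_simp// gerBl ltW.
  rewrite -Rintegral_itv_bndo_bndc; last exact: integrableS ig.
  rewrite [RHS]Rintegral_mkcond; apply: eq_Rintegral => s _.
  by rewrite windowE patchE indicE; case: ifP; rewrite ?mul1r ?mul0r.
under eq_fun do rewrite FE.
have dF' : has_deriv F t (g t) by rewrite -dFE; exact: derivable_has_deriv dF.
exact: (backward_quotient_cvg dF' h0 hc).
Qed.

End steklov_average.

(** * Steklov averages of functions on space-time *)

Section steklov_product.
Context (R : realType) (dX : measure_display) (X : measurableType dX).
Variable m : {sigma_finite_measure set X -> \bar R}.
Local Notation mu := (@lebesgue_measure R).
Local Notation muX := (mu \x m)%E.
Implicit Types (g : measurableTypeR R * X -> R) (h t s : R).

Definition average2 h g (p : measurableTypeR R * X) : R :=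
  average h (fun s => g (s, p.2)) p.1.

Lemma measurable_average2 h g : measurable_fun setT g ->
  measurable_fun setT (average2 h g).
Proof.
move=> mg; apply: measurable_funM => //.
apply: (@measurable_Rintegral_snd _ _ _ _ _ mu
  (fun q => window h q.1.1 q.2 * g (q.2, q.1.2))).
apply: measurable_funM.
  apply: (measurableT_comp (@measurable_window R h)
    (g := fun q : (measurableTypeR R * X) * measurableTypeR R => (q.1.1, q.2))).
  apply/measurable_fun_pairP; split => /=.
    exact: measurableT_comp measurable_fst measurable_fst.
  exact: measurable_snd.
apply: (measurableT_comp mg
  (g := fun q : (measurableTypeR R * X) * measurableTypeR R => (q.2, q.1.2))).
apply/measurable_fun_pairP; split => /=.
  exact: measurable_snd.
exact: measurableT_comp measurable_snd measurable_fst.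
Qed.

Lemma average2_L2_le h g : 0 < h -> L2 muX g ->
  L2 muX (average2 h g) /\ ip muX (average2 h g) (average2 h g) <= ip muX g g.
Proof.
move=> h0 Lg; have ma := measurable_average2 h Lg.1.
have sq (f : measurableTypeR R * X -> R) : measurable_fun setT f -> (\int[muX]_p (f p ^+ 2)%:E =
    \int[m]_x \int[mu]_t (f (t, x) ^+ 2)%:E)%E.
  move=> mf; rewrite (@fubini_tonelli2 _ _ _ _ _ mu m (fun p => (f p ^+ 2)%:E))//.
    by apply/measurable_EFinP; exact: measurable_funX.
  by move=> p; rewrite lee_fin sqr_ge0.
have msq (f : measurableTypeR R * X -> R) : measurable_fun setT f ->
    measurable_fun setT (fun x => \int[mu]_t (f (t, x) ^+ 2)%:E)%E.
  move=> mf; apply: (@measurable_fun_fubini_tonelli_G _ _ _ _ _ mu (fun p => (f p ^+ 2)%:E)).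
    by apply/measurable_EFinP; exact: measurable_funX.
  by move=> p; rewrite lee_fin sqr_ge0.
have le : (\int[muX]_p (average2 h g p ^+ 2)%:E <= \int[muX]_p (g p ^+ 2)%:E)%E.
  rewrite !sq//; last exact: Lg.1.
  apply: ge0_le_integral => //.
  - by move=> x _; apply: integral_ge0 => t _; rewrite lee_fin sqr_ge0.
  - exact: msq.
  - by apply: msq; exact: Lg.1.
  - move=> x _.
    have mgx : measurable_fun setT (fun s => g (s, x)).
      exact: measurableT_comp Lg.1 (measurable_pair2 x).
    exact: (@average_L2_le R h (fun s => g (s, x)) h0 mgx).
have La : L2 muX (average2 h g).
  by apply: L2_lty => //; apply: le_lt_trans le (L2_integral_lty Lg).
by split => //; rewrite -lee_fin -!ip_sqrE.
Qed.

(** On almost every slice [g] plus its average tends to [2 g], so Fatou's lemma yields the factor 4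
    without convergence of the averages in L^2. Vanishing outside []0, T[] makes the
    square-integrable slices integrable, as differentiation of their primitives demands. *)
Lemma average2_liminf (T : R) g (h : nat -> R) (e : R) : L2 muX g ->
  (forall t x, ~~ (0 < t < T) -> g (t, x) = 0) ->
  (forall n, 0 < h n) -> h n @[n --> \oo] --> 0 -> 0 < e ->
  \forall n \near \oo, 4 * ip muX g g - e <
    ip muX (fun p => g p + average2 (h n) g p) (fun p => g p + average2 (h n) g p).
Proof.
move=> Lg g0 h0 hc e0.
have La n := (average2_L2_le (h0 n) Lg).1.
have Lga n := L2_add Lg (La n).
pose u n (p : measurableTypeR R * X) := ((g p + average2 (h n) g p) ^+ 2)%:E.
have mu_ n : measurable_fun setT (u n).
  by apply/measurable_EFinP; apply: measurable_funX; exact: (Lga n).1.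
have u0 n p : (0 <= u n p)%E by rewrite lee_fin sqr_ge0.
(* The inferior limit is minus the superior limit of the negatives, which is known to be
   measurable. *)
have ml : measurable_fun setT (fun p => limn_einf (u ^~ p)).
  rewrite (_ : (fun _ => _) = (fun p => - limn_esup (fun n => - u n p))%E).
    apply: measurableT_comp => //; apply: measurable_fun_limn_esup => n.
    exact: measurableT_comp.
  apply/funext => p; rewrite -limn_einfN; congr limn_einf.
  by apply/funext => n; rewrite /comp oppeK.
have l0 p : (0 <= limn_einf (u ^~ p))%E.
  rewrite limn_einf_lim; apply: lime_ge; first exact: is_cvg_einfs.
  by apply: nearW => n; apply: le_ereal_inf_tmp => _ [k _ <-].
have m4 : measurable_fun setT (fun p => ((2 * g p) ^+ 2)%:E).
  apply/measurable_EFinP; apply: measurable_funX; apply: measurable_funM => //.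
  exact: Lg.1.
have ae_slice : {ae m, forall x, {ae mu, forall t,
    limn_einf (u ^~ (t, x)) = ((2 * g (t, x)) ^+ 2)%:E}}.
  apply: filterS (L2_slice_fst Lg) => x Lx.
  have ix : mu.-integrable setT (EFin \o (fun t => g (t, x))).
    have LT : L2 mu (\1_`]0, T[ : measurableTypeR R -> R).
      apply: L2_lty; first exact: measurable_indic.
      have e1 t : (\1_`]0, T[ t : R) ^+ 2 = \1_`]0, T[ t.
        by rewrite indicE; case: (_ \in _); rewrite ?expr1n ?expr0n.
      under eq_integral do rewrite e1.
      rewrite integral_indic// setIT [ltLHS](lebesgue_measure_itv `]0, T[)/=.
      by case: ifP => _; rewrite ?ltry// -EFinB ltry.
    have := L2_prod LT Lx; apply: eq_integrable => // t _ /=.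
    rewrite indicE; have [tT|tT] := boolP (t \in `]0, T[%classic).
      by rewrite mul1r.
    rewrite mul0r g0//; apply: contra tT => tT.
    by rewrite inE/= in_itv.
  apply: ae_imp (average_cvg_ae ix h0 hc) _ => t ct.
  have : (u n (t, x) @[n --> \oo] --> ((2 * g (t, x)) ^+ 2)%:E)%E.
    apply: cvg_EFin; first exact: nearW.
    rewrite (_ : 2 * g (t, x) = g (t, x) + g (t, x)); last by ring.
    have c2 : g (t, x) + average (h n) (fun s => g (s, x)) t @[n --> \oo] -->
        g (t, x) + g (t, x) by apply: cvgD => //; exact: cvg_cst.
    by rewrite expr2; apply: cvg_trans (cvgM c2 c2).
  by move=> /cvg_limn_einf_sup[].
have E : (\int[muX]_p limn_einf (u ^~ p) = (4 * ip muX g g)%:E)%E.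
  have -> : ((4 * ip muX g g)%:E = \int[muX]_p ((2 * g p) ^+ 2)%:E)%E.
    have L2g := L2_scale 2 Lg.
    by rewrite (ip_sqrE L2g) ipZl// ipZr//; congr EFin; ring.
  rewrite (fubini_tonelli2 _ ml l0) (fubini_tonelli2 _ m4); last first.
    by move=> p; rewrite lee_fin sqr_ge0.
  apply: ge0_ae_eq_integral => //.
  - exact: measurable_fun_fubini_tonelli_G.
  - apply: measurable_fun_fubini_tonelli_G => // p.
    by rewrite lee_fin sqr_ge0.
  - by move=> x _; apply: integral_ge0.
  - by move=> x _; apply: integral_ge0 => t _; rewrite lee_fin sqr_ge0.
  apply: filterS ae_slice => x ax _; apply: ge0_ae_eq_integral => //.
  - exact: measurableT_comp ml (measurable_pair2 x).
  - exact: measurableT_comp m4 (measurable_pair2 x).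
  - by move=> t _; rewrite lee_fin sqr_ge0.
  - by apply: ae_imp ax _ => t at_ _.
have := @fatou _ _ _ muX setT measurableT u mu_ (fun n p _ => u0 n p).
rewrite E => F.
have : ((4 * ip muX g g - e)%:E < limn_einf (fun n => \int[muX]_p u n p))%E.
  by apply: lt_le_trans F; rewrite lte_fin ltrBlDr ltrDl.
move=> /limn_einf_near; apply: filterS => n.
by rewrite /u ip_sqrE// lte_fin.
Qed.

Lemma L2_window_tensor h t (v : X -> R) : 0 < h -> L2 m v ->
  L2 muX (fun p => window h t p.1 * v p.2).
Proof.
move=> h0 Lv.
have mw := @measurable_window2 R h t.
set wv := fun p : measurableTypeR R * X => window h t p.1 * v p.2.
have mwv : measurable_fun setT wv.
  by apply: measurable_funM; [exact: measurableT_comp mw measurable_fst|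
    exact: measurableT_comp Lv.1 measurable_snd].
apply: L2_prod_tonelli => //.
rewrite (eq_integral (fun x => (v x ^+ 2)%:E * h%:E)%E); last first.
    move=> x _; under eq_integral do rewrite /wv /= exprMn window_sqr mulrC EFinM.
    rewrite ge0_integralZl//.
    - by rewrite integral_window2.
    - exact/measurable_EFinP.
    - by move=> s _; rewrite lee_fin; case/andP: (window01 h t s).
    - by rewrite lee_fin sqr_ge0.
  under eq_integral do rewrite muleC.
  rewrite ge0_integralZl//.
  - by rewrite (ip_sqrE Lv) -EFinM ltry.
  - by apply/measurable_EFinP; apply: measurable_funX; exact: Lv.1.
  - by move=> x _; rewrite lee_fin sqr_ge0.
  - by rewrite lee_fin ltW.
Qed.

Lemma integrable_window_ip h g (v : X -> R) t : 0 < h -> L2 muX g -> L2 m v ->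
  mu.-integrable setT (EFin \o (fun s => window h t s * ip m (fun x => g (s, x)) v)).
Proof.
move=> h0 Lg Lv; have ifg := L2_prod (L2_window_tensor t h0 Lv) Lg.
apply: (integrable_ae_eq measurableT _ _ (integrable_Rintegral_snd ifg)).
  apply/measurable_EFinP; apply: measurable_funM; first exact: measurable_window2.
  apply: (@measurable_Rintegral_snd _ _ _ _ _ m (fun p => g p * v p.2)).
  by apply: measurable_funM; [exact: Lg.1|exact: measurableT_comp Lv.1 measurable_snd].
apply: ae_imp (L2_slice_snd Lg) _ => s Ls _ /=.
rewrite /ip -RintegralZl//; last exact: L2_prod.
by congr EFin; apply: eq_Rintegral => x _; ring.
Qed.

(** Fubini's theorem for [window h t s * v x * g (s, x)], a product of two square-integrable
    functions on space-time. It converts the integrated weak formulation into a pairing with the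
    average. *)
Lemma ip_average2 h g (v : X -> R) t : 0 < h -> L2 muX g -> L2 m v ->
  ip m (fun x => average2 h g (t, x)) v =
  h^-1 * \int[mu]_s (window h t s * ip m (fun x => g (s, x)) v).
Proof.
move=> h0 Lg Lv.
have mw := @measurable_window2 R h t.
pose wv (p : measurableTypeR R * X) := window h t p.1 * v p.2.
have Lwv : L2 muX wv by exact: L2_window_tensor.
have ifg := L2_prod Lwv Lg.
have m1 : measurable_fun setT (fun x => \int[mu]_s (wv (s, x) * g (s, x))).
  by apply/measurable_EFinP; exact: measurable_int (integrable_Rintegral_fst ifg).
have m2 : measurable_fun setT (fun s => \int[m]_x (wv (s, x) * g (s, x))).
  by apply/measurable_EFinP; exact: measurable_int (integrable_Rintegral_snd ifg).
transitivity (h^-1 * \int[m]_x \int[mu]_s (wv (s, x) * g (s, x))).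
  rewrite -RintegralZl//; last exact: (integrable_Rintegral_fst ifg).
  apply: Rintegral_ae_eq => //.
  - apply: measurable_funM; last exact: Lv.1.
    exact: measurableT_comp (measurable_average2 h Lg.1) (pair1_measurable t).
  - exact: measurable_funM.
  apply: filterS (L2_slice_fst Lg) => x Lx _.
  rewrite /average2 /average /= -mulrA; congr (_ * _).
  rewrite -RintegralZr//; last exact: L2_prod (L2_window t h0) Lx.
  by apply: eq_Rintegral => s _; rewrite /wv/=; ring.
congr (_ * _); rewrite (Rintegral_prod21 ifg) -(Rintegral_prod12 ifg).
apply: Rintegral_ae_eq => //.
  apply: measurable_funM => //.
  apply: (@measurable_Rintegral_snd _ _ _ _ _ m (fun p => g p * v p.2)).
  by apply: measurable_funM; [exact: Lg.1|exact: measurableT_comp Lv.1 measurable_snd].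
apply: ae_imp (L2_slice_snd Lg) _ => s Ls _.
rewrite /ip -RintegralZl//; last exact: L2_prod.
by apply: eq_Rintegral => x _; rewrite /wv/=; ring.
Qed.

End steklov_product.

(** * The energy inequality on an abstract measure space *)

Section energy.
Context (R : realType).
Local Notation mu := (@lebesgue_measure R).

Lemma integrable_sumR (dX : measure_display) (X : measurableType dX)
    (m : {measure set X -> \bar R}) (I : Type) (r : seq I) (F : I -> X -> R) :
  (forall i, m.-integrable setT (EFin \o F i)) ->
  m.-integrable setT (EFin \o (fun x => \sum_(i <- r) F i x)).
Proof.
move=> iF; elim: r => [|i r IH].
  by under eq_fun do rewrite big_nil; exact: integrable0.
by under eq_fun do rewrite big_cons; apply: integrable_addR.
Qed.

Lemma Rintegral_sum (dX : measure_display) (X : measurableType dX)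
    (m : {measure set X -> \bar R}) (I : Type) (r : seq I) (F : I -> X -> R) :
  (forall i, m.-integrable setT (EFin \o F i)) ->
  \int[m]_x (\sum_(i <- r) F i x) = \sum_(i <- r) \int[m]_x F i x.
Proof.
move=> iF; elim: r => [|i r IH].
  under eq_Rintegral do rewrite big_nil.
  by rewrite big_nil /Rintegral integral0.
under eq_Rintegral do rewrite big_cons.
by rewrite big_cons RintegralD// ?IH//; exact: integrable_sumR.
Qed.

(** The integral telescopes: it is the mean of [E] over []T - h, T[] minus its mean over []-h,
    0[]. *)
Lemma continuous_increment_cvg (E : R -> R) (T : R) (h : nat -> R) : 0 < T ->
  continuous E -> (forall n, 0 < h n) -> (forall n, h n <= 1) ->
  h n @[n --> \oo] --> 0 ->
  \int[mu]_(t in `]0, T[) ((h n)^-1 * (E t - E (t - h n))) @[n --> \oo] -->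
    E T - E 0.
Proof.
move=> T0 cE h0 h1 hc.
(* The base point -2 leaves room on the left: as [h n <= 1], the shifted argument stays above -2 for
   all times above -1. *)
pose F x := \int[mu]_(s in `[- (2 : R), x]) E s.
have DF x : - 2 < x -> has_deriv F x (E x).
  move=> x2; have x1 : x < x + 1 by rewrite ltrDl.
  have iE : mu.-integrable `[- (2 : R), x + 1] (EFin \o E).
    by apply: continuous_itv_integrable; exact: continuous_subspaceT.
  have [dF <-] := continuous_FTC1_closed x1 iE x2 (cE x).
  exact: derivable_has_deriv.
have cq n : continuous (fun t => (h n)^-1 * (E t - E (t - h n))).
  move=> x; apply: cvgM; first exact: cvg_cst.
  apply: cvgB; first exact: cE.
  apply: (@continuous_comp _ _ _ (fun t => t - h n) E); last exact: cE.
  by apply: cvgB; [exact: cvg_id|exact: cvg_cst].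
have DK n x : - 1 < x -> has_deriv (fun t => (h n)^-1 * (F t - F (t - h n))) x
    ((h n)^-1 * (E x - E (x - h n))).
  move=> x1; have dsh : has_deriv (fun t => t - h n) x 1.
    by have := has_deriv_sub (has_deriv_id x) (has_deriv_cst (h n) x); rewrite subr0.
  have h1n := h1 n.
  have d1 : has_deriv F x (E x) by apply: DF; lra.
  have d2 : has_deriv F (x - h n) (E (x - h n)) by apply: DF; lra.
  have d3 := has_deriv_comp (g := fun t => t - h n) d2 dsh.
  apply: has_deriv_eq (has_deriv_mul (has_deriv_cst (h n)^-1 x) (has_deriv_sub d1 d3)) _.
  by ring.
have IE n : \int[mu]_(t in `]0, T[) ((h n)^-1 * (E t - E (t - h n))) =
   (h n)^-1 * (F T - F (T - h n)) - (h n)^-1 * (F 0 - F (0 - h n)).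
  rewrite Rintegral_oo_cc; last first.
    by apply: continuous_itv_oo_integrable; exact: continuous_subspaceT.
  rewrite /Rintegral (@continuous_FTC2 _ _ (fun t => (h n)^-1 * (F t - F (t - h n))))//=.
  - exact: continuous_subspaceT.
  - split.
    + move=> x; rewrite in_itv/= => /andP[x0 _].
      by apply: has_deriv_derivable (DK n x _); lra.
    + apply: cvg_at_right_filter.
      by apply: has_deriv_continuous (DK n 0 _); lra.
    + apply: cvg_at_left_filter.
      by apply: has_deriv_continuous (DK n T _); lra.
  - move=> x; rewrite in_itv/= => /andP[x0 _].
    by apply: has_deriv_derive1 (DK n x _); lra.
under eq_fun do rewrite IE.
by apply: cvgB; apply: backward_quotient_cvg => //; apply: DF; lra.
Qed.

(** Constant continuation beyond [[0, T]] gives a meaning to backward differences at times smaller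
    than [h]. *)
Lemma continuous_clamp (E : R -> R) (T : R) : 0 <= T ->
  {within `[0, T], continuous E} ->
  continuous (fun t : R => E (Num.min T (Num.max 0 t))).
Proof.
move=> T0 cE x; pose c (t : R) : R := Num.min T (Num.max 0 t).
have cc : continuous c.
  move=> y.
  have h1 : {for y, continuous ((fun=> 0 : R^o) \max (id : R -> R^o))}.
    by apply: continuous_max; [exact: cvg_cst|exact: cvg_id].
  have : {for y, continuous ((fun=> T : R^o) \min ((fun=> 0 : R^o) \max (id : R -> R^o)))}.
    by apply: continuous_min; first exact: cvg_cst.
  exact.
have cI t : `[0, T]%classic (c t).
  rewrite /c /= in_itv/= ge_min lexx le_min T0 le_max lexx/=.
  by [].
have /subspace_continuousP /(_ (c x) (cI x)) h := cE.
apply: (@cvg_comp _ _ _ c E _ (within `[0, T] (nbhs (c x))) _ _ h).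
move=> A A0.
have : \forall t \near x, `[0, T]%classic (c t) -> A (c t) := cc x _ A0.
by apply: filterS => t; apply.
Qed.

Context (dX : measure_display) (X : measurableType dX).
Variable m : {sigma_finite_measure set X -> \bar R}.
Local Notation muX := (mu \x m)%E.

Let sl (U : measurableTypeR R * X -> R) (t : R) (x : X) := U (t, x).

(** For [t < h] the window reaches negative times; since [phi] is zero there, the uncut window can
    be kept. *)
Let window_itv (phi : R -> R) (h t : R) : 0 < h -> 0 < t ->
  (forall s, s <= 0 -> phi s = 0) ->
  \int[mu]_(s in `]Num.max 0 (t - h), t[) phi s =
  \int[mu]_s (window h t s * phi s).
Proof.
move=> h0 t0 phi0; rewrite Rintegral_mkcond; apply: eq_Rintegral => s _.
rewrite patchE windowE indicE.
have [s0|s0] := leP s 0.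
  rewrite phi0// mulr0 ifF//; apply/negbTE; rewrite notin_setE/= in_itv/=.
  by rewrite gt_max ltNge s0.
rewrite (_ : (s \in `]Num.max 0 (t - h), t[%classic) = (s \in `]t - h, t[%classic)).
  by case: ifP; rewrite ?mul1r ?mul0r.
by apply/idP/idP; rewrite !inE/= !in_itv/= gt_max s0.
Qed.

(** Combines, at one index, the integrated inequality with lower bounds for the increment [q] and
    for the gradient term [B]. Here [c] is the tolerance, [d] the diffusion coefficient and [n] the
    number of gradient components. *)
Let energy_arith (eT e0 q P S A B d n c : R) : d * (4 * A - n * c) <= d * B ->
  eT - e0 - c < q -> q + d * B <= P + S + 2 * d * A ->
  eT + 2 * d * A <= e0 + P + S + (c + d * n * c).
Proof. by nra. Qed.

(* [2 (z t - z (t - h), z t) >= |z t|^2 - |z (t - h)|^2], and the gradient term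
   [2 (average g, g)] is [|g + average g|^2 - |g|^2 - |average g|^2], whose lower
   limit needs only Fatou's lemma. *)
Lemma energy_inequality (T D : R) (z : R -> X -> R) (n : nat)
    (Y p : measurableTypeR R * X -> R) (G : 'I_n -> measurableTypeR R * X -> R) :
  0 < T -> 0 <= D ->
  (forall t, 0 <= t <= T -> L2 m (z t)) ->
  {within `[0, T], continuous (fun t => ip m (z t) (z t))} ->
  L2 muX Y -> L2 muX p -> (forall i, L2 muX (G i)) ->
  (forall t x, ~~ (0 < t < T) -> p (t, x) = 0) ->
  (forall i t x, ~~ (0 < t < T) -> G i (t, x) = 0) ->
  {ae mu, forall t : R, 0 < t < T -> {ae m, forall x, z t x = Y (t, x)}} ->
  {ae mu, forall t : R, 0 < t < T -> forall s, 0 <= s <= t ->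
    ip m (z t) (sl Y t) - ip m (z s) (sl Y t) =
    \int[mu]_(tau in `]s, t[) (ip m (sl p tau) (sl Y t) -
      D * \sum_i ip m (sl (G i) tau) (sl (G i) t))} ->
  ip m (z T) (z T) + 2 * D * \sum_i ip muX (G i) (G i) <=
  ip m (z 0) (z 0) + ip muX p p + ip muX Y Y.
Proof.
move=> T0 D0 Lz cE LY Lp LG p0 G0 zY incr.
pose h (k : nat) : R := k.+1%:R^-1.
have h0 k : 0 < h k by rewrite invr_gt0 ltr0n.
have h1 k : h k <= 1 by rewrite invf_le1 ?ltr0n// ler1n.
have hc : h k @[k --> \oo] --> 0.
  by apply: cvg_harmonic.
pose E t := ip m (z t) (z t).
pose Ec (t : R) := E (Num.min T (Num.max 0 t)).
have cEc : continuous Ec by apply: continuous_clamp => //; exact: ltW.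
pose q k t := (h k)^-1 * (Ec t - Ec (t - h k)).
pose a k := average2 (h k) p.
pose b k i := average2 (h k) (G i).
have La k := average2_L2_le (h0 k) Lp.
have Lb k i := average2_L2_le (h0 k) (LG i).
have LGb k i := L2_add (LG i) (Lb k i).1.
pose N (U : measurableTypeR R * X -> R) t := ip m (sl U t) (sl U t).
have iN U : L2 muX U -> mu.-integrable setT (EFin \o N U).
  exact: integrable_ip_snd.
have IN U : L2 muX U -> \int[mu]_t N U t = ip muX U U.
  exact: Rintegral_ip_snd.
have iq k : mu.-integrable `]0, T[ (EFin \o q k).
  apply: continuous_itv_oo_integrable; apply: continuous_subspaceT => x.
  apply: cvgM; first exact: cvg_cst.
  apply: cvgB; first exact: cEc.
  apply: (@continuous_comp _ _ _ (fun t => t - h k) Ec); last exact: cEc.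
  by apply: cvgB; [exact: cvg_id|exact: cvg_cst].
have iqT k : mu.-integrable setT (EFin \o (q k \_ `]0, T[)).
  rewrite -restrict_EFin; apply/integrable_restrict => //.
  by rewrite setTI.
(* The estimate at a fixed time: the forcing term is split by Young's inequality, and polarization
   turns the product of gradient and averaged gradient into squares. *)
have slN k : {ae mu, forall t : R, [set: R] t -> (q k \_ `]0, T[) t + D * (\sum_i N (fun x => G i x + b k i x) t) <=
    N (a k) t + N Y t + D * (\sum_i (N (G i) t + N (b k i) t))}.
  have aeG : {ae mu, forall t : R, forall i, L2 m (sl (G i) t)}.
    by apply: ae_forall_ord => i; exact: L2_slice_snd.
  have aeb : {ae mu, forall t : R, forall i, L2 m (sl (b k i) t)}.
    by apply: ae_forall_ord => i; exact: (L2_slice_snd (Lb k i).1).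
  have aes := ae_imp2 (L2_slice_snd LY) (L2_slice_snd (La k).1) (fun t a b => conj a b).
  have aes2 := ae_imp2 aeG aeb (fun t a b => conj a b).
  have aes3 := ae_imp2 zY incr (fun t a b => conj a b).
  have aes4 := ae_imp2 aes aes2 (fun t a b => conj a b).
  apply: ae_imp2 aes3 aes4 _ => t [zYt incrt] [[LYt Lat] [LGt Lbt]] _.
  have Nadd i : N (fun x => G i x + b k i x) t =
      N (G i) t + 2 * ip m (sl (b k i) t) (sl (G i) t) + N (b k i) t.
    by rewrite /N (ipC _ (sl (b k i) t)) -ip_addsq.
  have N0 U : 0 <= N U t by exact: ip_ge0.
  (* Outside []0, T[] the slice of [G] is zero, so the cross term vanishes and only nonnegativity of
     squares is left to check. *)
  rewrite patchE; case: ifPn => [|tT]; last first.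
    have tT' : ~~ (0 < t < T).
      by apply: contra tT => tT; rewrite inE/= in_itv.
    have Nz i : N (fun x => G i x + b k i x) t = N (G i) t + N (b k i) t.
      have gz : sl (G i) t = fun=> 0 by apply/funext => x; exact: G0.
      rewrite Nadd gz (_ : ip m _ (fun=> 0) = 0) ?mulr0 ?addr0//.
      rewrite /ip (@eq_Rintegral _ _ _ _ _ (cst 0)) ?Rintegral_cst ?mul0r//.
      by move=> x _; rewrite mulr0.
    rewrite [point](_ : _ = 0)// add0r.
    by under eq_bigr do rewrite Nz; rewrite lerDr addr_ge0.
  rewrite inE/= in_itv/= => tT.
  have {}zYt := zYt tT; have {}incrt := incrt tT.
  have /andP[t0 tT'] := tT.
  have LztT : L2 m (z t) by apply: Lz; rewrite !ltW.
  set s := Num.max 0 (t - h k).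
  have s0t : 0 <= s <= t.
    by rewrite /s le_max lexx/= ge_max (ltW t0)/= gerBl ltW.
  have LzsT : L2 m (z s).
    by apply: Lz; have /andP[-> st] := s0t; rewrite (le_trans st)// ltW.
  have zYip w : L2 m w -> ip m w (z t) = ip m w (sl Y t).
    move=> Lw; apply: ip_ae_eq => //; try exact: Lw.1; first exact: LztT.1.
    - exact: LYt.1.
    - exact: aeW.
  have qE : q k t = (h k)^-1 * (E t - E s).
    rewrite /q /Ec; congr (_ * (E _ - E _)).
      by rewrite (max_r (ltW t0)) min_r// ltW.
    rewrite min_r// ge_max (ltW T0)/= lerBlDr (le_trans (ltW tT'))// lerDl ltW//.
  (* Nonnegativity of [|z t - z s|^2] does the work of a product rule; [z t] and the slice of [Y]
     agree almost everywhere. *)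
  have Est : E t - E s <= 2 * (ip m (z t) (sl Y t) - ip m (z s) (sl Y t)).
    rewrite -!zYip//; have := ip_ge0 m (fun x => z t x - z s x).
    by rewrite ip_subsq// (ipC m (z t) (z s)) /E; lra.
  have phiz U tau w : (forall x, U (tau, x) = 0) -> ip m (sl U tau) w = 0.
    move=> U0; rewrite /ip (@eq_Rintegral _ _ _ _ _ (cst 0)) ?Rintegral_cst ?mul0r//.
    by move=> x _; rewrite /sl U0 mul0r.
  have neg tau : tau <= 0 -> ~~ (0 < tau < T) by rewrite ltNge => ->.
  (* The increment formula tested with the slice of [Y] at the same time [t], divided by [h k]. *)
  have IE : (h k)^-1 * (ip m (z t) (sl Y t) - ip m (z s) (sl Y t)) =
      ip m (sl (a k) t) (sl Y t) - D * \sum_i ip m (sl (b k i) t) (sl (G i) t).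
    rewrite incrt// window_itv//; last first.
      move=> tau /neg tau0; rewrite phiz ?big1 ?mulr0 ?subr0// => [i _|x]; last exact: p0.
      by apply: phiz => x; exact: G0.
    have i1 := integrable_window_ip t (h0 k) Lp LYt.
    have i2 i := integrable_window_ip t (h0 k) (LG i) (LGt i).
    under eq_Rintegral do rewrite mulrBr mulrCA mulr_sumr.
    rewrite RintegralB//; last first.
      by apply: integrable_scaleR => //; exact: integrable_sumR.
    rewrite RintegralZl//; last exact: integrable_sumR.
    rewrite Rintegral_sum// mulrBr mulrCA mulr_sumr.
    congr (_ - D * _); first by rewrite -ip_average2.
    by apply: eq_bigr => i _; rewrite -ip_average2.
  have y1 := ip_young Lat LYt.
  have e1 : q k t <= 2 * ip m (sl (a k) t) (sl Y t) -
      D * \sum_i (2 * ip m (sl (b k i) t) (sl (G i) t)).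
    rewrite -mulr_sumr (_ : _ - _ = 2 * (ip m (sl (a k) t) (sl Y t) -
      D * \sum_i ip m (sl (b k i) t) (sl (G i) t))); last by ring.
    rewrite -IE qE mulrCA; apply: ler_wpM2l => //.
    by rewrite invr_ge0 ltW.
  under eq_bigr do rewrite Nadd addrAC.
  rewrite big_split/= mulrDr.
  rewrite /N; lra.
(* Integration over time. Averaging does not increase the L^2 norm, so the averages on the right are
   replaced by [p] and [G i]. *)
have ineq k : \int[mu]_(t in `]0, T[) q k t +
    D * (\sum_i ip muX (fun x => G i x + b k i x) (fun x => G i x + b k i x)) <=
    ip muX p p + ip muX Y Y + 2 * D * \sum_i ip muX (G i) (G i).
  have iS1 : mu.-integrable setT (EFin \o (fun t => \sum_i N (fun x => G i x + b k i x) t)).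
    by apply: integrable_sumR => i; apply: iN; exact: LGb.
  have iS2i i : mu.-integrable setT (EFin \o (fun t => N (G i) t + N (b k i) t)).
    by apply: integrable_addR => //; apply: iN; [exact: LG|exact: (Lb k i).1].
  have iS2 : mu.-integrable setT (EFin \o (fun t => \sum_i (N (G i) t + N (b k i) t))).
    exact: integrable_sumR.
  have iNa := iN _ (La k).1; have iNY := iN _ LY.
  have iaY := integrable_addR measurableT iNa iNY.
  have iD1 := integrable_scaleR D measurableT iS1.
  have iD2 := integrable_scaleR D measurableT iS2.
  have eL : \int[mu]_t ((q k \_ `]0, T[) t +
      D * (\sum_i N (fun x => G i x + b k i x) t)) =
      \int[mu]_(t in `]0, T[) q k t +
      D * (\sum_i ip muX (fun x => G i x + b k i x) (fun x => G i x + b k i x)).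
    rewrite (RintegralD measurableT (iqT k) iD1) (RintegralZl D measurableT iS1).
    rewrite -[X in X + _]Rintegral_mkcond Rintegral_sum; last first.
      by move=> i; apply: iN; exact: LGb.
    by congr (_ + D * _); apply: eq_bigr => i _; apply: IN; exact: LGb.
  have eR : \int[mu]_t (N (a k) t + N Y t + D * (\sum_i (N (G i) t + N (b k i) t))) =
      ip muX (a k) (a k) + ip muX Y Y +
      D * (\sum_i (ip muX (G i) (G i) + ip muX (b k i) (b k i))).
    rewrite (RintegralD measurableT iaY iD2) (RintegralD measurableT iNa iNY).
    rewrite (IN _ (La k).1) (IN _ LY) (RintegralZl D measurableT iS2).
    rewrite Rintegral_sum//; congr (_ + D * _); apply: eq_bigr => i _.
    rewrite (RintegralD measurableT (iN _ (LG i)) (iN _ (Lb k i).1)).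
    by rewrite (IN _ (LG i)) (IN _ (Lb k i).1).
  have := ae_le_Rintegral measurableT (integrable_addR measurableT (iqT k) iD1)
    (integrable_addR measurableT iaY iD2) (slN k).
  rewrite eL eR => /le_trans; apply.
  apply: lerD; first by rewrite lerD2r; exact: (La k).2.
  rewrite (mulrC 2) -mulrA; apply: ler_wpM2l => //.
  rewrite mulr_sumr; apply: ler_sum => i _.
  by have := (Lb k i).2; rewrite /b; lra.
apply/ler_addgt0Pr => e e0.
(* The tolerance [e'] is spent once on the increment of [E] and, with weight [D], once on each
   gradient component. *)
pose M : R := 1 + D * n%:R.
have M0 : 0 < M by rewrite ltr_pwDl// mulr_ge0.
pose e' := e / M.
have e'0 : 0 < e' by rewrite divr_gt0.
have lim1 : \int[mu]_(t in `]0, T[) q k t @[k --> \oo] --> E T - E 0.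
  have := continuous_increment_cvg T0 cEc h0 h1 hc.
  rewrite /Ec (max_r (ltW T0)) minxx maxxx (min_r (ltW T0)).
  by [].
have near1 : \forall k \near \oo, E T - E 0 - e' < \int[mu]_(t in `]0, T[) q k t.
  have /cvgrPdist_lt /(_ _ e'0) := lim1; apply: filterS => k.
  by rewrite ltr_norml; lra.
have near2 : \forall k \near \oo, forall i, 4 * ip muX (G i) (G i) - e' <
    ip muX (fun x => G i x + b k i x) (fun x => G i x + b k i x).
  by apply: near_forall_ord => i; exact: (average2_liminf (LG i) (@G0 i) h0 hc e'0).
have [k [k1 k2]] : exists k, E T - E 0 - e' < \int[mu]_(t in `]0, T[) q k t /\
    forall i, 4 * ip muX (G i) (G i) - e' <
    ip muX (fun x => G i x + b k i x) (fun x => G i x + b k i x).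
  have := filterI near1 near2; case=> k _ /(_ k (leqnn k)) [? ?].
  by exists k.
have := ineq k.
have S : D * (4 * \sum_i ip muX (G i) (G i) - n%:R * e') <=
    D * (\sum_i ip muX (fun x => G i x + b k i x) (fun x => G i x + b k i x)).
  apply: ler_wpM2l => //.
  have -> : 4 * \sum_i ip muX (G i) (G i) - n%:R * e' =
      \sum_(i < n) (4 * ip muX (G i) (G i) - e').
    by rewrite sumrB mulr_sumr sumr_const card_ord mulr_natl.
  by apply: ler_sum => i _; rewrite ltW.
have eE : e = e' + D * n%:R * e' by rewrite /e' /M; field; rewrite gt_eqF.
rewrite eE; rewrite /E in k1 *.
by move=> ineqk; apply: energy_arith S k1 ineqk.
Qed.

End energy.

Import HBNNSimple.

(** * Integrals of functions not known to be measurable *)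

Section nonmeasurable_integrands.
Context (R : realType) (dX : measure_display) (X : measurableType dX).
Variable m : {measure set X -> \bar R}.

(* The integral of a nonnegative function is the supremum of the integrals of
   the simple functions below it, so no measurability is needed here. *)
Lemma ae_le_integral (f g : X -> \bar R) : (forall x, 0 <= f x)%E ->
  (forall x, 0 <= g x)%E -> {ae m, forall x, (f x <= g x)%E} ->
  (\int[m]_x f x <= \int[m]_x g x)%E.
Proof.
move=> f0 g0 [N [mN N0 fgN]]; rewrite !ge0_integralTE//.
apply: ge_ereal_sup => _ [h /= hf <-].
rewrite -integralT_nnsfun.
have -> : (\int[m]_x (h x)%:E = \int[m]_x (proj_nnsfun h (measurableC mN) x)%:E)%E.
  apply: ge0_ae_eq_integral => //.
  - by apply/measurable_EFinP; exact: measurable_funPT.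
  - by apply/measurable_EFinP; exact: measurable_funPT.
  - by move=> x _; rewrite lee_fin fun_ge0.
  - by move=> x _; rewrite lee_fin fun_ge0.
  exists N; split => // x /= /not_implyP[_]; apply: contra_notP => xN.
  by rewrite /mindic indicE mem_set// mulr1.
rewrite [leLHS]integralT_nnsfun; apply: ereal_sup_ubound.
exists (proj_nnsfun h (measurableC mN)) => //= x.
rewrite /mindic indicE; have [xN|xN] := pselect (N x).
  by rewrite memNset ?mulr0.
rewrite mem_set// mulr1; apply: le_trans (hf x) _.
by have := contra_not (fgN x) xN; rewrite notK.
Qed.

(** Positive and negative parts are compared in both directions. This serves integrands such as
    [t |-> F t (phi t)], in which [F t] is an arbitrary functional. *)
Lemma ae_eq_integral_any (D : set X) (f g : X -> \bar R) :
  {ae m, forall x, D x -> f x = g x} ->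
  (\int[m]_(x in D) f x = \int[m]_(x in D) g x)%E.
Proof.
move=> fg; rewrite [LHS]integralE [RHS]integralE.
have eqp (u v : X -> \bar R) : (forall x, 0 <= u x)%E -> (forall x, 0 <= v x)%E ->
    {ae m, forall x, D x -> u x = v x} ->
    (\int[m]_(x in D) u x = \int[m]_(x in D) v x)%E.
  move=> u0 v0 uv; rewrite [LHS]integral_mkcond [RHS]integral_mkcond.
  apply/eqP; rewrite eq_le; apply/andP; split;
    apply: ae_le_integral => [x|x|]; try (by apply: erestrict_ge0);
    apply: ae_imp uv _ => x uvx; rewrite !patchE; case: ifPn => // xD;
    by rewrite uvx//; move: xD; rewrite inE.
by congr (_ - _)%E; apply: eqp => //; apply: ae_imp fg _ => x fgx Dx;
  rewrite ?funeposE ?funenegE fgx.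
Qed.

Lemma Rintegral_ae_eq_any (D : set X) (f g : X -> R) :
  {ae m, forall x, D x -> f x = g x} ->
  \int[m]_(x in D) f x = \int[m]_(x in D) g x.
Proof.
move=> fg; rewrite /Rintegral; congr fine; apply: ae_eq_integral_any.
by apply: ae_imp fg _ => x /[apply] ->.
Qed.

End nonmeasurable_integrands.

(** * Quadratic norms and norms in time *)

Section Lnorm2.
Context (R : realType) (dX : measure_display) (X : measurableType dX).
Variable m : {measure set X -> \bar R}.

Lemma Lnorm2E (f : X -> \bar R) : Lnorm m 2%:E f = sqrte (\int[m]_x (`|f x| ^+ 2))%E.
Proof.
rewrite unlock /= poweR12_sqrt; last by apply: integral_ge0 => x _; exact: poweR_ge0.
congr sqrte; apply: eq_integral => x _.
case: (f x) => [r||] /=.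
- by rewrite powR_mulrn// expr2 EFinM.
- by rewrite pnatr_eq0/= mulyy.
- by rewrite pnatr_eq0/= mulyy.
Qed.

Lemma Lnorm2_fin (f : X -> R) :
  Lnorm m 2%:E (EFin \o f) = sqrte (\int[m]_x (f x ^+ 2)%:E)%E.
Proof.
rewrite Lnorm2E; congr sqrte; apply: eq_integral => x _ /=.
by rewrite -EFinM -normrM -expr2 ger0_norm ?sqr_ge0.
Qed.

Lemma Lnorm2_L2 (f : X -> R) : L2 m f ->
  Lnorm m 2%:E (EFin \o f) = (Num.sqrt (ip m f f))%:E.
Proof. by move=> Lf; rewrite Lnorm2_fin ip_sqrE. Qed.

Lemma Lnorm2_lty (f : X -> R) : measurable_fun setT f ->
  (Lnorm m 2%:E (EFin \o f) < +oo)%E -> L2 m f.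
Proof.
move=> mf; rewrite Lnorm2_fin => h; apply: L2_lty => //.
by move: h; case: (integral _ _ _) => [r||]//=; rewrite ?ltry ?ltNyr.
Qed.

End Lnorm2.

Section time_norms.
Context (R : realType) (T : R).
Local Notation mu := (@lebesgue_measure R).

(** [N] stands for norms of slices. One of them is the dual norm, an uncountable supremum whose
    measurability in time is not established; domination by the root of an integrable function is
    enough. *)
Lemma time_norm2_le (N : R -> \bar R) (b : R -> R) :
  (forall t, `]0, T[%classic t -> 0 <= b t) ->
  mu.-integrable `]0, T[ (EFin \o b) ->
  {ae mu, forall t : R, `]0, T[%classic t -> (`|N t| <= (Num.sqrt (b t))%:E)%E} ->
  (time_norm T 2%:E N <= (Num.sqrt (\int[mu]_(t in `]0, T[) b t))%:E)%E.
Proof.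
move=> b0 ib Nb; rewrite /time_norm Lnorm2E.
have -> : ((Num.sqrt (\int[mu]_(t in `]0, T[) b t))%:E =
    sqrte (\int[mu]_(t in `]0%R, T[) (b t)%:E))%E.
  by rewrite /Rintegral -[in RHS](fineK (integrable_fin_num _ ib)).
rewrite lee_sqrt; last by apply: integral_ge0 => t tT; rewrite lee_fin b0.
rewrite [leRHS]integral_mkcond; apply: ae_le_integral => [t|t|].
- exact: expe_ge0.
- by apply: erestrict_ge0 => s sT; rewrite lee_fin b0.
apply: ae_imp Nb _ => t Nt; rewrite !patchE; case: ifPn => tT.
  have {}Nt : (`|N t| <= (Num.sqrt (b t))%:E)%E by apply: Nt; rewrite inE in tT.
  have bt : 0 <= b t by apply: b0; rewrite inE in tT.
  rewrite -(sqr_sqrtr bt) EFin_expe.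
  by rewrite !expe2 lee_pmul.
have -> : (point : \bar R) = 0%E by [].
by rewrite abse0 expe2 mul0e.
Qed.

Lemma time_normy_le (N : R -> \bar R) (M : R) : 0 <= M ->
  {ae mu, forall t : R, `]0, T[%classic t -> (`|N t| <= M%:E)%E} ->
  (time_norm T +oo%E N <= M%:E)%E.
Proof.
move=> M0 NM; rewrite /time_norm unlock; case: ifPn => _; last by rewrite lee_fin.
apply/ess_supP; apply: ae_imp NM _ => t Nt /=; rewrite patchE.
case: ifPn => tT; last by rewrite [point](_ : _ = 0%E)// abse0 lee_fin.
by apply: Nt; rewrite inE in tT.
Qed.

Lemma time_normy_ae (N : R -> \bar R) : (time_norm T +oo%E N < +oo)%E ->
  exists2 M : R, 0 <= M & {ae mu, forall t : R, `]0, T[%classic t -> (`|N t| <= M%:E)%E}.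
Proof.
rewrite /time_norm unlock ifT; last first.
  by rewrite -set_itvNyy [X in (_ < X)%E](lebesgue_measure_itv `]-oo, +oo[)/= ltry.
set s := ess_sup _ _ => soo.
have sge := ess_sup_ge mu (abse \o (N \_ `]0, T[)).
exists (Num.max 0 (fine s)); first by rewrite le_max lexx.
apply: ae_imp sge _ => t st tT; move: st; rewrite /= patchE mem_set// => st.
apply: le_trans st _; rewrite -/s; move: soo; case: s => [r||] //= _; last by rewrite leNye.
by rewrite lee_fin le_max lexx orbT.
Qed.

End time_norms.

(** * Open sets are measurable *)

Section borel_open.
Context (R : realType) (d : nat).

Lemma measurable_rV_ball (x : 'rV[R]_d) (e : R) : measurable (ball x e).
Proof.
have [e0|e0] := ltP 0 e; last first.
  rewrite (_ : ball x e = set0)//; apply/seteqP; split => // y [].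
  by rewrite ltNge e0.
have := @measurable_rV_box R d (fun i => ball (x ord0 i) e) (fun i => measurable_ball _ _).
rewrite (_ : [set v | _] = ball x e)//; apply/seteqP; split => [v vb|v [_ vb] i].
  by split => // i j; rewrite (ord1 i); exact: vb.
exact: vb.
Qed.

(** The sigma-algebra comes from the coordinates and balls are boxes, so [A] is written as a
    countable union of balls: those contained in [A] with rational centre and radius [1/(n+1)]. *)
Lemma open_measurable_rV (A : set 'rV[R]_d) : open A -> measurable A.
Proof.
move=> oA.
pose q (k : 'rV[rat]_d * nat) : 'rV[R]_d := \row_i ratr (k.1 ord0 i).
pose B (k : 'rV[rat]_d * nat) : set 'rV[R]_d :=
  if pselect (ball (q k) (k.2.+1%:R^-1) `<=` A) then ball (q k) (k.2.+1%:R^-1) else set0.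
have -> : A = \bigcup_n (if unpickle n is Some k then B k else set0).
  apply/seteqP; split => [x Ax|x [n _]]; last first.
    case: (unpickle n) => // k; rewrite /B.
    by case: pselect => // kA /kA.
  have [e /= e0 eA] : nbhs_ball x A by apply/nbhs_ballP; exact: oA.
  (* With radius below [e / 2], a ball that contains [x] lies in [ball x e], hence in [A]. *)
  have e2 : 0 < e / 2 by rewrite divr_gt0.
  have [n _ /(_ n (leqnn n)) ne] := near_infty_natSinv_lt (PosNum e2).
  have n0 : 0 < n.+1%:R^-1 :> R by rewrite invr_gt0.
  have qx i : exists r : rat, ball (x ord0 i) (n.+1%:R^-1) (ratr r : R).
    have b1 : ball (x ord0 i) (n.+1%:R^-1) !=set0.
      by exists (x ord0 i); exact: ballxx.
    have b2 : open (ball (x ord0 i) (n.+1%:R^-1)) by exact: ball_open.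
    have [y [xy [r _ ry]]] := @dense_rat R _ b1 b2.
    by exists r; rewrite ry.
  have [r xr] := choice qx.
  pose k : 'rV[rat]_d * nat := (\row_i r i, n).
  have kx : ball (q k) n.+1%:R^-1 x.
    split => // i j; rewrite (ord1 i) !mxE/=; apply: ball_sym; exact: xr.
  exists (pickle k) => //; rewrite pickleK /B; case: pselect => //=; apply.
  move=> y ky; apply: eA.
  have : ball x (n.+1%:R^-1 + n.+1%:R^-1) y by apply: ball_triangle ky; exact: ball_sym.
  by apply: le_ball; rewrite [leRHS]splitr lerD// ltW.
apply: bigcup_measurable => n _; case: unpickle => // k; rewrite /B.
by case: (pselect _) => a /=; [exact: measurable_rV_ball|exact: measurable0].
Qed.

End borel_open.

(** * Homogeneity of the integral without measurability *)

Section scaling_nonmeasurable.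
Context (R : realType) (dX : measure_display) (X : measurableType dX).
Variable m : {measure set X -> \bar R}.

Let scale_integral_le (u : X -> \bar R) (r : R) : 0 < r -> (forall x, 0 <= u x)%E ->
  (\int[m]_x u x <= (r^-1)%:E * \int[m]_x (r%:E * u x))%E.
Proof.
move=> r0 u0; rewrite [leLHS]ge0_integralTE//.
apply: ge_ereal_sup => _ [h /= hu <-].
have ru0 x : (0 <= r%:E * u x)%E by rewrite mule_ge0// lee_fin ltW.
rewrite lee_pdivlMl// (ge0_integralTE _ ru0) -sintegralrM.
apply: ereal_sup_ubound; exists (scale_nnsfun h (ltW r0)) => //= x.
by rewrite EFinM lee_pmul2l.
Qed.

(** Scaling the simple functions below [u] gives one inequality; applied to [r^-1] it gives the
    other. *)
Lemma ge0_integralZl_any (u : X -> \bar R) (r : R) : 0 < r -> (forall x, 0 <= u x)%E ->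
  (\int[m]_x (r%:E * u x) = r%:E * \int[m]_x u x)%E.
Proof.
move=> r0 u0; have rV0 : 0 < r^-1 by rewrite invr_gt0.
have ru0 x : (0 <= r%:E * u x)%E by rewrite mule_ge0// lee_fin ltW.
apply/eqP; rewrite eq_le; apply/andP; split; last first.
  by rewrite -lee_pdivlMl//; exact: scale_integral_le.
have := scale_integral_le rV0 ru0; rewrite invrK.
rewrite [X in (_ <= _ * X)%E -> _](eq_integral u)// => x _; rewrite muleA -EFinM mulVf ?mul1e//.
by rewrite gt_eqF.
Qed.

(** Meant for pairings with test functions and their derivatives in the definition of weak
    gradients. *)
Lemma RintegralZl_gt0 (D : set X) (f : X -> R) (r : R) : 0 < r ->
  \int[m]_(x in D) (r * f x) = r * \int[m]_(x in D) f x.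
Proof.
move=> r0; rewrite Rintegral_mkcond [in RHS]Rintegral_mkcond /Rintegral.
rewrite [in LHS]integralE [in RHS]integralE.
have -> : (\int[m]_x (fun x => (((fun x => r * f x) \_ D) x)%:E)^\+ x =
    r%:E * \int[m]_x (fun x => ((f \_ D) x)%:E)^\+ x)%E.
  rewrite -ge0_integralZl_any//; apply: eq_integral => x _.
  rewrite !funeposE !patchE; case: ifP => _ /=.
    by rewrite -!EFin_max -EFinM maxr_pMr ?mulr0// ltW.
  by rewrite maxxx mule0.
have -> : (\int[m]_x (fun x => (((fun x => r * f x) \_ D) x)%:E)^\- x =
    r%:E * \int[m]_x (fun x => ((f \_ D) x)%:E)^\- x)%E.
  rewrite -ge0_integralZl_any//; apply: eq_integral => x _.
  rewrite !funenegE !patchE; case: ifP => _ /=.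
    by rewrite -!EFin_max -EFinM maxr_pMr ?mulr0 ?mulrN// ltW.
  by rewrite oppr0 maxxx mule0.
have p0 : (0 <= \int[m]_x (fun x => ((f \_ D) x)%:E)^\+ x)%E by apply: integral_ge0.
have n0 : (0 <= \int[m]_x (fun x => ((f \_ D) x)%:E)^\- x)%E by apply: integral_ge0.
(* If one of the two parts is infinite, both sides are 0, the value of [fine] at infinity. *)
move: p0 n0; case: (integral _ _ _) => [a||]//; case: (integral _ _ _) => [b||]// _ _.
- by rewrite -!EFinM -!EFinB/= mulrBr.
- by rewrite gt0_muley ?lte_fin//= mulr0.
- by rewrite gt0_muley ?lte_fin//= mulr0.
- by rewrite gt0_muley ?lte_fin//= mulr0.
Qed.

End scaling_nonmeasurable.

(** * L^2, H^1 and dual norms through extension by zero *)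

Section space_bridge.
Context (R : realType) (d : nat) (Omega : set 'rV[R]_d).
Hypothesis mO : measurable Omega.
Local Notation m := (lebesgue_rV R d).
Implicit Types (u v : 'rV[R]_d -> R) (G H : 'rV[R]_d -> 'rV[R]_d).

Lemma in_L2_restrict u : in_L2 Omega u -> L2 m (u \_ Omega).
Proof.
move=> [mu uoo]; apply: Lnorm2_lty uoo.
have h := (measurable_restrictT u mO).1 mu.
exact: h.
Qed.

Lemma L2norm_ip u : L2 m (u \_ Omega) ->
  L2norm Omega u = (Num.sqrt (ip m (u \_ Omega) (u \_ Omega)))%:E.
Proof. by move=> Lu; rewrite /L2norm Lnorm2_L2. Qed.

Lemma restrict_in_L2 u : L2 m (u \_ Omega) -> in_L2 Omega u.
Proof.
move=> Lu; split; last by rewrite L2norm_ip// ltry.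
have h := (measurable_restrictT u mO).2 Lu.1.
exact: h.
Qed.

Lemma restrict_mul u v : (fun x => u x * v x) \_ Omega =
  (fun x => (u \_ Omega) x * (v \_ Omega) x).
Proof.
by apply/funext => x; rewrite !patchE; case: ifP => // _; rewrite [point](_ : _ = 0)// mulr0.
Qed.

Lemma L2inner_ip u v : L2inner Omega u v = ip m (u \_ Omega) (v \_ Omega).
Proof.
by rewrite /L2inner /ip Rintegral_mkcond restrict_mul.
Qed.

Definition comp_ G (i : 'I_d) : 'rV[R]_d -> R := fun x => G x ord0 i.

Lemma integral_dotv G H :
  (forall i, L2 m (comp_ G i \_ Omega)) -> (forall i, L2 m (comp_ H i \_ Omega)) ->
  \int[m]_(x in Omega) dotv (G x) (H x) =
  \sum_i ip m (comp_ G i \_ Omega) (comp_ H i \_ Omega).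
Proof.
move=> LG LH; rewrite Rintegral_mkcond.
rewrite -Rintegral_sum; last by move=> i; exact: L2_prod.
apply: eq_Rintegral => x _; rewrite patchE; case: ifPn => xO.
  by apply: eq_bigr => i _; rewrite !patchE xO.
by rewrite big1// => i _; rewrite !patchE (negbTE xO) [point](_ : _ = 0)// mulr0.
Qed.

Lemma in_H1_L2 v H : in_H1 Omega v H ->
  L2 m (v \_ Omega) /\ forall i, L2 m (comp_ H i \_ Omega).
Proof.
by move=> [Lv LH _]; split => [|i]; apply: in_L2_restrict => //; exact: LH.
Qed.

Definition H1sqr v H : R := ip m (v \_ Omega) (v \_ Omega) +
  \sum_i ip m (comp_ H i \_ Omega) (comp_ H i \_ Omega).

Lemma H1sqr_ge0 v H : 0 <= H1sqr v H.
Proof. by rewrite addr_ge0 ?ip_ge0// sumr_ge0// => i _; exact: ip_ge0. Qed.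

Lemma H1norm_sqr v H : in_H1 Omega v H ->
  H1norm Omega v H = (Num.sqrt (H1sqr v H))%:E.
Proof.
move=> /in_H1_L2[Lv LH]; rewrite /H1norm L2norm_ip// expe2 -EFinM -expr2 sqr_sqrtr ?ip_ge0//.
rewrite (eq_bigr (fun i => (ip m (comp_ H i \_ Omega) (comp_ H i \_ Omega))%:E)).
  by rewrite sumEFin -EFinD.
by move=> i _; rewrite L2norm_ip; [rewrite expe2 -EFinM -expr2 sqr_sqrtr ?ip_ge0|exact: LH].
Qed.

Lemma restrict0 : (fun=> 0 : R) \_ Omega = fun=> 0.
Proof. by apply/funext => x; rewrite patchE; case: ifP. Qed.

Lemma ip0l u : ip m (fun=> 0) u = 0.
Proof.
rewrite /ip (@eq_Rintegral _ _ _ _ _ (cst 0)) ?Rintegral_cst ?mul0r//.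
by move=> x _; rewrite mul0r.
Qed.

Lemma in_H1_0 : in_H1 Omega (fun=> 0) (fun=> 0).
Proof.
split.
- by apply: restrict_in_L2; rewrite restrict0; exact: L2_0.
- move=> i; apply: restrict_in_L2.
  rewrite (_ : (fun=> _) = fun=> 0); first by rewrite restrict0; exact: L2_0.
  by apply/funext => x; rewrite mxE.
- move=> i phi _; rewrite !L2inner_ip.
  rewrite (_ : (fun x => (0 : 'rV[R]_d) ord0 i) = fun=> 0); last first.
    by apply/funext => x; rewrite mxE.
  by rewrite restrict0 !ip0l oppr0.
Qed.

Lemma restrict_scale (r : R) u : (fun x => r * u x) \_ Omega = (fun x => r * (u \_ Omega) x).
Proof.
by apply/funext => x; rewrite !patchE; case: ifP => // _; rewrite [point](_ : _ = 0)// mulr0.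
Qed.

Lemma in_H1_scale (r : R) v H : 0 < r -> in_H1 Omega v H ->
  in_H1 Omega (fun x => r * v x) (fun x => r *: H x).
Proof.
move=> r0 vH; have [Lv LH] := in_H1_L2 vH.
have cE i : (fun x => (r *: H x) ord0 i) = fun x => r * comp_ H i x.
  by apply/funext => x; rewrite mxE.
split.
- by apply: restrict_in_L2; rewrite restrict_scale; exact: L2_scale.
- by move=> i; apply: restrict_in_L2; rewrite cE restrict_scale; exact: L2_scale.
- move=> i phi tp; have [_ _ /(_ i phi tp)] := vH.
  rewrite cE /L2inner.
  under [in X in _ -> X]eq_Rintegral do rewrite -mulrA.
  rewrite RintegralZl_gt0// => ->; rewrite mulrN; congr (- _).
  under [in RHS]eq_Rintegral do rewrite -mulrA.
  by rewrite RintegralZl_gt0.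
Qed.

Lemma H1sqr_scale (r : R) v H : in_H1 Omega v H ->
  H1sqr (fun x => r * v x) (fun x => r *: H x) = r ^+ 2 * H1sqr v H.
Proof.
move=> /in_H1_L2[Lv LH]; rewrite /H1sqr restrict_scale mulrDr; congr (_ + _).
  by rewrite ipZl ?ipZr ?mulrA//; exact: L2_scale.
rewrite mulr_sumr; apply: eq_bigr => i _.
rewrite (_ : comp_ _ i = fun x => r * comp_ H i x); last first.
  by apply/funext => x; rewrite /comp_ mxE.
by rewrite restrict_scale ipZl ?ipZr ?mulrA//; exact: L2_scale.
Qed.

Lemma H1dual_norm_ge0 l : (0 <= H1dual_norm Omega l)%E.
Proof.
apply: (@le_trans _ _ `|l (fun=> 0)|%:E); first by rewrite lee_fin.
apply: ereal_sup_ubound; exists (fun=> 0), (fun=> 0); split => //; first exact: in_H1_0.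
rewrite H1norm_sqr; last exact: in_H1_0.
rewrite /H1sqr restrict0 big1 => [|i _].
  by rewrite addr0 ip0l sqrtr0 lee_fin.
rewrite (_ : comp_ _ i = fun=> 0); last by apply/funext => x; rewrite /comp_ mxE.
by rewrite restrict0 ip0l.
Qed.

Lemma in_H1dual_0 l : in_H1dual Omega l -> l (fun=> 0) = 0.
Proof.
move=> [lin _]; have := lin 1 _ _ _ _ in_H1_0 in_H1_0.
rewrite (_ : (fun x => _) = fun=> 0); last by apply/funext => x; rewrite mulr0 addr0.
by rewrite mul1r => /eqP; rewrite -subr_eq0 opprD addrA subrr add0r oppr_eq0 => /eqP.
Qed.

Lemma in_H1dual_scale l (r : R) v H : in_H1dual Omega l -> in_H1 Omega v H ->
  l (fun x => r * v x) = r * l v.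
Proof.
move=> ld vH; have [lin _] := ld; have := lin r _ _ _ _ vH in_H1_0.
rewrite in_H1dual_0// addr0 => <-; congr l; apply/funext => x.
by rewrite addr0.
Qed.

(** Dividing by 1 plus the norm avoids a case of zero norm. Positive homogeneity is all that is
    asked of [l], so that a difference of two functionals qualifies at once. *)
Lemma homogeneous_H1dual_le (l : ('rV[R]_d -> R) -> R) v H (e : R) :
  (forall r u K, 0 < r -> in_H1 Omega u K -> l (fun x => r * u x) = r * l u) ->
  in_H1 Omega v H -> (H1dual_norm Omega l <= e%:E)%E ->
  `|l v| <= e * (1 + Num.sqrt (H1sqr v H)).
Proof.
move=> hl vH le; set q := 1 + _.
have q0 : 0 < q by rewrite ltr_pwDl// sqrtr_ge0.
have qV : 0 < q^-1 by rewrite invr_gt0.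
have sH := in_H1_scale qV vH.
have : (`|l (fun x => q^-1 * v x)|%:E <= e%:E)%E.
  apply: le_trans le; apply: ereal_sup_ubound.
  exists (fun x => q^-1 * v x), (fun x => q^-1 *: H x); split => //.
  rewrite H1norm_sqr// H1sqr_scale// sqrtrM ?sqr_ge0// sqrtr_sqr gtr0_norm// lee_fin.
  by rewrite ler_pdivrMl// mulr1 /q lerDr.
rewrite lee_fin (hl _ _ _ qV vH) normrM (gtr0_norm qV) ler_pdivrMl//.
by rewrite mulrC.
Qed.

End space_bridge.

(** * Functions on the space-time cylinder *)

Section space_time_bridge.
Context (R : realType) (d : nat) (T : R) (Omega : set 'rV[R]_d).
Hypothesis mO : measurable Omega.
Local Notation m := (lebesgue_rV R d).
Local Notation mu := (@lebesgue_measure R).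
Local Notation muX := (mu \x m)%E.
Implicit Types (A : R -> 'rV[R]_d -> R) (G : R -> 'rV[R]_d -> 'rV[R]_d).

(** The zero extension makes averages over negative times harmless and turns a smaller final time
    into a truncation. *)
Definition ext A : measurableTypeR R * 'rV[R]_d -> R :=
  (fun p : measurableTypeR R * 'rV[R]_d => A p.1 p.2) \_ (Q_T T Omega).

Lemma measurable_Q_T : measurable (Q_T T Omega).
Proof. exact: measurableX. Qed.

Lemma ext_slice A t : 0 < t < T -> (fun x => ext A (t, x)) = A t \_ Omega.
Proof.
move=> tT; apply/funext => x; rewrite /ext !patchE.
rewrite (_ : ((t, x) \in Q_T T Omega) = (x \in Omega))//.
apply/idP/idP; rewrite !inE; first by case.
by move=> xO; split => //=; rewrite in_itv.
Qed.

Lemma ext_out A t x : ~~ (0 < t < T) -> ext A (t, x) = 0.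
Proof.
move=> tT; rewrite /ext patchE memNset// => -[/=]; rewrite in_itv/= => h.
by rewrite h in tT.
Qed.

Lemma measurable_ext A : measurable_Q T Omega A -> measurable_fun setT (ext A).
Proof.
move=> mA; have h := (measurable_restrictT
  (fun p : measurableTypeR R * 'rV[R]_d => A p.1 p.2) measurable_Q_T).1 mA.
exact: h.
Qed.

Lemma L2_ext_slice A t : measurable_Q T Omega A -> 0 < t < T ->
  (L2norm Omega (A t) < +oo)%E -> L2 m (A t \_ Omega).
Proof.
move=> mA tT Aoo; apply: Lnorm2_lty Aoo; rewrite -ext_slice//.
exact: measurableT_comp (measurable_ext mA) (pair1_measurable t).
Qed.

(** By Tonelli's theorem the squared norm is at most [M ^+ 2] times the length of the time
    interval. *)
Lemma L2_ext A (M : R) : measurable_Q T Omega A ->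
  {ae mu, forall t : R, `]0, T[%classic t -> (L2norm Omega (A t) <= M%:E)%E} ->
  L2 muX (ext A).
Proof.
move=> mA AM; have me := measurable_ext mA.
have sq0 p : (0 <= (ext A p ^+ 2)%:E)%E by rewrite lee_fin sqr_ge0.
have msq : measurable_fun setT (fun p => (ext A p ^+ 2)%:E).
  by apply/measurable_EFinP; exact: measurable_funX.
apply: L2_lty => //.
rewrite (@fubini_tonelli1 _ _ _ _ _ mu m (fun p => (ext A p ^+ 2)%:E) msq sq0).
apply: (@le_lt_trans _ _ (\int[mu]_t (M ^+ 2 * \1_`]0, T[ t)%:E)%E).
  apply: ae_le_integral => [t|t|].
  - by apply: integral_ge0 => x _; exact: sq0.
  - by rewrite lee_fin mulr_ge0 ?sqr_ge0// indicE.
  apply: ae_imp AM _ => t AMt; rewrite /fubini_F.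
  have [tT|tT] := boolP (0 < t < T); last first.
    rewrite (eq_integral (cst 0%E)) ?integral0.
      by rewrite lee_fin mulr_ge0 ?sqr_ge0// indicE.
    by move=> x _; rewrite ext_out// expr0n.
  have tT' : `]0, T[%classic t by rewrite /= in_itv.
  have LA : L2 m (A t \_ Omega).
    by apply: L2_ext_slice => //; apply: le_lt_trans (AMt tT') _; rewrite ltry.
  rewrite (_ : integral _ _ _ = (ip m (A t \_ Omega) (A t \_ Omega))%:E); last first.
    rewrite -(ip_sqrE LA); apply: eq_integral => x _.
    by rewrite -(ext_slice _ tT).
  rewrite indicE mem_set// mulr1 lee_fin -(sqr_sqrtr (ip_ge0 m _)).
  have := AMt tT'; rewrite L2norm_ip// lee_fin => AMt'.
  by rewrite ler_pXn2r// ?nnegrE ?sqrtr_ge0// (le_trans _ AMt') ?sqrtr_ge0.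
under eq_integral do rewrite EFinM.
rewrite ge0_integralZl//.
- rewrite integral_indic// setIT.
  rewrite [X in (_ * X)%E](lebesgue_measure_itv `]0, T[)/=.
  by case: ifP => _; rewrite -?EFinB -?EFinM ?ltry// mule0 ltry.
- by apply/measurable_EFinP; exact: measurable_indic.
- by rewrite lee_fin sqr_ge0.
Qed.

Definition gcomp G (i : 'I_d) : measurableTypeR R * 'rV[R]_d -> R :=
  ext (fun t => comp_ (G t) i).

(** The squared norm is a finite sum of nonnegative integrals, so its finiteness passes to each
    component. *)
Lemma gradQ_norm_ip G : (forall i, measurable_Q T Omega (fun t => comp_ (G t) i)) ->
  (gradQ_norm T Omega G < +oo)%E ->
  (forall i, L2 muX (gcomp G i)) /\
  gradQ_norm T Omega G = (Num.sqrt (\sum_i ip muX (gcomp G i) (gcomp G i)))%:E.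
Proof.
move=> mG; have me i := measurable_ext (mG i).
have sqE p : ((fun p => Num.sqrt (dotv (G p.1 p.2) (G p.1 p.2))) \_ (Q_T T Omega)) p ^+ 2 =
    \sum_i gcomp G i p ^+ 2.
  rewrite patchE; case: ifPn => pQ.
    rewrite sqr_sqrtr; last by apply: sumr_ge0 => i _; rewrite -expr2 sqr_ge0.
    by apply: eq_bigr => i _; rewrite /gcomp /ext patchE pQ expr2.
  rewrite [point](_ : _ = 0)// expr0n/= big1// => i _.
  by rewrite /gcomp /ext patchE (negbTE pQ) [point](_ : _ = 0)// expr0n.
have msum : measurable_fun setT (fun p => (\sum_i gcomp G i p ^+ 2)%:E).
  apply/measurable_EFinP; apply: measurable_sum => i.
  by apply: measurable_funX; exact: me.
have IE : (\int[muX]_p (\sum_i gcomp G i p ^+ 2)%:E =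
    \sum_i \int[muX]_p (gcomp G i p ^+ 2)%:E)%E.
  under eq_integral do rewrite -sumEFin.
  rewrite ge0_integral_sum//.
    by move=> i; apply/measurable_EFinP/measurable_funX; exact: me.
  by move=> i p _; rewrite lee_fin sqr_ge0.
rewrite [gradQ_norm _ _ _](Lnorm2_fin muX ((fun p : measurableTypeR R * 'rV[R]_d =>
  Num.sqrt (dotv (G p.1 p.2) (G p.1 p.2))) \_ (Q_T T Omega))).
under eq_integral do rewrite sqE.
rewrite IE => fin.
have LG i : L2 muX (gcomp G i).
  apply: L2_lty; first exact: me.
  have : (\sum_i \int[muX]_p (gcomp G i p ^+ 2)%:E < +oo)%E.
    by move: fin; case: (\sum_i _)%E => [r||]//=; rewrite ?ltry ?ltNyr.
  apply: le_lt_trans; rewrite (bigD1 i)//= leeDl// sume_ge0// => j _.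
  by apply: integral_ge0 => p _; rewrite lee_fin sqr_ge0.
split => //; rewrite (eq_bigr (fun i => (ip muX (gcomp G i) (gcomp G i))%:E)).
  by rewrite sumEFin.
by move=> i _; rewrite ip_sqrE.
Qed.

End space_time_bridge.

(** * Strongly measurable families of functionals *)

Section dual_space.
Context (R : realType) (d : nat) (T : R) (Omega : set 'rV[R]_d).
Hypothesis mO : measurable Omega.
Local Notation mu := (@lebesgue_measure R).

Lemma finite_range_enum (I S : Type) (f : I -> S) : finite_set (range f) ->
  I -> exists e : nat -> S, forall i, exists k, f i = e k.
Proof.
move=> /finite_set_countable cf i0.
have /pfcard_geP[f0|[g]] := cf.
  by have : range f (f i0) by [exists i0]; rewrite f0.
exists g => i; have : range f (f i) by exists i.
by move=> /(@surj _ _ _ _ g)[k _ <-]; exists k.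
Qed.

(** The simple approximants evaluated at [v] are measurable and converge to [F t v] for almost every
    [t]; their superior limit is the measurable representative. *)
Lemma H1dual_measurable (F : R -> ('rV[R]_d -> R) -> R) v H :
  strongly_measurable T Omega F ->
  {ae mu, forall t : R, `]0, T[%classic t -> in_H1dual Omega (F t)} ->
  in_H1 Omega v H ->
  exists w : R -> R, measurable_fun setT w /\
    {ae mu, forall t : R, `]0, T[%classic t -> F t v = w t}.
Proof.
move=> [s [fs ms ds cs]] Fd vH.
have msv n : measurable_fun setT (fun t : R => s n t v).
  have [e eP] := finite_range_enum (fs n) 0.
  move=> _ Y mY; rewrite setTI.
  (* The approximant takes finitely many values, so the preimage is a countable union of its level
     sets; no sigma-algebra on functionals is involved. *)
  have -> : (fun t => s n t v) @^-1` Y =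
      \bigcup_k (if pselect (Y (e k v)) then s n @^-1` [set e k] else set0).
    apply/seteqP; split => [t Yt|t [k _]].
      have [k ek] := eP t; exists k => //; case: (pselect _) => /= a.
        exact: ek.
      by case: a; rewrite -ek.
    by case: (pselect _) => /= a // st; rewrite /= st.
  apply: bigcup_measurable => k _; case: (pselect _) => /= a; first exact: ms.
  exact: measurable0.
pose w t : R := fine (limn_esup (fun n => (s n t v)%:E)).
exists w; split.
  apply: (measurableT_comp (fine_measurable measurableT)).
  by apply: measurable_fun_limn_esup => n; exact/measurable_EFinP.
apply: ae_imp2 cs Fd _ => t cst Fdt tT.
have hom n r u K : 0 < r -> in_H1 Omega u K ->
    s n t (fun x => r * u x) - F t (fun x => r * u x) = r * (s n t u - F t u).
  move=> r0 uK; rewrite (in_H1dual_scale mO r (ds n t) uK).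
  by rewrite (in_H1dual_scale mO r (Fdt tT) uK) mulrBr.
have c0 := cst tT.
have cv : s n t v @[n --> \oo] --> F t v.
  apply/cvgrPdist_le => e e0.
  set q := 1 + Num.sqrt (H1sqr Omega v H).
  have q0 : 0 < q by rewrite ltr_pwDl// sqrtr_ge0.
  have eq0 : 0 < e / q by rewrite divr_gt0.
  move/fine_cvgP : c0 => [cfin /cvgrPdist_le /(_ _ eq0)] cn.
  apply: filterS2 cfin cn => n fn; rewrite sub0r normrN => le.
  rewrite distrC.
  have := @homogeneous_H1dual_le _ _ _ mO (fun u : 'rV[R]_d -> R => s n t u - F t u) v H (e / q) (hom n) vH.
  rewrite -/q divfK ?gt_eqF//; apply.
  rewrite -(fineK fn) lee_fin; apply: le_trans le; exact: ler_norm.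
have : ((s n t v)%:E @[n --> \oo] --> (F t v)%:E)%E.
  by apply: cvg_EFin => //; exact: nearW.
by rewrite /w => /cvg_limn_einf_sup[_ ->].
Qed.

(* The dual norm is a supremum over an uncountable set; strong measurability
   reduces it to countably many test functions, which makes a.e. statements usable. *)
Lemma H1dual_norming_family (F : R -> ('rV[R]_d -> R) -> R) :
  strongly_measurable T Omega F ->
  exists (v : nat -> 'rV[R]_d -> R) (H : nat -> 'rV[R]_d -> 'rV[R]_d),
    [/\ forall k, in_H1 Omega (v k) (H k), forall k, H1sqr Omega (v k) (H k) <= 1 &
    {ae mu, forall t : R, `]0, T[%classic t -> forall B, (forall k, `|F t (v k)| <= B) ->
      (H1dual_norm Omega (F t) <= B%:E)%E}].
Proof.
move=> [s [fs ms ds cs]].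
have /choice[e eP] : forall n, exists e : nat -> ('rV[R]_d -> R) -> R,
    forall t, exists k, s n t = e k.
  by move=> n; exact: finite_range_enum (fs n) 0.
have unit0 : H1sqr Omega (fun=> 0) (fun=> 0) <= 1.
  rewrite /H1sqr restrict0 ip0l add0r big1 ?ler01// => i _.
  rewrite (_ : comp_ _ i = fun=> 0); last by apply/funext => x; rewrite /comp_ mxE.
  by rewrite restrict0 ip0l.
(* One near-maximizer for each value of each simple approximant and each precision [1/(k+1)]: a
   countable family. *)
have approx (q : nat * nat * nat) : exists vH : ('rV[R]_d -> R) * ('rV[R]_d -> 'rV[R]_d),
    [/\ in_H1 Omega vH.1 vH.2, H1sqr Omega vH.1 vH.2 <= 1 &
      in_H1dual Omega (e q.1.1 q.1.2) ->
      (H1dual_norm Omega (e q.1.1 q.1.2) <=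
        (`|e q.1.1 q.1.2 vH.1| + q.2.+1%:R^-1)%:E)%E].
  have [ld|nld] := pselect (in_H1dual Omega (e q.1.1 q.1.2)); last first.
    by exists (fun=> 0, fun=> 0); split => //; exact: in_H1_0.
  have fin : H1dual_norm Omega (e q.1.1 q.1.2) \is a fin_num.
    by rewrite ge0_fin_numE; [exact: ld.2|exact: H1dual_norm_ge0].
  have k0 : 0 < q.2.+1%:R^-1 :> R by rewrite invr_gt0.
  have [_ [u [G [uG u1 ->]]] lt] := ub_ereal_sup_adherent k0 fin.
  exists (u, G); split => //=.
    move: u1; rewrite (H1norm_sqr mO uG) lee_fin => u1.
    by rewrite -(sqr_sqrtr (H1sqr_ge0 _ _ _)) expr_le1// sqrtr_ge0.
  by move=> _; move: lt; rewrite lteBlDr// -EFinD => /ltW.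
have [f fP] := choice approx.
pose g k := if unpickle k is Some q then f q else (fun=> 0, fun=> 0).
exists (fun k => (g k).1), (fun k => (g k).2); split.
- move=> k; rewrite /g; case: unpickle => [q|]; first by have [] := fP q.
  exact: in_H1_0.
- by move=> k; rewrite /g; case: unpickle => [q|]//; have [] := fP q.
apply: ae_imp cs _ => t cst tT B FB.
apply/lee_addgt0Pr => eps eps0.
(* Three errors occur: the approximation of [F t] at [u], the same at the selected test function,
   and the gap of the near-maximizer. *)
have e3 : 0 < eps / 3 by rewrite divr_gt0.
have /fine_cvgP[cfin /cvgrPdist_le /(_ _ e3) cn] := cst tT.
have [n _ /(_ n (leqnn n))[fn]] := filterI cfin cn.
rewrite sub0r normrN => le.
have {}le : (H1dual_norm Omega (fun u : 'rV[R]_d -> R => (s n t u - F t u)%R) <= (eps / 3)%:E)%E.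
  by rewrite -(fineK fn) lee_fin; apply: le_trans le; exact: ler_norm.
have diff u K : in_H1 Omega u K -> H1sqr Omega u K <= 1 -> `|s n t u - F t u| <= eps / 3.
  move=> uK u1; rewrite -lee_fin; apply: le_trans le; apply: ereal_sup_ubound.
  exists u, K; split => //; rewrite (H1norm_sqr mO uK) lee_fin.
  by rewrite -[leRHS]sqrtr1 ler_wsqrtr.
have [k _ /(_ k (leqnn k)) ke] := near_infty_natSinv_lt (PosNum e3).
have [i ei] := eP n t.
have [vH1 vs] := fP (n, i, k); move=> /= /(_ _).
rewrite -ei => /(_ (ds n t)) snorm.
have FBv : `|F t (f (n, i, k)).1| <= B.
  by have := FB (pickle (n, i, k)); rewrite /g pickleK.
have dv := diff _ _ vH1 vs.
apply: ge_ereal_sup => _ [u [K [uK u1 ->]]].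
have u1' : H1sqr Omega u K <= 1.
  move: u1; rewrite (H1norm_sqr mO uK) lee_fin => u1.
  by rewrite -(sqr_sqrtr (H1sqr_ge0 _ _ _)) expr_le1// sqrtr_ge0.
have du := diff _ _ uK u1'.
have su : `|s n t u| <= `|s n t (f (n, i, k)).1| + k.+1%:R^-1.
  rewrite -lee_fin; apply: le_trans snorm; apply: ereal_sup_ubound.
  by exists u, K.
rewrite -EFinD lee_fin.
have t1 : `|F t u| <= `|s n t u| + `|s n t u - F t u|.
  rewrite -{1}(subKr (s n t u) (F t u)); exact: ler_normB.
have t2 : `|s n t (f (n, i, k)).1| <= `|F t (f (n, i, k)).1| +
    `|s n t (f (n, i, k)).1 - F t (f (n, i, k)).1|.
  rewrite -{1}(subrK (F t (f (n, i, k)).1) (s n t (f (n, i, k)).1)) addrC.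
  exact: ler_normD.
have ke' : k.+1%:R^-1 <= eps / 3 by rewrite ltW.
set kk := k.+1%:R^-1 in su ke'.
lra.
Qed.

End dual_space.

(** * The formula for the time derivative *)

Section dual_representation.
Context (R : realType) (d : nat) (T : R) (Omega : set 'rV[R]_d).
Hypothesis mO : measurable Omega.
Local Notation m := (lebesgue_rV R d).
Local Notation mu := (@lebesgue_measure R).
Local Notation muX := (mu \x m)%E.
Implicit Types (v : 'rV[R]_d -> R) (H : 'rV[R]_d -> 'rV[R]_d).

Definition slice (U : measurableTypeR R * 'rV[R]_d -> R) (t : R) : 'rV[R]_d -> R :=
  fun x => U (t, x).

Lemma slice_ext (A : R -> 'rV[R]_d -> R) t : 0 < t < T ->
  slice (ext T Omega A) t = A t \_ Omega.
Proof. by move=> tT; rewrite -(ext_slice _ A tT). Qed.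

Lemma slice_ext_out (A : R -> 'rV[R]_d -> R) t : ~~ (0 < t < T) ->
  slice (ext T Omega A) t = fun=> 0.
Proof. by move=> tT; apply/funext => x; exact: ext_out. Qed.

Lemma measurable_ip_slice (U : measurableTypeR R * 'rV[R]_d -> R) (v : 'rV[R]_d -> R) :
  measurable_fun setT U -> measurable_fun setT v ->
  measurable_fun [set: measurableTypeR R] (fun t => ip m (slice U t) v).
Proof.
move=> mU mv.
have mUv : measurable_fun [set: measurableTypeR R * 'rV[R]_d] (fun p => U p * v p.2).
  by apply: measurable_funM => //; exact: measurableT_comp mv measurable_snd.
have h := measurable_Rintegral_snd m mUv.
exact: h.
Qed.

Lemma integrable_ip_slice (A : R -> 'rV[R]_d -> R) (v : 'rV[R]_d -> R) : 0 < T ->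
  L2 muX (ext T Omega A) -> L2 m v ->
  mu.-integrable setT (EFin \o (fun t => ip m (slice (ext T Omega A) t) v)).
Proof.
(* With [h = t = T] the window is the indicator of []0, T[], outside which the slices vanish. *)
move=> T0 LA Lv; have := @integrable_window_ip R _ _ m T (ext T Omega A) v T T0 LA Lv.
rewrite (_ : (fun s => _) = (fun t => ip m (slice (ext T Omega A) t) v))//.
apply/funext => t; have [tT|tT] := boolP (0 < t < T).
  by rewrite /window subrr tT mul1r.
by rewrite /window subrr (negbTE tT) mul0r slice_ext_out// ip0l.
Qed.

Lemma in_L2H1_indicator v H (B : set R) : measurable (B : set (measurableTypeR R)) ->
  in_H1 Omega v H ->
  in_L2H1 T Omega (fun t => if t \in B then v else (fun=> 0))
    (fun t => if t \in B then H else (fun=> 0)).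
Proof.
move=> mB vH; have [Lv LH] := in_H1_L2 mO vH.
have meas (u : 'rV[R]_d -> R) (a : R -> 'rV[R]_d -> R) : measurable_fun setT (u \_ Omega) ->
    (forall t x, Omega x -> a t x = if t \in B then u x else 0) ->
    measurable_Q T Omega a.
  move=> mu_ aE; rewrite /measurable_Q.
  apply: (@eq_measurable_fun _ _ _ _ _
    (fun p : measurableTypeR R * 'rV[R]_d => \1_B p.1 * (u \_ Omega) p.2)).
    move=> -[t x]; rewrite inE => -[_ /= xO].
    rewrite aE// indicE patchE (mem_set xO).
    by case: ifP => _; rewrite ?mul1r ?mul0r.
  apply: measurable_funTS.
  apply: measurable_funM; last exact: measurableT_comp mu_ measurable_snd.
  exact: (measurableT_comp (measurable_indic mB) measurable_fst).
split; first split.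
- by apply: (meas v) => [|t x _]; [exact: Lv.1|case: ifP].
- move=> i; apply: (meas (comp_ H i)) => [|t x _]; first exact: (LH i).1.
  by rewrite /comp_; case: ifP => _ //; rewrite mxE.
- apply: aeW => t _; case: ifP => _ //; exact: in_H1_0.
apply: (@le_lt_trans _ _ (Num.sqrt (\int[mu]_(t in `]0, T[) H1sqr Omega v H))%:E);
  last by rewrite ltry.
apply: (@time_norm2_le _ _ _ (fun=> H1sqr Omega v H)).
- by move=> t _; exact: H1sqr_ge0.
- apply: continuous_itv_oo_integrable => t; exact: cvg_cst.
- apply: aeW => t _; rewrite (fun_if (fun a => H1norm Omega a _)).
  case: (t \in B); first by rewrite (H1norm_sqr mO vH) gee0_abs ?lee_fin ?sqrtr_ge0.
  rewrite (H1norm_sqr mO (in_H1_0 mO)) gee0_abs ?lee_fin ?sqrtr_ge0// ler_wsqrtr//.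
  rewrite {1}/H1sqr restrict0 ip0l add0r big1 ?H1sqr_ge0// => i _.
  rewrite (_ : comp_ _ i = fun=> 0); last by apply/funext => x; rewrite /comp_ mxE.
  by rewrite restrict0 ip0l.
Qed.

Variables (D : R) (G : R -> 'rV[R]_d -> 'rV[R]_d) (q : R -> 'rV[R]_d -> R)
  (F : R -> ('rV[R]_d -> R) -> R).
Hypotheses (T0 : 0 < T)
  (LG : forall i, L2 muX (gcomp T Omega G i))
  (Lq : L2 muX (ext T Omega q))
  (dF : in_L2H1dual T Omega F).
Hypothesis weak : forall phi K, in_L2H1 T Omega phi K ->
  \int[mu]_(t in `]0, T[) (F t (phi t) +
    D * \int[m]_(x in Omega) dotv (G t x) (K t x) - L2inner Omega (q t) (phi t)) = 0.

Definition dual_rep v H (t : R) : R :=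
  ip m (slice (ext T Omega q) t) (v \_ Omega) -
  D * \sum_i ip m (slice (gcomp T Omega G i) t) (comp_ H i \_ Omega).

Lemma integrable_dual_rep v H : in_H1 Omega v H ->
  mu.-integrable setT (EFin \o dual_rep v H).
Proof.
move=> vH; have [Lv LH] := in_H1_L2 mO vH.
apply: integrable_subR => //; first exact: integrable_ip_slice.
apply: integrable_scaleR => //; apply: integrable_sumR => i.
exact: integrable_ip_slice T0 (LG i) (LH i).
Qed.

Lemma slices_L2 : {ae mu, forall t : R, 0 < t < T ->
  forall i, L2 m (comp_ (G t) i \_ Omega)}.
Proof.
have : {ae mu, forall t : R, forall i, L2 m (slice (gcomp T Omega G i) t)}.
  by apply: ae_forall_ord => i; exact: L2_slice_snd.
move=> h; apply: ae_imp h _ => t ht tT i.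
by have := ht i; rewrite slice_ext.
Qed.

(** As [B] is arbitrary, the weak formulation tested with [1_B(t) v(x)] localizes in time. The
    exceptional set depends on [v]. *)
Lemma dual_representation v H : in_H1 Omega v H ->
  {ae mu, forall t : R, `]0, T[%classic t -> F t v = dual_rep v H t}.
Proof.
move=> vH; have [Lv LH] := in_H1_L2 mO vH.
have [sF Fd _] := dF.
have [w [mw Fw]] := H1dual_measurable mO sF Fd vH.
have mA : measurable_fun setT (dual_rep v H).
  have /integrableP[+ _] := integrable_dual_rep vH.
  by move/measurable_EFinP.
(* The measurable function [w] stands in for [F t v], since localization applies to measurable
   functions. *)
have : {ae mu, forall t : R, `]0, T[%classic t -> w t - dual_rep v H t = 0}.
  apply: null_integral_ae0 => //.
  - by apply: measurable_funTS; exact: measurable_funB.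
  - by rewrite [ltLHS](lebesgue_measure_itv `]0, T[)/=; case: ifP => _; rewrite ?ltry.
  move=> B mB BT; have := weak (in_L2H1_indicator mB vH).
  rewrite (@Rintegral_ae_eq_any _ _ _ mu _ _
    (fun t => \1_B t * (w t - dual_rep v H t))).
    move=> <-; rewrite -[in LHS](setIidr BT) Rintegral_mkcondr.
    apply: eq_Rintegral => t _; rewrite patchE indicE.
    by case: ifP => _; rewrite ?mul1r ?mul0r.
  have h1 := ae_imp2 Fw slices_L2 (fun t a b => conj a b).
  apply: ae_imp2 h1 Fd _ => t [Fwt sGt] Fdt tT.
  have tT' : 0 < t < T by move: tT; rewrite /= in_itv.
  rewrite indicE; case: ifP => tB.
    rewrite mul1r -Fwt// L2inner_ip integral_dotv//; last exact: sGt.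
    rewrite /dual_rep slice_ext// opprB addrA; congr (_ + _ * _ - _).
    by apply: eq_bigr => i _; rewrite slice_ext.
  rewrite mul0r (in_H1dual_0 mO (Fdt tT)).
  rewrite L2inner_ip restrict0 ipC ip0l subr0 add0r (_ : Rintegral _ _ _ = 0) ?mulr0//.
  rewrite (@eq_Rintegral _ _ _ _ _ (cst 0)); first by rewrite Rintegral_cst// mul0r.
  by move=> x _; rewrite /dotv big1// => i _; rewrite mxE mulr0.
move=> h; apply: ae_imp2 h Fw _ => t wt Fwt tT.
by rewrite Fwt//; apply/eqP; rewrite -subr_eq0 wt.
Qed.

End dual_representation.

(** * Increments of the continuous representative *)

Section weak_increments.
Context (R : realType) (d : nat) (T : R) (Omega : set 'rV[R]_d).
Hypothesis mO : measurable Omega.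
Local Notation m := (lebesgue_rV R d).
Local Notation mu := (@lebesgue_measure R).
Local Notation muX := (mu \x m)%E.
Implicit Types (u v : 'rV[R]_d -> R) (H : 'rV[R]_d -> 'rV[R]_d).

Lemma restrict_sub u v :
  (fun x => u x - v x) \_ Omega = (fun x => (u \_ Omega) x - (v \_ Omega) x).
Proof.
apply/funext => x; rewrite !patchE; case: ifP => // _.
by rewrite [point](_ : _ = 0)// subr0.
Qed.

Lemma L2norm_sub0 u v : L2 m (u \_ Omega) -> L2 m (v \_ Omega) ->
  L2norm Omega (fun x => u x - v x) = 0%E ->
  {ae m, forall x, (u \_ Omega) x = (v \_ Omega) x}.
Proof.
move=> Lu Lv; have Luv := L2_sub Lu Lv.
rewrite L2norm_ip restrict_sub// => -[] /eqP; rewrite sqrtr_eq0 => h.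
by apply: ip_sub_eq0 => //; apply/eqP; rewrite eq_le h ip_ge0.
Qed.

(** Gronwall's inequality asks for the energy estimate at every intermediate time [b], hence for the
    data truncated at [b]. *)
Lemma ext_restrict b (A : R -> 'rV[R]_d -> R) p : b <= T ->
  ext b Omega A p = if p.1 < b then ext T Omega A p else 0.
Proof.
move=> bT; case: p => t x /=; have [tb|tb] := ltP t b; last first.
  by rewrite ext_out// negb_and -!leNgt tb orbT.
have [t0|t0] := ltP 0 t; last by rewrite !ext_out// negb_and -leNgt t0.
have bt : 0 < t < b by rewrite t0.
have tT : 0 < t < T by rewrite t0 (lt_le_trans tb).
by have := congr1 (@^~ x) (ext_slice Omega A bt); have := congr1 (@^~ x) (ext_slice Omega A tT) => /= -> ->.
Qed.

Lemma L2_ext_restrict b (A : R -> 'rV[R]_d -> R) : b <= T -> measurable_Q T Omega A ->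
  L2 muX (ext T Omega A) -> L2 muX (ext b Omega A).
Proof.
move=> bT mA [_ iA]; apply: (L2_dominated _ iA) => [|p].
  apply: measurable_ext => //; apply: measurable_funS mA; first exact: measurable_Q_T.
  move=> [t x] [/= + xO]; rewrite !in_itv/= => /andP[t0 tb]; split => //=.
  by rewrite in_itv/= t0 (lt_le_trans tb).
by rewrite ext_restrict//; case: ifP => _ //; rewrite expr0n sqr_ge0.
Qed.

Lemma ip_ext_Rintegral b (A : R -> 'rV[R]_d -> R) : L2 muX (ext b Omega A) ->
  ip muX (ext b Omega A) (ext b Omega A) =
  \int[mu]_(t in `]0, b[) ip m (A t \_ Omega) (A t \_ Omega).
Proof.
move=> LA; rewrite -(Rintegral_ip_snd LA) [RHS]Rintegral_mkcond.
apply: eq_Rintegral => t _; rewrite patchE.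
case: ifPn => [|]; rewrite ?notin_setE ?inE /= in_itv/= => tb.
  by rewrite -(slice_ext _ _ tb).
have -> : (fun x => ext b Omega A (t, x)) = fun=> 0.
  by apply: slice_ext_out; apply/negP.
exact: ip0l.
Qed.

Lemma integrable_ip_ext b (A : R -> 'rV[R]_d -> R) : L2 muX (ext b Omega A) ->
  mu.-integrable `]0, b[ (EFin \o (fun t => ip m (A t \_ Omega) (A t \_ Omega))).
Proof.
move=> LA; have h : mu.-integrable `]0, b[ (EFin \o (fun t => ip m
    (slice (ext b Omega A) t) (slice (ext b Omega A) t))).
  exact: integrableS (integrable_ip_snd LA).
apply: eq_integrable h => // t; rewrite inE /= in_itv/= => tb.
by rewrite slice_ext.
Qed.

Variables (D : R) (y q : R -> 'rV[R]_d -> R) (G : R -> 'rV[R]_d -> 'rV[R]_d)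
  (F : R -> ('rV[R]_d -> R) -> R) (z : R -> 'rV[R]_d -> R).
Hypotheses (T0 : 0 < T) (D0 : 0 <= D)
  (my : measurable_Q T Omega y) (Ly : L2 muX (ext T Omega y))
  (mG : forall i, measurable_Q T Omega (fun t => comp_ (G t) i))
  (LG : forall i, L2 muX (gcomp T Omega G i))
  (yH : ae_time T (fun t => in_H1 Omega (y t) (G t)))
  (mq : measurable_Q T Omega q) (Lq : L2 muX (ext T Omega q))
  (dF : in_L2H1dual T Omega F) (yF : time_deriv T Omega y F).
Hypothesis weak : forall phi K, in_L2H1 T Omega phi K ->
  \int[mu]_(t in `]0, T[) (F t (phi t) +
    D * \int[m]_(x in Omega) dotv (G t x) (K t x) - L2inner Omega (q t) (phi t)) = 0.
Hypotheses (zL : forall t, `[0, T]%classic t -> in_L2 Omega (z t))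
  (zC : forall t, `[0, T]%classic t ->
     L2norm Omega (fun x => z s x - z t x) @[s --> within `[0, T] (nbhs t)] --> 0%E)
  (zy : ae_time T (fun t => L2norm Omega (fun x => z t x - y t x) = 0%E)).

Local Notation zO t := (z t \_ Omega).

Let LzO t : 0 <= t <= T -> L2 m (zO t).
Proof. by move=> tT; apply: in_L2_restrict => //; apply: zL; rewrite /= in_itv. Qed.

Let incr_norm_cvg t : 0 <= t <= T ->
  Num.sqrt (ip m (fun x => zO s x - zO t x) (fun x => zO s x - zO t x))
    @[s --> within `[0, T] (nbhs t)] --> (0 : R).
Proof.
move=> tT; have tT' : `[0, T]%classic t by rewrite /= in_itv.
have /fine_cvgP[_] := zC tT'; apply: cvg_trans; apply: near_eq_cvg.
near=> s; have sT : 0 <= s <= T.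
  suff : `[0, T]%classic s by rewrite /= in_itv.
  by near: s; exact: withinT.
rewrite /= L2norm_ip ?restrict_sub//.
by apply: L2_sub; exact: LzO.
Unshelve. all: by end_near. Qed.

Lemma continuous_pairing v : L2 m v ->
  {within `[0, T], continuous (fun t => ip m (zO t) v)}.
Proof.
move=> Lv; apply/subspace_continuousP => t; rewrite /= in_itv/= => tT.
suff h : ip m (zO s) v @[s --> within `[0, T] (nbhs t)] --> (ip m (zO t) v : R) by exact: h.
apply/cvgrPdist_le => e e0; set r := 1 + Num.sqrt (ip m v v).
have r0 : 0 < r by rewrite ltr_pwDl// sqrtr_ge0.
have er : 0 < e / r by rewrite divr_gt0.
have /cvgrPdist_le /(_ _ er) h := incr_norm_cvg tT.
near=> s; have sT : 0 <= s <= T.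
  suff : `[0, T]%classic s by rewrite /= in_itv.
  by near: s; exact: withinT.
rewrite distrC -ipBl//; [|exact: LzO|exact: LzO].
apply: le_trans (cauchy_schwarz _ Lv) _; first by apply: L2_sub; exact: LzO.
apply: (@le_trans _ _ (e / r * r)); last by rewrite divfK// gt_eqF.
apply: ler_pM; rewrite ?sqrtr_ge0//; last by rewrite lerDr.
have : `|0 - Num.sqrt (ip m (fun x => zO s x - zO t x) (fun x => zO s x - zO t x))| <= e / r.
  by near: s.
by rewrite sub0r normrN ger0_norm// sqrtr_ge0.
Unshelve. all: by end_near. Qed.

(** From [|z s|^2 = |z s - z t|^2 + 2 (z s, z t) - |z t|^2] and continuity of the pairing with the
    fixed function [z t]. *)
Lemma continuous_energy : {within `[0, T], continuous (fun t => ip m (zO t) (zO t))}.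
Proof.
apply/subspace_continuousP => t; rewrite /= in_itv/= => tT.
have /subspace_continuousP /(_ t) cp := continuous_pairing (LzO tT).
have {}cp : ip m (zO s) (zO t) @[s --> within `[0, T] (nbhs t)] --> ip m (zO t) (zO t).
  by apply: cp; rewrite /= in_itv.
pose N s : R := Num.sqrt (ip m (fun x => zO s x - zO t x) (fun x => zO s x - zO t x)).
have h3 : N s * N s + (2 * ip m (zO s) (zO t) - ip m (zO t) (zO t))
    @[s --> within `[0, T] (nbhs t)] -->
    0 * 0 + (2 * ip m (zO t) (zO t) - ip m (zO t) (zO t)).
  apply: cvgD; first by apply: cvgM; exact: incr_norm_cvg.
  by apply: cvgB; [apply: cvgM => //; exact: cvg_cst|exact: cvg_cst].
suff h : ip m (zO s) (zO s) @[s --> within `[0, T] (nbhs t)] --> (ip m (zO t) (zO t) : R).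
  exact: h.
have -> : ip m (zO t) (zO t) = 0 * 0 + (2 * ip m (zO t) (zO t) - ip m (zO t) (zO t)) by ring.
apply: cvg_trans h3; apply: near_eq_cvg; near=> s.
have sT : 0 <= s <= T.
  suff : `[0, T]%classic s by rewrite /= in_itv.
  by near: s; exact: withinT.
rewrite /N -[X in X + _]expr2 sqr_sqrtr ?ip_ge0// ip_subsq; [|exact: LzO|exact: LzO].
ring.
Unshelve. all: by end_near. Qed.

Lemma representative_ae : {ae mu, forall t : R, 0 < t < T ->
  L2 m (y t \_ Omega) /\ {ae m, forall x, zO t x = (y t \_ Omega) x}}.
Proof.
apply: ae_imp2 zy yH _ => t zyt yHt tT.
have tT' : `]0, T[%classic t by rewrite /= in_itv.
have [Lyt _] := in_H1_L2 mO (yHt tT'); split => //.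
apply: L2norm_sub0 => //; last exact: zyt.
by apply: LzO; case/andP: tT => /ltW -> /ltW ->.
Qed.

(** The real function [t |-> (z t, v)] is continuous with weak derivative [dual_rep v H]. No time is
    excepted any more, so [v] may afterwards depend on the time. *)
Lemma weak_increment v H t : in_H1 Omega v H -> 0 <= t <= T ->
  ip m (zO t) (v \_ Omega) = ip m (zO 0) (v \_ Omega) +
    \int[mu]_(s in `]0, t[) dual_rep T Omega D G q v H s.
Proof.
move=> vH tT; have [Lv LH] := in_H1_L2 mO vH.
apply: (weak_derivative_increment (g := fun t => ip m (zO t) (v \_ Omega)) T0) => //.
- exact: continuous_pairing.
- by apply: integrableS (integrable_dual_rep mO _ _ _ _ vH).
move=> eta eta_test; have := yF eta_test vH.
have -> : \int[mu]_(t in `]0, T[) (F t v * eta t) =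
    \int[mu]_(t in `]0, T[) (dual_rep T Omega D G q v H t * eta t).
  apply: Rintegral_ae_eq_any.
  have h := dual_representation mO T0 LG Lq dF weak vH.
  by apply: ae_imp h _ => s hs sT; rewrite hs.
move=> <-; apply: Rintegral_ae_eq_any.
apply: ae_imp representative_ae _ => s hs; rewrite /= in_itv/= => sT.
have [Lys zys] := hs sT; congr (_ * _); rewrite L2inner_ip.
have sT' : 0 <= s <= T by case/andP: sT => /ltW -> /ltW ->.
apply: ip_ae_eq => //; [exact: (LzO sT').1|exact: Lys.1|exact: Lv.1|exact: Lv.1|exact: aeW].
Qed.

Lemma weak_increment_between v H s t : in_H1 Omega v H -> 0 <= s <= t -> t <= T ->
  ip m (zO t) (v \_ Omega) - ip m (zO s) (v \_ Omega) =
    \int[mu]_(tau in `]s, t[) dual_rep T Omega D G q v H tau.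
Proof.
move=> vH /andP[s0 st] tT.
rewrite (weak_increment vH (t := t)); last by rewrite (le_trans s0 st).
rewrite (weak_increment vH (t := s)); last by rewrite s0 (le_trans st tT).
have ii a b : mu.-integrable [set` Interval a b] (EFin \o dual_rep T Omega D G q v H).
  by apply: integrableS (integrable_dual_rep mO _ _ _ _ vH).
rewrite opprD addrACA subrr add0r; move: st; rewrite le_eqVlt => /predU1P[->|st].
  by rewrite subrr set_itvoo0 ?lexx// Rintegral_set0.
rewrite (Rintegral_itv_bndo_bndc (ii (BRight 0) (BLeft s))).
by apply: (Rintegral_itvB (ii (BRight 0) (BLeft t))); rewrite bnd_simp.
Qed.

(** The abstract inequality on []0, b[] with [v = y(t)], which lies in H^1 for almost every [t]. *)
Lemma energy_estimate b : 0 < b <= T ->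
  ip m (zO b) (zO b) + 2 * D * \sum_i ip muX (gcomp b Omega G i) (gcomp b Omega G i) <=
  ip m (zO 0) (zO 0) + \int[mu]_(t in `]0, b[) ip m (q t \_ Omega) (q t \_ Omega) +
  \int[mu]_(t in `]0, b[) ip m (zO t) (zO t).
Proof.
move=> /andP[b0 bT].
have Lyb := L2_ext_restrict bT my Ly; have Lqb := L2_ext_restrict bT mq Lq.
have LGb i : L2 muX (gcomp b Omega G i) := L2_ext_restrict bT (mG i) (LG i).
have zyb : \int[mu]_(t in `]0, b[) ip m (zO t) (zO t) = ip muX (ext b Omega y) (ext b Omega y).
  rewrite ip_ext_Rintegral//; apply: Rintegral_ae_eq_any.
  apply: ae_imp representative_ae _ => t ht; rewrite /= in_itv/= => /andP[t0 tb].
  have tT : 0 < t < T by rewrite t0 (lt_le_trans tb).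
  have tT' : 0 <= t <= T by case/andP: tT => /ltW -> /ltW ->.
  have [Lyt zyt] := ht tT; have [mzt _] := LzO tT'; have [myt _] := Lyt.
  exact: ip_ae_eq.
rewrite zyb -(ip_ext_Rintegral Lqb).
apply: (@energy_inequality R _ _ m b D (fun t => zO t) d (ext b Omega y) (ext b Omega q)
  (gcomp b Omega G)) => //.
- by move=> t /andP[t0 tb]; apply: LzO; rewrite t0 (le_trans tb).
- by apply: continuous_subspaceW continuous_energy; apply: subset_itvl; rewrite bnd_simp.
- by move=> t x tb; rewrite ext_out.
- by move=> i t x tb; rewrite /gcomp ext_out.
- apply: ae_imp representative_ae _ => t ht tb.
  have [t0 tb'] := andP tb.
  have tT : 0 < t < T by rewrite t0 (lt_le_trans tb').
  have [_ h] := ht tT; apply: ae_imp h _ => x ->.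
  by rewrite -(ext_slice _ _ tb).
apply: ae_imp yH _ => t ht tb s st; have [t0 tb'] := andP tb.
have tT : 0 < t < T by rewrite t0 (lt_le_trans tb').
have yHt : in_H1 Omega (y t) (G t) by apply: ht; rewrite /= in_itv.
have -> : (fun x => ext b Omega y (t, x)) = y t \_ Omega by exact: ext_slice.
rewrite (weak_increment_between yHt st); last by case/andP: tT => _ /ltW.
apply: eq_Rintegral => tau; rewrite inE /= in_itv/= => /andP[stau taut].
have tau0 : 0 < tau by apply: le_lt_trans stau; case/andP: st.
have taub : 0 < tau < b by rewrite tau0 (lt_trans taut).
have tauT : 0 < tau < T by rewrite tau0 (lt_trans taut)//; case/andP: tT.
rewrite /dual_rep (slice_ext _ _ tauT).
have -> : (fun x => ext b Omega q (tau, x)) = q tau \_ Omega by exact: ext_slice.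
congr (_ - _ * _); apply: eq_bigr => i _.
rewrite (slice_ext _ _ tauT).
have -> : (fun x => gcomp b Omega G i (tau, x)) = comp_ (G tau) i \_ Omega by exact: ext_slice.
by have -> : (fun x => gcomp b Omega G i (t, x)) = comp_ (G t) i \_ Omega by exact: ext_slice.
Qed.

End weak_increments.

(** Sum of [(a_i b_j - a_j b_i)^2 >= 0] over all pairs of indices. *)
Lemma big_sum_sqr_prod_le (R : realType) (n : nat) (a b : 'I_n -> R) :
  (\sum_i a i * b i) ^+ 2 <= (\sum_i a i ^+ 2) * (\sum_i b i ^+ 2).
Proof.
rewrite expr2 !big_distrlr/=.
have h : \sum_i \sum_j 2 * (a i * b i * (a j * b j)) <=
    \sum_i \sum_j (a i ^+ 2 * b j ^+ 2) + \sum_i \sum_j (a j ^+ 2 * b i ^+ 2).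
  rewrite -big_split/=; apply: ler_sum => i _; rewrite -big_split/=; apply: ler_sum => j _.
  by have := sqr_ge0 (a i * b j - a j * b i); nra.
have e : \sum_i \sum_j (a j ^+ 2 * b i ^+ 2) = \sum_i \sum_j (a i ^+ 2 * b j ^+ 2).
  by rewrite exchange_big.
rewrite e in h; suff : 2 * (\sum_i \sum_j a i * b i * (a j * b j)) <=
    \sum_i \sum_j (a i ^+ 2 * b j ^+ 2) + \sum_i \sum_j (a i ^+ 2 * b j ^+ 2) by lra.
by apply: le_trans h; rewrite mulr_sumr; apply: ler_sum => i _; rewrite mulr_sumr.
Qed.

(** * Gronwall's inequality and the estimate for real functions of time *)

Section a_priori.
Context (R : realType).
Local Notation mu := (@lebesgue_measure R).

Lemma lebesgue_oo (b : R) : 0 <= b -> fine (mu `]0, b[%classic) = b.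
Proof.
move=> b0; rewrite [X in fine X](lebesgue_measure_itv `]0, b[)/=.
by case: ifPn => [_|]; rewrite ?lte_fin ?oppr0 ?addr0//= -leNgt => bl; apply/eqP; rewrite eq_le b0.
Qed.

Lemma Rintegral_affine_le (b u0 u1 : R) (f g : R -> R) : 0 <= b ->
  mu.-integrable `]0, b[ (EFin \o f) -> mu.-integrable `]0, b[ (EFin \o g) ->
  {ae mu, forall t : R, `]0, b[%classic t -> f t <= u0 + u1 * g t} ->
  \int[mu]_(t in `]0, b[) f t <= u0 * b + u1 * \int[mu]_(t in `]0, b[) g t.
Proof.
move=> b0 fi gi fg.
have ci : mu.-integrable `]0, b[ (EFin \o (fun=> u0)).
  by apply: continuous_itv_oo_integrable => t; exact: cvg_cst.
have si : mu.-integrable `]0, b[ (EFin \o (fun t => u1 * g t)) by exact: integrable_scaleR.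
rewrite -RintegralZl// -{2}(lebesgue_oo b0) -Rintegral_cst// -RintegralD//.
by apply: ae_le_Rintegral => //; exact: integrable_addR.
Qed.

(* The weight exp(- 2 B t) makes half of the supremum absorb the integral term. *)
Lemma gronwall (T a B : R) (V : R -> R) : 0 < T -> 0 < B ->
  {within `[0, T], continuous V} ->
  (forall b, 0 <= b <= T -> 0 <= V b) ->
  (forall b, 0 <= b <= T -> V b <= a + B * \int[mu]_(t in `]0, b[) V t) ->
  forall t, 0 <= t <= T -> V t <= 2 * a * expR (2 * B * T).
Proof.
move=> T0 B0 cV V0 VI.
have dE (x : R) : is_derive x (1 : R) (fun t : R => expR (2 * B * t)) (2 * B * expR (2 * B * x)).
  have h : has_deriv (fun t : R => expR (2 * B * t)) x (expR (2 * B * x) * (0 * x + 2 * B * 1)).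
    apply: (has_deriv_comp (f := expR) (g := fun t => 2 * B * t)); first exact: is_derive_expR.
    by apply: (has_deriv_mul (f := fun=> 2 * B) (g := id)); [exact: has_deriv_cst|exact: has_deriv_id].
  by apply: has_deriv_eq h _; ring.
have cE : continuous (fun t : R => expR (2 * B * t)).
  by move=> t; exact: has_deriv_continuous (dE t).
have cW : {within `[0, T], continuous (fun t => V t * expR (- (2 * B * t)))}.
  apply/subspace_continuousP => t tT; apply: cvgM.
    by move/subspace_continuousP : cV => /(_ t tT).
  apply: cvg_within_filter.
  have -> : (fun x : R => expR (- (2 * B * x))) = (fun x => (expR (2 * B * x))^-1).
    by apply/funext => x; rewrite expRN.
  by rewrite expRN; apply: cvgV; [rewrite gt_eqF ?expR_gt0|exact: cE].
(* [s] maximizes the weighted function and [M] is its maximum, so [V t <= M * expR (2 * B * t)] on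
   the whole interval. *)
have [s + sM] := EVT_max (ltW T0) cW; rewrite in_itv/= => sT.
set M := V s * expR (- (2 * B * s)).
have VM t : 0 <= t <= T -> V t <= M * expR (2 * B * t).
  move=> tT; have := sM t; rewrite in_itv/= => /(_ tT).
  by rewrite -/M -(ler_pM2r (expR_gt0 (2 * B * t))) expRN mulfVK// gt_eqF ?expR_gt0.
have M0 : 0 <= M by rewrite mulr_ge0 ?V0// ltW ?expR_gt0.
have [s0 sT'] := andP sT.
have Vs : V s = M * expR (2 * B * s) by rewrite /M expRN mulfVK// gt_eqF ?expR_gt0.
have IE : \int[mu]_(t in `]0, s[) V t <= M * ((expR (2 * B * s) - 1) / (2 * B)).
  have [->|s0'] := eqVneq s 0.
    by rewrite set_itvoo0 ?lexx// Rintegral_set0 mulr0 expR0 subrr mul0r mulr0.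
  have {}s0 : 0 < s by rewrite lt_neqAle eq_sym s0'.
  have cEs : {within `[0, s], continuous (fun t : R => expR (2 * B * t))}.
    exact: continuous_subspaceT.
  have iE := continuous_itv_oo_integrable cEs.
  have EI : \int[mu]_(t in `]0, s[) expR (2 * B * t) = (expR (2 * B * s) - 1) / (2 * B).
    rewrite Rintegral_oo_cc// /Rintegral.
    rewrite (@continuous_FTC2 _ _ (fun t => (2 * B)^-1 * expR (2 * B * t)))//=.
    - by rewrite mulr0 expR0; ring.
    - have dF x : has_deriv (fun t => (2 * B)^-1 * expR (2 * B * t)) x (expR (2 * B * x)).
        apply: has_deriv_eq (has_deriv_mul (has_deriv_cst _ _) (dE x)) _.
        by rewrite mul0r add0r mulrA mulVf ?mul1r// mulf_neq0 ?gt_eqF.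
      split.
      + by move=> x _; exact: has_deriv_derivable (dF x).
      + exact/cvg_at_right_filter/(has_deriv_continuous (dF _)).
      + exact/cvg_at_left_filter/(has_deriv_continuous (dF _)).
    - move=> x _; apply: has_deriv_derive1.
      apply: has_deriv_eq (has_deriv_mul (has_deriv_cst _ _) (dE x)) _.
      by rewrite mul0r add0r mulrA mulVf ?mul1r// mulf_neq0 ?gt_eqF.
  rewrite -EI -RintegralZl//; apply: le_Rintegral => //.
  - by apply: continuous_itv_oo_integrable; apply: continuous_subspaceW cV; apply: subset_itvl; rewrite bnd_simp.
  - exact: integrable_scaleR.
  by move=> t; rewrite /= in_itv/= => /andP[t0 ts]; apply: VM; rewrite ltW//= ltW// (lt_le_trans ts).
have := VI s sT; rewrite Vs => h.
(* The primitive of the exponential brings the factor [1 / (2 * B)], so that only half of the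
   maximum reappears on the right. *)
have h2 : M * expR (2 * B * s) <= a + M * (expR (2 * B * s) - 1) / 2.
  apply: le_trans h _; rewrite lerD2l.
  apply: le_trans (ler_wpM2l (ltW B0) IE) _; rewrite le_eqVlt; apply/orP; left; apply/eqP.
  by field; rewrite gt_eqF.
have es1 : 1 <= expR (2 * B * s) by rewrite -expR0 ler_expR !mulr_ge0// ltW.
have Ma : M <= 2 * a by nra.
move=> t /[dup] tT /andP[t0 tT']; apply: le_trans (VM t tT) _.
apply: ler_pM => //.
by rewrite ler_expR ler_wpM2l// mulr_ge0// ltW.
Qed.

Lemma restrict_L2_sub (T b : R) (a : R -> R) : 0 <= b <= T ->
  L2 mu (a \_ `]0, T[) -> L2 mu (a \_ `]0, b[).
Proof.
move=> /andP[b0 bT] [ma ia].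
have sub : `]0, b[%classic `<=` `]0, T[%classic.
  by apply: subset_itvl; rewrite bnd_simp.
apply: (L2_dominated _ ia) => [|x].
  apply/(measurable_restrictT _ _).1 => //; apply: measurable_funS sub _ => //.
  exact/(measurable_restrictT _ _).2.
rewrite !patchE; case: ifPn => xb.
  by rewrite ifT//; move: xb; rewrite !inE; exact: sub.
by rewrite [point](_ : _ = 0)// expr0n sqr_ge0.
Qed.

Lemma L2_integrable_oo (b : R) (a : R -> R) : 0 < b -> L2 mu (a \_ `]0, b[) ->
  mu.-integrable `]0, b[ (EFin \o a) /\
  mu.-integrable `]0, b[ (EFin \o (fun t => a t ^+ 2)).
Proof.
move=> b0 La; split.
  apply/integrable_mkcond => //.
  have := L2_prod (L2_window b b0) La; apply: eq_integrable => // x _.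
  have xE : (x \in `]0, b[%classic) = (0 < x < b).
    by apply/idP/idP; rewrite inE /= in_itv/=.
  rewrite /window subrr /= !patchE xE; case: ifP => _; first by rewrite mul1r.
  by rewrite mul0r.
apply/integrable_mkcond => //.
have [_] := La; apply: eq_integrable => // x _; rewrite !patchE.
by case: ifPn => // _; rewrite [X in (X ^+ 2)%:E](_ : _ = 0)// expr0n.
Qed.

(** Cauchy-Schwarz against the window with [h = t = b], whose squared norm is [b]. *)
Lemma sqr_Rintegral_le (b : R) (a : R -> R) : 0 < b -> L2 mu (a \_ `]0, b[) ->
  (\int[mu]_(t in `]0, b[) a t) ^+ 2 <= b * \int[mu]_(t in `]0, b[) (a t ^+ 2).
Proof.
move=> b0 La; have := cauchy_schwarz_sqr (L2_window b b0) La.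
rewrite ip_window// => h; rewrite Rintegral_mkcond [in leRHS]Rintegral_mkcond.
have -> : \int[mu]_x (a \_ `]0, b[) x = ip mu (window b b) (a \_ `]0, b[).
  apply: eq_Rintegral => x _; rewrite /window subrr patchE; case: ifPn => xb.
    by move: xb; rewrite inE /= in_itv/= => ->; rewrite mul1r.
  by rewrite [point](_ : _ = 0)// mulr0.
apply: le_trans h _; rewrite le_eqVlt; apply/orP; left; apply/eqP; congr (_ * _).
apply: eq_Rintegral => x _; rewrite !patchE.
by case: ifPn => _; rewrite ?expr2// [point](_ : _ = 0)// mulr0.
Qed.

Lemma in_Lp2_L2 (T : R) (k : R -> R) : in_Lp T 2%:E k -> L2 mu (k \_ `]0, T[).
Proof.
move=> [mk koo]; apply: Lnorm2_lty; first exact/(measurable_restrictT _ _).1.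
move: koo; rewrite /time_norm.
rewrite (_ : (EFin \o k) \_ _ = EFin \o (k \_ `]0, T[))//.
by apply/funext => t; rewrite /= !patchE; case: ifP.
Qed.

Lemma scalar_increment (T : R) (k dk : R -> R) (k0 : R) : 0 < T ->
  in_Lp T 2%:E dk -> scalar_deriv T k dk -> scalar_initial_value T k k0 ->
  exists c : R -> R, [/\ {within `[0, T], continuous c}, ae_time T (fun t => c t = k t), c 0 = k0 &
    forall t, 0 <= t <= T -> c t = c 0 + \int[mu]_(s in `]0, t[) dk s].
Proof.
move=> T0 Ldk kdk [c [cc ck c0]]; exists c; split => //.
have [idk _] := L2_integrable_oo T0 (in_Lp2_L2 Ldk).
apply: weak_derivative_increment => // eta eta_test; rewrite -kdk//.
apply: Rintegral_ae_eq_any; apply: ae_imp ck _ => t ckt tT; by rewrite ckt.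
Qed.

Lemma scalar_sqr_le (T r : R) (c dk : R -> R) :
  L2 mu (dk \_ `]0, T[) -> c 0 ^+ 2 <= r ->
  (forall t, 0 <= t <= T -> c t = c 0 + \int[mu]_(s in `]0, t[) dk s) ->
  forall t, 0 <= t <= T -> c t ^+ 2 <= 2 * r + 2 * T * \int[mu]_(s in `]0, t[) (dk s ^+ 2).
Proof.
move=> Ldk cr ci t /[dup] tT /andP[t0 tT']; rewrite ci//.
have I0 : 0 <= \int[mu]_(s in `]0, t[) (dk s ^+ 2) by apply: Rintegral_ge0 => s _; exact: sqr_ge0.
have [t00|t00] := eqVneq t 0.
  rewrite t00 set_itvoo0 ?lexx// !Rintegral_set0; nra.
have {}t0 : 0 < t by rewrite lt_neqAle eq_sym t00.
have := sqr_Rintegral_le t0 (restrict_L2_sub tT Ldk).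
set I := Rintegral _ _ _ in I0 *; set Q := Rintegral _ _ _ => h.
by have := sqr_ge0 (c 0 - Q); nra.
Qed.

(** [M] precedes the functions, hence cannot depend on domain or solution. In the application [E] is
    [|z|^2], [Gb b] the squared gradient norm up to time [b], [Pp] the squared norm of the forcing,
    [es] that of [y*], and [c j], [dk j] are the continuous representative of [kappa_j] and its
    derivative. *)
Lemma a_priori_bound (T D p0 p1 q0 q1 r Ys : R) (J : nat) : 0 < T -> 0 < D ->
  0 <= p0 -> 0 <= p1 -> 0 <= q0 -> 0 <= q1 -> 0 <= r -> 0 <= Ys ->
  exists2 M : R, 0 <= M & forall (E Gb Pp es : R -> R) (c dk : 'I_J -> R -> R),
    {within `[0, T], continuous E} -> (forall t, 0 <= t <= T -> 0 <= E t) ->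
    (forall t, 0 <= t <= T -> 0 <= Gb t) ->
    mu.-integrable `]0, T[ (EFin \o Pp) ->
    mu.-integrable `]0, T[ (EFin \o es) -> (forall t, 0 <= es t) ->
    \int[mu]_(t in `]0, T[) es t <= Ys ->
    (forall j, {within `[0, T], continuous (c j)}) ->
    (forall j, L2 mu (dk j \_ `]0, T[)) ->
    (forall j t, 0 <= t <= T -> c j t = c j 0 + \int[mu]_(s in `]0, t[) dk j s) ->
    (forall b, 0 < b <= T -> E b + 2 * D * Gb b <=
      E 0 + \int[mu]_(t in `]0, b[) Pp t + \int[mu]_(t in `]0, b[) E t) ->
    {ae mu, forall t : R, `]0, T[%classic t ->
      Pp t <= p0 + p1 * (E t + \sum_j c j t ^+ 2)} ->
    (forall j, {ae mu, forall t : R, `]0, T[%classic t ->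
      dk j t ^+ 2 <= q0 + q1 * (E t + es t + \sum_j c j t ^+ 2)}) ->
    E 0 <= r -> (forall j, c j 0 ^+ 2 <= r) ->
    [/\ forall t, 0 <= t <= T -> E t + \sum_j c j t ^+ 2 <= M, Gb T <= M,
      \int[mu]_(t in `]0, T[) Pp t <= M &
      forall j, \int[mu]_(t in `]0, T[) (dk j t ^+ 2) <= M].
Proof.
have le_sum4 (x y z t : R) : 0 <= x -> 0 <= y -> 0 <= z -> 0 <= t ->
    [/\ x <= x + y + z + t, y <= x + y + z + t, z <= x + y + z + t & t <= x + y + z + t].
  by move=> *; split; lra.
move=> T0 D0 p00 p10 q00 q10 r0 Ys0.
(* These are the coefficients in [V b <= a + B * \int V]: [E] contributes [r + p0 T] and [p1 + 1],
   and each of the [J] squares [c j ^+ 2] contributes twice its initial value plus [2 T] times the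
   bound for the integral of [dk j ^+ 2]. *)
pose a := r + p0 * T + J%:R * (2 * r + 2 * T * (q0 * T + q1 * Ys)).
pose B := p1 + 1 + J%:R * (2 * T * q1).
have Tge := ltW T0; have Dge := ltW D0.
have a0 : 0 <= a by do ?[by []|apply: addr_ge0|apply: mulr_ge0].
have B0 : 0 < B by rewrite /B ltr_wpDr ?mulr_ge0// ltr_wpDl.
pose V0 := 2 * a * expR (2 * B * T).
have V00 : 0 <= V0 by rewrite mulr_ge0 ?expR_ge0// mulr_ge0.
(* Given [V <= V0], the pointwise bounds integrate to [P1] and [Q1], and the energy inequality at
   time [T], solved for the gradient term, gives [G1]. *)
pose P1 := p0 * T + p1 * (V0 * T).
have P1ge0 : 0 <= P1 by do ?[by []|apply: addr_ge0|apply: mulr_ge0].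
pose Q1 := q0 * T + q1 * (V0 * T + Ys).
have Q1ge0 : 0 <= Q1 by do ?[by []|apply: addr_ge0|apply: mulr_ge0].
pose G1 := (r + P1 + V0 * T) / (2 * D).
have G1ge0 : 0 <= G1 by do ?[by []|apply: divr_ge0|apply: addr_ge0|apply: mulr_ge0].
have [VM GM PM' QM] : [/\ V0 <= V0 + G1 + P1 + Q1, G1 <= V0 + G1 + P1 + Q1,
    P1 <= V0 + G1 + P1 + Q1 & Q1 <= V0 + G1 + P1 + Q1] by exact: le_sum4.
exists (V0 + G1 + P1 + Q1); first by do ?[by []|apply: addr_ge0].
move=> E Gb Pp es c dk cE E0 Gb0 iP ie es0 eY cc Ldk ci en pb qb Er cr.
pose V t := E t + \sum_j c j t ^+ 2.
have S0 t : 0 <= \sum_j c j t ^+ 2 by apply: sumr_ge0 => j _; exact: sqr_ge0.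
have VE t : E t <= V t by rewrite lerDl.
have Vge t : 0 <= t <= T -> 0 <= V t by move=> tT; rewrite addr_ge0// E0.
have cV : {within `[0, T], continuous V}.
  apply/subspace_continuousP => t tT; apply: cvgD.
    by move/subspace_continuousP : cE => /(_ t tT).
  apply: cvg_big => [|j _]; first exact: add_continuous.
  have /subspace_continuousP /(_ t tT) h := cc j.
  exact: (cvgM h h).
have sub b : b <= T -> `]0, b[%classic `<=` `]0, T[%classic.
  by move=> bT; apply: subset_itvl; rewrite bnd_simp.
have iS b (f : R -> R) : b <= T -> mu.-integrable `]0, T[ (EFin \o f) ->
    mu.-integrable `]0, b[ (EFin \o f).
  by move=> bT; apply: integrableS => //; exact: sub.
have iV : mu.-integrable `]0, T[ (EFin \o V) := continuous_itv_oo_integrable cV.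
have iE : mu.-integrable `]0, T[ (EFin \o E) := continuous_itv_oo_integrable cE.
have id j : mu.-integrable `]0, T[ (EFin \o (fun t => dk j t ^+ 2)).
  by have [] := L2_integrable_oo T0 (Ldk j).
have PV b : 0 <= b <= T -> \int[mu]_(t in `]0, b[) Pp t <=
    p0 * T + p1 * \int[mu]_(t in `]0, b[) V t.
  move=> /andP[b0 bT]; apply: le_trans (Rintegral_affine_le (f := Pp) (u0 := p0) (u1 := p1)
    (g := V) b0 (iS _ _ bT iP) (iS _ _ bT iV) _) _.
    by apply: ae_imp pb _ => t pbt tb; apply: pbt; exact: sub tb.
  by rewrite lerD2r ler_wpM2l.
have esb b : 0 <= b <= T -> \int[mu]_(t in `]0, b[) es t <= Ys.
  move=> /andP[b0 bT]; apply: le_trans eY.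
  rewrite Rintegral_mkcond [leRHS]Rintegral_mkcond; apply: le_Rintegral => //.
  - have := (@integrable_mkcond _ _ _ mu `]0, b[ (EFin \o es) (measurable_itv _)).1 (iS _ _ bT ie).
    by apply: eq_integrable => // t _; rewrite /= !patchE; case: ifP.
  - have := (@integrable_mkcond _ _ _ mu `]0, T[ (EFin \o es) (measurable_itv _)).1 ie.
    by apply: eq_integrable => // t _; rewrite /= !patchE; case: ifP.
  move=> t _; rewrite !patchE; case: ifPn => tb; last by case: ifP => _; rewrite ?es0.
  by rewrite ifT//; move: tb; rewrite !inE; exact: sub.
have QV j b : 0 <= b <= T -> \int[mu]_(t in `]0, b[) (dk j t ^+ 2) <=
    q0 * T + q1 * (\int[mu]_(t in `]0, b[) V t + Ys).
  move=> /[dup] bT' /andP[b0 bT].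
  apply: le_trans (Rintegral_affine_le (f := fun t => dk j t ^+ 2) (u0 := q0) (u1 := q1)
    (g := fun t => V t + es t) b0 (iS _ _ bT (id j)) _ _) _.
  - by apply: integrable_addR => //; exact: iS.
  - apply: ae_imp (qb j) _ => t qbt tb; apply: le_trans (qbt (sub _ bT _ tb)) _.
    by rewrite lerD2l ler_wpM2l// /V; lra.
  rewrite RintegralD//; [|exact: iS|exact: iS].
  by apply: lerD; [rewrite ler_wpM2l|rewrite ler_wpM2l// lerD2l esb].
have IV0 b : 0 <= b <= T -> 0 <= \int[mu]_(t in `]0, b[) V t.
  move=> /andP[b0 bT]; apply: Rintegral_ge0 => t; rewrite /= in_itv/= => /andP[t0 tb].
  by apply: Vge; rewrite ltW//= ltW// (lt_le_trans tb).
have EV b : 0 <= b <= T -> E b <= r + p0 * T + (p1 + 1) * \int[mu]_(t in `]0, b[) V t.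
  move=> /[dup] bT' /andP[b0 bT]; have [b00|b00] := eqVneq b 0.
    rewrite b00 set_itvoo0 ?lexx// Rintegral_set0 mulr0 addr0 (le_trans Er)// lerDl mulr_ge0//.
  have {}b0 : 0 < b by rewrite lt_neqAle eq_sym b00.
  have := en b; rewrite b0 bT => /(_ isT) h.
  have h1 := PV b bT'; have h2 : \int[mu]_(t in `]0, b[) E t <= \int[mu]_(t in `]0, b[) V t.
    by apply: le_Rintegral => //; exact: iS.
  have h3 : 0 <= D * Gb b by rewrite mulr_ge0// Gb0.
  move: h h1 h2; set I1 := Rintegral _ _ _; set I2 := Rintegral _ _ _; set I3 := Rintegral _ _ _.
  by lra.
have VB t : 0 <= t <= T -> V t <= V0.
  apply: (gronwall T0 B0 cV Vge) => b bT.
  have h1 := EV b bT.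
  have h2 : \sum_j c j b ^+ 2 <= J%:R * (2 * r + 2 * T * (q0 * T + q1 * Ys) +
      2 * T * q1 * \int[mu]_(t in `]0, b[) V t).
    rewrite mulr_natl -[X in _ *+ X]card_ord -sumr_const; apply: ler_sum => j _.
    apply: le_trans (scalar_sqr_le (Ldk j) (cr j) (ci j) bT) _.
    rewrite -addrA lerD2l; apply: le_trans (ler_wpM2l _ (QV j b bT)) _; first by rewrite mulr_ge0.
    by rewrite le_eqVlt; apply/orP; left; apply/eqP; ring.
  rewrite /V /a /B; move: h1 h2; set I1 := Rintegral _ _ _ => h1 h2.
  apply: le_trans (lerD h1 h2) _.
  by rewrite le_eqVlt; apply/orP; left; apply/eqP; ring.
have VT b : 0 <= b <= T -> \int[mu]_(t in `]0, b[) V t <= V0 * T.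
  move=> /[dup] bT' /andP[b0 bT].
  have := Rintegral_affine_le (f := V) (u0 := V0) (u1 := 0) (g := V) b0 (iS _ _ bT iV) (iS _ _ bT iV).
  rewrite mul0r addr0 => h; apply: le_trans (h _) _; last by rewrite ler_wpM2l.
  apply: aeW => t; rewrite /= in_itv/= => /andP[t0 tb]; rewrite mul0r addr0.
  by apply: VB; rewrite ltW//= ltW// (lt_le_trans tb).
have TT : 0 <= T <= T by rewrite lexx Tge.
have PM : \int[mu]_(t in `]0, T[) Pp t <= P1.
  by apply: le_trans (PV T TT) _; rewrite lerD2l ler_wpM2l// VT.
split.
- by move=> t tT; exact: le_trans (VB t tT) VM.
- have := en T; rewrite T0 lexx => /(_ isT) h.
  suff h1 : Gb T <= G1 by exact: le_trans h1 GM.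
  rewrite ler_pdivlMr ?mulr_gt0// mulrC.
  have h2 : \int[mu]_(t in `]0, T[) E t <= V0 * T.
    by apply: le_trans (VT T TT); apply: le_Rintegral.
  have h3 := E0 T TT.
  move: h PM h2; set I1 := Rintegral _ _ _; set I2 := Rintegral _ _ _; lra.
- exact: le_trans PM PM'.
- move=> j; apply: le_trans (QV j T TT) _; apply: le_trans _ QM.
  by rewrite lerD2l ler_wpM2l// lerD2r VT.
Qed.

End a_priori.

(** * Lipschitz nonlinearities and control terms *)

Section lipschitz_maps.
Context (R : realType).
Implicit Types (f : R -> R).

Lemma lipschitz_dist f (L : R) : L.-lipschitz f ->
  forall x y, `|f x - f y| <= `|L| * `|x - y|.
Proof.
move=> fL x y; apply: le_trans (fL (x, y) _) _ => //=.
by apply: ler_wpM2r => //; exact: ler_norm.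
Qed.

Lemma lipschitz_continuous f (L : R) : L.-lipschitz f -> continuous f.
Proof.
move=> fL x; apply/cvgrPdist_le => e e0.
have L1 : 0 < `|L| + 1 by rewrite ltr_wpDl.
have eL : 0 < e / (`|L| + 1) by rewrite divr_gt0.
apply/nbhs_ballP; exists (e / (`|L| + 1)) => //= y /ltW xy.
apply: le_trans (lipschitz_dist fL x y) _.
rewrite -[leRHS](divfK (lt0r_neq0 L1)) [leRHS]mulrC.
by apply: ler_pM => //; rewrite lerDl.
Qed.

Lemma lipschitz_norm_le f (L : R) : L.-lipschitz f ->
  forall x, `|f x| <= `|f 0| + `|L| * `|x|.
Proof.
move=> fL x; have := lipschitz_dist fL x 0; rewrite subr0 => h.
by rewrite -[f x](subrK (f 0)) addrC; apply: le_trans (ler_normD _ _) _; rewrite lerD2l.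
Qed.

End lipschitz_maps.

Section nonlinear_terms.
Context (R : realType) (d : nat) (Omega : set 'rV[R]_d).
Hypothesis mO : measurable Omega.
Local Notation m := (lebesgue_rV R d).
Implicit Types (u v : 'rV[R]_d -> R).

Lemma L2norm_sqr u : L2 m (u \_ Omega) ->
  (L2norm Omega u ^+ 2)%E = (ip m (u \_ Omega) (u \_ Omega))%:E.
Proof. by move=> Lu; rewrite L2norm_ip// -EFin_expe sqr_sqrtr// ip_ge0. Qed.

(** Pointwise [f(v)^2 <= 2 f(0)^2 + 2 L^2 v^2]; the constant term is integrable because the domain
    has finite volume. *)
Lemma nemytskii_L2 (f : R -> R) (L vol : R) v : m Omega = vol%:E -> L.-lipschitz f ->
  L2 m (v \_ Omega) ->
  L2 m ((fun x => f (v x)) \_ Omega) /\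
  ip m ((fun x => f (v x)) \_ Omega) ((fun x => f (v x)) \_ Omega) <=
    2 * f 0 ^+ 2 * vol + 2 * L ^+ 2 * ip m (v \_ Omega) (v \_ Omega).
Proof.
move=> mOv fL Lv; set w := (fun x => f (v x)) \_ Omega.
(* Composition with [f] destroys the zero extension when [f 0] is not 0, so the indicator has to be
   restored. *)
have wE : w = fun x => f ((v \_ Omega) x) * \1_Omega x.
  apply/funext => x; rewrite /w indicE !patchE; case: ifPn => _; first by rewrite mulr1.
  by rewrite mulr0.
have mw : measurable_fun setT w.
  rewrite wE; apply: measurable_funM; last exact: measurable_indic.
  exact: measurableT_comp (continuous_measurable_fun (lipschitz_continuous fL)) Lv.1.
pose g x := 2 * f 0 ^+ 2 * \1_Omega x + 2 * L ^+ 2 * (v \_ Omega) x ^+ 2.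
have wg x : w x ^+ 2 <= g x.
  rewrite /w /g indicE !patchE; case: ifPn => xO; last first.
    by rewrite [point](_ : _ = 0)// mulr0 add0r expr0n/= mulr0.
  rewrite mulr1; have := lipschitz_norm_le fL (v x); rewrite -(real_normK (num_real (f _))).
  rewrite -[f 0 ^+ 2](real_normK (num_real _)) -[L ^+ 2](real_normK (num_real _)) -[v x ^+ 2](real_normK (num_real _)).
  have := normr_ge0 (f (v x)).
  move: `|f (v x)| `|f 0| `|L| `|v x| => a b c e a0 h.
  have : a ^+ 2 <= (b + c * e) ^+ 2 by rewrite ler_pXn2r// nnegrE (le_trans a0).
  by have := sqr_ge0 (b - c * e); nra.
have i0 : m.-integrable setT (EFin \o \1_Omega).
  apply/integrableP; split; first by apply/measurable_EFinP; exact: measurable_indic.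
  under eq_integral do rewrite gee0_abs ?lee_fin//.
  by rewrite integral_indic// setIT [ltLHS]mOv ltry.
have i1 : m.-integrable setT (EFin \o (fun x => 2 * f 0 ^+ 2 * \1_Omega x)).
  exact: integrable_scaleR.
have i2 : m.-integrable setT (EFin \o (fun x => 2 * L ^+ 2 * (v \_ Omega) x ^+ 2)).
  by apply: integrable_scaleR => //; exact: Lv.2.
have ig : m.-integrable setT (EFin \o g) by exact: integrable_addR.
have Lw : L2 m w by exact: L2_dominated ig wg.
split => //.
have <- : \int[m]_x g x = 2 * f 0 ^+ 2 * vol + 2 * L ^+ 2 * ip m (v \_ Omega) (v \_ Omega).
  rewrite RintegralD//; congr (_ + _).
    rewrite RintegralZl//; congr (_ * _); rewrite /Rintegral integral_indic// setIT.
    by rewrite [X in fine X = _]mOv.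
  by rewrite RintegralZl//; exact: Lv.2.
apply: le_Rintegral => //; first exact: L2_prod.
by move=> x _; rewrite -expr2.
Qed.

(** The finite Cauchy-Schwarz inequality at each point, then integration. *)
Lemma combination_L2 (n : nat) (k : 'I_n -> R) (g : 'I_n -> 'rV[R]_d -> R) :
  (forall j, L2 m (g j \_ Omega)) ->
  L2 m ((fun x => \sum_j k j * g j x) \_ Omega) /\
  ip m ((fun x => \sum_j k j * g j x) \_ Omega) ((fun x => \sum_j k j * g j x) \_ Omega) <=
    (\sum_j k j ^+ 2) * (\sum_j ip m (g j \_ Omega) (g j \_ Omega)).
Proof.
move=> Lg.
have -> : (fun x => \sum_j k j * g j x) \_ Omega = fun x => \sum_j k j * (g j \_ Omega) x.
  apply/funext => x; rewrite patchE; case: ifPn => xO.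
    by apply: eq_bigr => j _; rewrite patchE xO.
  by rewrite big1// => j _; rewrite patchE (negbTE xO) [point](_ : _ = 0)// mulr0.
have Ls : L2 m (fun x => \sum_j k j * (g j \_ Omega) x).
  by apply: L2_sum => j; exact: L2_scale.
split => //.
have ig j : m.-integrable setT (EFin \o (fun x => (g j \_ Omega) x * (g j \_ Omega) x)).
  exact: L2_prod.
rewrite /ip -Rintegral_sum// -RintegralZl//; last exact: integrable_sumR.
apply: le_Rintegral => //; first exact: L2_prod.
  by apply: integrable_scaleR => //; exact: integrable_sumR.
move=> x _; rewrite -expr2; under [X in _ * X]eq_bigr do rewrite -expr2.
exact: big_sum_sqr_prod_le.
Qed.

Lemma restrict_add u v :
  (fun x => u x + v x) \_ Omega = (fun x => (u \_ Omega) x + (v \_ Omega) x).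
Proof.
apply/funext => x; rewrite !patchE; case: ifP => // _.
by rewrite [point](_ : _ = 0)// addr0.
Qed.

Lemma forcing_L2 (f : R -> R) (L vol : R) v (n : nat) (k : 'I_n -> R)
    (g : 'I_n -> 'rV[R]_d -> R) :
  m Omega = vol%:E -> L.-lipschitz f -> L2 m (v \_ Omega) ->
  (forall j, L2 m (g j \_ Omega)) ->
  let q := (fun x => f (v x) + \sum_j k j * g j x) \_ Omega in
  L2 m q /\ ip m q q <=
    4 * f 0 ^+ 2 * vol + 4 * L ^+ 2 * ip m (v \_ Omega) (v \_ Omega) +
    2 * ((\sum_j k j ^+ 2) * (\sum_j ip m (g j \_ Omega) (g j \_ Omega))).
Proof.
move=> mOv fL Lv Lg; have [Lf fle] := nemytskii_L2 mOv fL Lv.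
have [Ls sle] := combination_L2 k Lg.
rewrite /= restrict_add; split; first exact: L2_add.
by apply: le_trans (ip_addsq_le Lf Ls) _; lra.
Qed.

Section control_term.
Context (J K : nat).
Variables (u : control Omega J K) (RU : R).
Hypothesis (RU0 : 0 <= RU) (uRU : (Unorm u <= RU%:E)%E).

Lemma control_g_L2 j : L2 m (g_ u j \_ Omega).
Proof. exact: in_L2_restrict (g_L2 u j). Qed.

Lemma control_h_L2 k : L2 m (h_ u k \_ Omega).
Proof. exact: in_L2_restrict (h_L2 u k). Qed.

Let Usqr : \sum_(j < J) ip m (g_ u j \_ Omega) (g_ u j \_ Omega) +
  \sum_(k < K) ip m (h_ u k \_ Omega) (h_ u k \_ Omega) +
  \sum_(j < J) \sum_(k < K) alpha_ u j k ^+ 2 <= RU ^+ 2.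
Proof.
have sg : 0 <= \sum_(j < J) ip m (g_ u j \_ Omega) (g_ u j \_ Omega).
  by apply: sumr_ge0 => j _; exact: ip_ge0.
have sh : 0 <= \sum_(k < K) ip m (h_ u k \_ Omega) (h_ u k \_ Omega).
  by apply: sumr_ge0 => j _; exact: ip_ge0.
have sa : 0 <= \sum_(j < J) \sum_(k < K) alpha_ u j k ^+ 2.
  by apply: sumr_ge0 => j _; apply: sumr_ge0 => k _; exact: sqr_ge0.
move: uRU; rewrite /Unorm.
under eq_bigr do rewrite (L2norm_sqr (control_g_L2 _)).
under [X in (_ + X + _)%E]eq_bigr do rewrite (L2norm_sqr (control_h_L2 _)).
rewrite !sumEFin -!EFinD /= lee_fin => h.
rewrite -[leLHS]sqr_sqrtr ?addr_ge0// ler_pXn2r// ?nnegrE ?sqrtr_ge0//.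
Qed.

Lemma control_g_le : \sum_(j < J) ip m (g_ u j \_ Omega) (g_ u j \_ Omega) <= RU ^+ 2.
Proof.
apply: le_trans Usqr; rewrite -addrA lerDl addr_ge0// sumr_ge0// => k _; first exact: ip_ge0.
by apply: sumr_ge0 => j _; exact: sqr_ge0.
Qed.

Lemma control_h_le k : ip m (h_ u k \_ Omega) (h_ u k \_ Omega) <= RU ^+ 2.
Proof.
apply: le_trans Usqr; rewrite (bigD1 k)//= addrAC addrCA lerDl !addr_ge0// sumr_ge0// => j _;
  rewrite ?ip_ge0//.
by apply: sumr_ge0 => i _; exact: sqr_ge0.
Qed.

Lemma control_alpha_le j k : `|alpha_ u j k| <= RU.
Proof.
suff h : alpha_ u j k ^+ 2 <= RU ^+ 2.
  by rewrite -(ler_pXn2r (n := 2))// ?nnegrE// real_normK// num_real.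
apply: le_trans Usqr; apply: (@le_trans _ _ (\sum_(j < J) \sum_(k < K) alpha_ u j k ^+ 2)).
  rewrite (bigD1 j)//= (bigD1 k)//= -addrA lerDl addr_ge0// sumr_ge0// => i _.
    exact: sqr_ge0.
  by apply: sumr_ge0 => l _; exact: sqr_ge0.
by rewrite lerDr addr_ge0// sumr_ge0// => i _; exact: ip_ge0.
Qed.

Variables (w : 'I_K -> R -> R) (Lw w0 : 'I_K -> R).
Hypotheses (wL : forall k, (Lw k).-lipschitz (w k)) (w_0 : forall k, w k 0 = w0 k).

(** With [n] the norm of the difference of [v] and [vs], [|W_j|] is at most
    [RU \sum_k |w0 k| + RU^2 \sum_k |Lw k| n]: one factor [RU] bounds [alpha_jk], the second bounds
    the norm of [h_k]. Squaring this and then [n] gives the factors 2 and 4. *)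
Lemma thermostat_le j (v vs : 'rV[R]_d -> R) : L2 m (v \_ Omega) -> L2 m (vs \_ Omega) ->
  W_ w u j v vs ^+ 2 <= 2 * (RU * \sum_k `|w0 k|) ^+ 2 +
    4 * (RU ^+ 2 * \sum_k `|Lw k|) ^+ 2 *
      (ip m (v \_ Omega) (v \_ Omega) + ip m (vs \_ Omega) (vs \_ Omega)).
Proof.
move=> Lv Lvs; set A := RU * _; set B := RU ^+ 2 * _.
have Ld := L2_sub Lv Lvs; set df := (fun x => (v \_ Omega) x - _) in Ld.
set n := Num.sqrt (ip m df df).
have n2 : n ^+ 2 <= 2 * (ip m (v \_ Omega) (v \_ Omega) + ip m (vs \_ Omega) (vs \_ Omega)).
  rewrite sqr_sqrtr ?ip_ge0// ip_subsq//.
  have := ip_ge0 m (fun x => (v \_ Omega) x + (vs \_ Omega) x); rewrite ip_addsq//; lra.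
have n0 : 0 <= n by exact: sqrtr_ge0.
have Wn : `|W_ w u j v vs| <= A + B * n.
  rewrite /W_; apply: le_trans (ler_norm_sum _ _ _) _.
  rewrite /A /B !mulr_sumr mulr_suml -big_split/=; apply: ler_sum => k _.
  rewrite normrM; have ak := control_alpha_le j k.
  have := lipschitz_norm_le (wL k) (L2inner Omega (h_ u k) (fun x => v x - vs x)).
  rewrite w_0 => wle.
  have hle : `|L2inner Omega (h_ u k) (fun x => v x - vs x)| <= RU * n.
    rewrite L2inner_ip restrict_sub; apply: le_trans (cauchy_schwarz (control_h_L2 k) Ld) _.
    apply: ler_wpM2r => //; rewrite -[leRHS](ger0_norm RU0) -sqrtr_sqr.
    by rewrite ler_wsqrtr// control_h_le.
  apply: le_trans (ler_wpM2l (normr_ge0 _) wle) _.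
  have h3 : `|w0 k| + `|Lw k| * `|L2inner Omega (h_ u k) (fun x => v x - vs x)| <=
      `|w0 k| + `|Lw k| * (RU * n) by rewrite lerD2l ler_wpM2l.
  apply: le_trans (ler_pM _ _ ak h3) _ => //.
  by rewrite le_eqVlt; apply/orP; left; apply/eqP; ring.
rewrite -[leLHS](real_normK (num_real _)).
have : `|W_ w u j v vs| ^+ 2 <= (A + B * n) ^+ 2.
  by rewrite ler_pXn2r// nnegrE// (le_trans _ Wn).
have B2 := sqr_ge0 B.
have := ler_wpM2l B2 n2; have := sqr_ge0 (A - B * n).
set I := ip _ _ _ + _; move: (`|_|) I => a I; nra.
Qed.

End control_term.
End nonlinear_terms.

(** * Forcing, differential equations for the controllers, and the dual norm *)

Section evolution_terms.
Context (R : realType) (d : nat) (T : R) (Omega : set 'rV[R]_d).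
Hypothesis mO : measurable Omega.
Local Notation m := (lebesgue_rV R d).
Local Notation mu := (@lebesgue_measure R).
Local Notation muX := (mu \x m)%E.

Lemma measurable_Q_forcing (f : R -> R) (L : R) (n : nat) (k : 'I_n -> R -> R)
    (g : 'I_n -> 'rV[R]_d -> R) (y : R -> 'rV[R]_d -> R) : L.-lipschitz f ->
  measurable_Q T Omega y -> (forall j, measurable_fun `]0, T[ (k j)) ->
  (forall j, measurable_fun Omega (g j)) ->
  measurable_Q T Omega (fun t x => f (y t x) + \sum_j k j t * g j x).
Proof.
move=> fL my mk mg; rewrite /measurable_Q; apply: measurable_funD.
  exact: measurableT_comp (continuous_measurable_fun (lipschitz_continuous fL)) my.
apply: measurable_sum => j; apply: measurable_funM.
  apply: (@eq_measurable_fun _ _ _ _ _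
    (fun p : measurableTypeR R * 'rV[R]_d => (k j \_ `]0, T[) p.1)).
    by move=> -[t x]; rewrite inE => -[/= tT _]; rewrite patchE mem_set.
  apply: measurable_funTS.
  have h : measurable_fun [set: measurableTypeR R] (k j \_ `]0, T[).
    by apply/(measurable_restrictT _ _).1 => //; exact: mk.
  exact: measurableT_comp h measurable_fst.
apply: (@eq_measurable_fun _ _ _ _ _
  (fun p : measurableTypeR R * 'rV[R]_d => (g j \_ Omega) p.2)).
  by move=> -[t x]; rewrite inE => -[_ /= xO]; rewrite patchE mem_set.
apply: measurable_funTS.
have h : measurable_fun [set: 'rV[R]_d] (g j \_ Omega).
  by apply/(measurable_restrictT _ _).1 => //; exact: mg.
exact: measurableT_comp h measurable_snd.
Qed.

Lemma measurable_thermostat (J K : nat) (u : control Omega J K) (w : 'I_K -> R -> R)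
    (Lw : 'I_K -> R) (y ystar : R -> 'rV[R]_d -> R) j :
  (forall k, (Lw k).-lipschitz (w k)) ->
  measurable_Q T Omega y -> measurable_Q T Omega ystar ->
  measurable_fun `]0, T[ (fun t => W_ w u j (y t) (ystar t)).
Proof.
move=> wL my mys.
have md : measurable_Q T Omega (fun t x => y t x - ystar t x).
  exact: measurable_funB my mys.
apply: (@eq_measurable_fun _ _ _ _ _ (fun t : measurableTypeR R => \sum_(k < K) alpha_ u j k *
    w k (ip m (slice (ext T Omega (fun t x => y t x - ystar t x)) t) (h_ u k \_ Omega)))).
  move=> t; rewrite inE /= in_itv/= => tT; apply: eq_bigr => k _.
  by rewrite L2inner_ip slice_ext// ipC.
apply: measurable_funTS; apply: measurable_sum => k; apply: measurable_funM => //.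
apply: measurableT_comp (continuous_measurable_fun (lipschitz_continuous (wL k))) _.
apply: measurable_ip_slice; first exact: measurable_ext.
exact: (control_h_L2 mO u k).1.
Qed.

(** Testing with [xi = 1_B] for every measurable set of times [B] localizes the equation. *)
Lemma weak_scalar_ode (k dk W : R -> R) (b : R) :
  measurable_fun `]0, T[ k -> measurable_fun `]0, T[ dk -> measurable_fun `]0, T[ W ->
  (forall xi, in_Lp T 2%:E xi ->
    \int[mu]_(t in `]0, T[) ((b * dk t + k t - W t) * xi t) = 0) ->
  {ae mu, forall t : R, `]0, T[%classic t -> b * dk t = W t - k t}.
Proof.
move=> mk mdk mW weak.
have : {ae mu, forall t : R, `]0, T[%classic t -> b * dk t + k t - W t = 0}.
  apply: null_integral_ae0 => //.
  - by apply: measurable_funB => //; apply: measurable_funD => //; exact: measurable_funM.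
  - by rewrite [ltLHS](lebesgue_measure_itv `]0, T[)/=; case: ifP => _; rewrite ?ltry.
  move=> B mB BT; rewrite -[RHS](weak (\1_B)).
    rewrite -[in LHS](setIidr BT) Rintegral_mkcondr.
    apply: eq_Rintegral => t _; rewrite patchE indicE.
    by case: ifP => _; rewrite ?mulr1 ?mulr0.
  split; first by apply: measurable_funTS; exact: measurable_indic.
  apply: (@le_lt_trans _ _ (Num.sqrt (\int[mu]_(t in `]0, T[) 1))%:E); last by rewrite ltry.
  apply: (@time_norm2_le _ _ _ (fun=> 1)) => //.
    by apply: continuous_itv_oo_integrable => t; exact: cvg_cst.
  apply: aeW => t _; rewrite sqrtr1 /= lee_fin indicE.
  by case: (_ \in _); rewrite ?normr1 ?normr0.
move=> h; apply: ae_imp h _ => t ht tT; have := ht tT; lra.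
Qed.

Variables (D : R) (G : R -> 'rV[R]_d -> 'rV[R]_d) (q : R -> 'rV[R]_d -> R)
  (F : R -> ('rV[R]_d -> R) -> R).
Hypotheses (T0 : 0 < T) (LG : forall i, L2 muX (gcomp T Omega G i))
  (Lq : L2 muX (ext T Omega q)) (dF : in_L2H1dual T Omega F).
Hypothesis weak : forall phi K, in_L2H1 T Omega phi K ->
  \int[mu]_(t in `]0, T[) (F t (phi t) +
    D * \int[m]_(x in Omega) dotv (G t x) (K t x) - L2inner Omega (q t) (phi t)) = 0.

(** Cauchy-Schwarz for each of the two pairings, with the H^1 norm of [v] at most 1, and
    [(a - D b)^2 <= 2 a^2 + 2 D^2 b^2]. *)
Lemma dual_rep_le v H t : in_H1 Omega v H -> H1sqr Omega v H <= 1 ->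
  L2 m (slice (ext T Omega q) t) -> (forall i, L2 m (slice (gcomp T Omega G i) t)) ->
  dual_rep T Omega D G q v H t ^+ 2 <=
    2 * ip m (slice (ext T Omega q) t) (slice (ext T Omega q) t) +
    2 * D ^+ 2 * \sum_i ip m (slice (gcomp T Omega G i) t) (slice (gcomp T Omega G i) t).
Proof.
move=> vH v1 Lqt LGt; have [Lv LH] := in_H1_L2 mO vH.
rewrite /dual_rep; set a := ip m _ _; set b := \sum_i _.
set A := ip m _ _; set B := \sum_i _.
have A0 : 0 <= A by exact: ip_ge0.
have B0 : 0 <= B by apply: sumr_ge0 => i _; exact: ip_ge0.
have H0 : 0 <= \sum_i ip m (comp_ H i \_ Omega) (comp_ H i \_ Omega).
  by apply: sumr_ge0 => i _; exact: ip_ge0.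
have V0 := ip_ge0 m (v \_ Omega).
have aA : a ^+ 2 <= A.
  apply: le_trans (cauchy_schwarz_sqr Lqt Lv) _; rewrite -[leRHS]mulr1 ler_wpM2l//.
  by apply: le_trans v1; rewrite lerDl.
have bB : b ^+ 2 <= B.
  pose s i := Num.sqrt (ip m (slice (gcomp T Omega G i) t) (slice (gcomp T Omega G i) t)).
  pose r i := Num.sqrt (ip m (comp_ H i \_ Omega) (comp_ H i \_ Omega)).
  have bs : `|b| <= \sum_i s i * r i.
    by apply: le_trans (ler_norm_sum _ _ _) _; apply: ler_sum => i _; exact: cauchy_schwarz.
  rewrite -(real_normK (num_real b)).
  apply: (@le_trans _ _ ((\sum_i s i * r i) ^+ 2)).
    by rewrite ler_pXn2r// nnegrE// (le_trans _ bs).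
  apply: le_trans (big_sum_sqr_prod_le _ _) _.
  under eq_bigr do rewrite sqr_sqrtr ?ip_ge0//.
  under [X in _ * X]eq_bigr do rewrite sqr_sqrtr ?ip_ge0//.
  rewrite -[leRHS]mulr1 ler_wpM2l//.
  by apply: le_trans v1; rewrite lerDr.
have D2 := sqr_ge0 D; have := ler_wpM2l D2 bB; have := sqr_ge0 (a + D * b).
move: A B a b {A0 B0 bB} aA => A B a b aA; nra.
Qed.

(** The countable norming family admits one null set of times for all its members, off which the
    formula for [y'(t)] bounds the full dual norm. *)
Lemma dual_norm_ae : {ae mu, forall t : R, `]0, T[%classic t ->
  (`|H1dual_norm Omega (F t)| <= (Num.sqrt
    (2 * ip m (slice (ext T Omega q) t) (slice (ext T Omega q) t) +
     2 * D ^+ 2 * \sum_i ip m (slice (gcomp T Omega G i) t) (slice (gcomp T Omega G i) t)))%:E)%E}.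
Proof.
have [sF _ _] := dF.
have [v [H [vH v1 norming]]] := H1dual_norming_family mO sF.
have h1 : {ae mu, forall t : R, forall k, `]0, T[%classic t -> F t (v k) = dual_rep T Omega D G q (v k) (H k) t}.
  apply/ae_foralln => k; exact: (dual_representation mO T0 LG Lq dF weak (vH k)).
have h2 : {ae mu, forall t : R, L2 m (slice (ext T Omega q) t)} by exact: L2_slice_snd Lq.
have h3 : {ae mu, forall t : R, forall i, L2 m (slice (gcomp T Omega G i) t)}.
  by apply: ae_forall_ord => i; exact: L2_slice_snd.
have h23 := ae_imp2 h2 h3 (fun t a b => conj a b).
have h4 := ae_imp2 h1 h23 (fun t a b => conj a b).
apply: ae_imp2 norming h4 _ => t nt [Ft [Lqt LGt]] tT.
rewrite gee0_abs ?H1dual_norm_ge0//; apply: nt => // k; rewrite Ft//.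
by rewrite -sqrtr_sqr ler_wsqrtr// dual_rep_le.
Qed.

Lemma dual_time_norm_le : (time_norm T 2%:E (fun t => H1dual_norm Omega (F t)) <=
  (Num.sqrt (2 * ip muX (ext T Omega q) (ext T Omega q) +
    2 * D ^+ 2 * \sum_i ip muX (gcomp T Omega G i) (gcomp T Omega G i)))%:E)%E.
Proof.
pose b t := 2 * ip m (slice (ext T Omega q) t) (slice (ext T Omega q) t) +
  2 * D ^+ 2 * \sum_i ip m (slice (gcomp T Omega G i) t) (slice (gcomp T Omega G i) t).
have b0 t : 0 <= b t.
  by do ?[by []|exact: ip_ge0|exact: sqr_ge0|apply: sumr_ge0 => i _|apply: addr_ge0|apply: mulr_ge0].
have iq : mu.-integrable setT (EFin \o (fun t => 2 * ip m (slice (ext T Omega q) t) (slice (ext T Omega q) t))).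
  by apply: integrable_scaleR => //; exact: integrable_ip_snd.
have iGs : mu.-integrable setT (EFin \o (fun t => \sum_i ip m (slice (gcomp T Omega G i) t) (slice (gcomp T Omega G i) t))).
  by apply: integrable_sumR => i; exact: integrable_ip_snd.
have iG : mu.-integrable setT (EFin \o (fun t => 2 * D ^+ 2 * \sum_i ip m (slice (gcomp T Omega G i) t) (slice (gcomp T Omega G i) t))).
  exact: integrable_scaleR.
have ib : mu.-integrable setT (EFin \o b) by exact: integrable_addR.
have -> : 2 * ip muX (ext T Omega q) (ext T Omega q) +
    2 * D ^+ 2 * \sum_i ip muX (gcomp T Omega G i) (gcomp T Omega G i) = \int[mu]_(t in `]0, T[) b t.
  rewrite Rintegral_mkcond (_ : b \_ _ = b); last first.
    apply/funext => t; rewrite patchE; case: ifPn => //; rewrite notin_setE /= in_itv/= => /negP tT.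
    rewrite /b slice_ext_out// ip0l big1 ?mulr0 ?addr0// => i _.
    by rewrite slice_ext_out// ip0l.
  rewrite RintegralD// RintegralZl//; last exact: integrable_ip_snd.
  rewrite RintegralZl// Rintegral_sum; last by move=> i; exact: integrable_ip_snd.
  rewrite -(Rintegral_ip_snd Lq); congr (_ + _ * _).
  by apply: eq_bigr => i _; rewrite -(Rintegral_ip_snd (LG i)).
apply: time_norm2_le => //; first exact: integrableS ib.
exact: dual_norm_ae.
Qed.

End evolution_terms.

(** * The bound for weak solutions *)

Section solution_bounds.
Context (R : realType) (d : nat) (T : R) (Omega : set 'rV[R]_d) (J : nat).
Hypothesis mO : measurable Omega.
Local Notation m := (lebesgue_rV R d).
Local Notation mu := (@lebesgue_measure R).
Local Notation muX := (mu \x m)%E.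

Lemma in_LpL2y_L2 (y : R -> 'rV[R]_d -> R) : in_LpL2 T Omega +oo%E y ->
  exists2 M : R, 0 <= M & L2 muX (ext T Omega y) /\
    {ae mu, forall t : R, `]0, T[%classic t ->
      L2 m (y t \_ Omega) /\ ip m (y t \_ Omega) (y t \_ Omega) <= M}.
Proof.
move=> [my /time_normy_ae[M M0 yM]].
have yM' : {ae mu, forall t : R, `]0, T[%classic t -> (L2norm Omega (y t) <= M%:E)%E}.
  by apply: ae_imp yM _ => t yMt tT; apply: le_trans (yMt tT); exact: lee_abs.
exists (M ^+ 2); first exact: sqr_ge0.
split; first exact: (L2_ext mO my yM').
apply: ae_imp yM' _ => t yMt tT; have tT' : 0 < t < T by move: tT; rewrite /= in_itv.
have Lyt : L2 m (y t \_ Omega).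
  by apply: (L2_ext_slice mO my tT'); apply: le_lt_trans (yMt tT) _; rewrite ltry.
split => //; have := yMt tT; rewrite L2norm_ip// lee_fin => h.
by rewrite -[leLHS]sqr_sqrtr ?ip_ge0// ler_pXn2r// ?nnegrE ?sqrtr_ge0.
Qed.

(** Translates the given extended-real norm of [y*] into the real integral that the a priori bound
    takes as input. *)
Lemma time_norm2_L2norm (v : R -> 'rV[R]_d -> R) (Y : R) : in_LpL2 T Omega +oo%E v ->
  time_norm T 2%:E (fun t => L2norm Omega (v t)) = Y%:E ->
  \int[mu]_(t in `]0, T[) ip m (v t \_ Omega) (v t \_ Omega) = Y ^+ 2.
Proof.
move=> vL; have [M M0 [Lv vM]] := in_LpL2y_L2 vL.
pose g := (fun t => ip m (v t \_ Omega) (v t \_ Omega)) \_ `]0, T[.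
rewrite /time_norm Lnorm2E (@ae_eq_integral_any _ _ _ mu setT _ (EFin \o g)); last first.
  apply: ae_imp vM _ => t vMt _; rewrite /g /= !patchE; case: ifPn => tT; last first.
    by rewrite [X in `|X|%E](_ : _ = 0%E)// abse0 mule0.
  have [Lvt _] := vMt (set_mem tT).
  by rewrite L2norm_ip// gee0_abs ?lee_fin ?sqrtr_ge0// -EFinM -expr2 sqr_sqrtr// ip_ge0.
have iv := integrable_ip_ext Lv.
have iv' := (@integrable_mkcond _ _ _ mu `]0, T[ _ (measurable_itv _)).1 iv.
have -> : \int[mu]_(t in `]0, T[) ip m (v t \_ Omega) (v t \_ Omega) = \int[mu]_t g t.
  exact: Rintegral_mkcond.
have -> : (\int[mu]_x (EFin \o g) x = (\int[mu]_t g t)%:E)%E.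
  rewrite /Rintegral fineK//; apply: integrable_fin_num => //.
  by move: iv'; apply: eq_integrable => // t _; rewrite /g /= !patchE; case: ifP.
move=> /= -[<-]; rewrite sqr_sqrtr//.
apply: Rintegral_ge0 => t _; rewrite /g patchE; case: ifP => _ //; exact: ip_ge0.
Qed.

(** The summand 1 makes the inequality strict. *)
Lemma X2norm_le (z : X2 T Omega J) (a b c e : R) :
  (time_norm T +oo%E (fun t => L2norm Omega (X_y z t)) <= a%:E)%E ->
  (gradQ_norm T Omega (X_grad z) <= b%:E)%E ->
  (time_norm T 2%:E (fun t => H1dual_norm Omega (X_dy z t)) <= c%:E)%E ->
  (forall j, (time_norm T +oo%E (EFin \o X_kappa z j) +
    time_norm T 2%:E (EFin \o X_dkappa z j) <= e%:E)%E) ->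
  (X2norm z < (a + b + c + e *+ J + 1)%:E)%E.
Proof.
move=> za zb zc ze.
apply: (@le_lt_trans _ _ (a + b + c + e *+ J)%:E); last by rewrite lte_fin ltrDl.
rewrite /X2norm !EFinD; apply: leeD; first by apply: leeD => //; exact: leeD.
rewrite -[X in _ *+ X]card_ord -sumr_const -sumEFin.
by apply: lee_sum => j _; exact: ze.
Qed.

End solution_bounds.

Theorem theorem3p2 (R : realType) (T vol : R) (K J : nat) (L f0 : R)
    (Lw w0 : 'I_K -> R) (RU R0 Ystar D : R) (beta : 'I_J -> R)
    (T_gt0 : 0 < T) (K_gt0 : (0 < K)%N) (J_gt0 : (0 < J)%N)
    (RU_gt0 : 0 < RU) (R0_gt0 : 0 < R0) (D_gt0 : 0 < D)
    (beta_gt0 : forall j, 0 < beta j) :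
  exists C : R,
    forall (d : nat) (Omega : set 'rV[R]_d)
      (f : R -> R) (w : 'I_K -> R -> R) (ystar : R -> 'rV[R]_d -> R)
      (u : control Omega J K) (y0 : 'rV[R]_d -> R) (kappa0 : 'I_J -> R)
      (z : X2 T Omega J),
      (1 <= d)%N ->
      open Omega -> connected Omega -> Omega !=set0 -> bounded_set Omega ->
      compact_H1_L2 Omega ->
      lebesgue_rV R d Omega = vol%:E ->
      L.-lipschitz f -> f 0 = f0 ->
      (forall k, (Lw k).-lipschitz (w k)) -> (forall k, w k 0 = w0 k) ->
      in_LpL2 T Omega +oo%E ystar ->
      time_norm T 2%:E (fun t => L2norm Omega (ystar t)) = Ystar%:E ->
      (Unorm u <= RU%:E)%E ->
      in_L2 Omega y0 -> (X0norm Omega y0 kappa0 <= R0%:E)%E ->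
      weak_solution f w D beta ystar u y0 kappa0 z ->
      (X2norm z < C%:E)%E.
Proof.
pose A := RU * \sum_k `|w0 k|; pose B := RU ^+ 2 * \sum_k `|Lw k|.
(* One number bounding all the [1 / beta_j^2], so that the same [q0] and [q1] serve every
   controller. *)
pose Bm := \sum_j (beta j)^-1 ^+ 2.
have Bm0 : 0 <= Bm by apply: sumr_ge0 => j _; exact: sqr_ge0.
have Bmj j : (beta j)^-1 ^+ 2 <= Bm.
  by rewrite /Bm (bigD1 j)//= lerDl sumr_ge0// => i _; exact: sqr_ge0.
(* [p0], [p1] are the coefficients of the forcing bound once the [g_j] are estimated by [RU]; the
   absolute value is there because [vol] is still an arbitrary real at this point. [q0], [q1] come
   from [(W - kappa)^2 <= 2 W^2 + 2 kappa^2] and the bound on [W]. *)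
pose p0 := 4 * f0 ^+ 2 * `|vol|; pose p1 := 4 * L ^+ 2 + 2 * RU ^+ 2.
pose q0 := Bm * (4 * A ^+ 2); pose q1 := Bm * (8 * B ^+ 2 + 2).
have p0_ge0 : 0 <= p0 by do ?[by []|exact: sqr_ge0|apply: mulr_ge0].
have p1_ge0 : 0 <= p1 by do ?[by []|exact: sqr_ge0|apply: addr_ge0|apply: mulr_ge0].
have q0_ge0 : 0 <= q0 by do ?[by []|exact: sqr_ge0|apply: mulr_ge0].
have q1_ge0 : 0 <= q1 by do ?[by []|exact: sqr_ge0|apply: addr_ge0|apply: mulr_ge0].
have [M M0 bound] := @a_priori_bound R T D p0 p1 q0 q1 (R0 ^+ 2) (Ystar ^+ 2) J
  T_gt0 D_gt0 p0_ge0 p1_ge0 q0_ge0 q1_ge0 (sqr_ge0 _) (sqr_ge0 _).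
(* In order: [y] in the supremum norm, its gradient, its time derivative in the dual norm, then for
   each [j] the norms of [kappa_j] and of its derivative, and 1 for strictness. *)
exists (Num.sqrt M + Num.sqrt M + Num.sqrt (2 * M + 2 * D ^+ 2 * M) +
  (Num.sqrt M + Num.sqrt M) *+ J + 1).
move=> d Omega f w ystar u y0 kappa0 z _ oO _ _ _ _ mOv fL f_0 wL w_0 ysL ysE uRU y0L X0
  [[zr [zL zC zy z0]] kinit weakY weakK].
have mO := open_measurable_rV oO.
set m := lebesgue_rV R d; set mu := @lebesgue_measure R.
have vol0 : 0 <= vol by rewrite -lee_fin -mOv measure_ge0.
have [My My0 [Ly yM]] := in_LpL2y_L2 mO (X_yP z).
have [Ms Ms0 [Lys ysM]] := in_LpL2y_L2 mO ysL.
have [_ mG yH] := X_gradP z.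
have [LG gradE] := gradQ_norm_ip mO mG (X_grad_fin z).
have Lg := control_g_L2 mO u.
pose q t x := f (X_y z t x) + \sum_j X_kappa z j t * g_ u j x.
have mq : measurable_Q T Omega q.
  exact: (measurable_Q_forcing mO fL (X_yP z).1 (fun j => (X_kappaP z j).1)
    (fun j => (g_L2 u j).1)).
have qle : {ae mu, forall t : R, `]0, T[%classic t -> L2 m (q t \_ Omega) /\
    ip m (q t \_ Omega) (q t \_ Omega) <= p0 +
      p1 * (ip m (X_y z t \_ Omega) (X_y z t \_ Omega) + \sum_j X_kappa z j t ^+ 2)}.
  apply: ae_imp yM _ => t yMt tT; have [Lyt _] := yMt tT.
  have [Lqt le] := forcing_L2 mO (fun j => X_kappa z j t) mOv fL Lyt Lg.
  split => //; apply: le_trans le _.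
  have S0 : 0 <= \sum_j X_kappa z j t ^+ 2 by apply: sumr_ge0 => j _; exact: sqr_ge0.
  have h := ler_wpM2l S0 (control_g_le mO (ltW RU_gt0) uRU); have E0 := ip_ge0 m (X_y z t \_ Omega).
  rewrite /p0 /p1 f_0 ger0_norm//; move: h E0 S0.
  set G := \sum_j ip _ _ _; set S := \sum_j _ ^+ 2; set E := ip _ _ _ => h E0 S0.
  have := mulr_ge0 (sqr_ge0 L) S0; have := mulr_ge0 (sqr_ge0 RU) E0; nra.
(* The essential bounds [My] and [Mk] of the given solution only show that the forcing is square
   integrable on space-time; they do not enter the constant. *)
have /choice[Mk MkP] : forall j, exists Mk : R,
    {ae mu, forall t : R, `]0, T[%classic t -> X_kappa z j t ^+ 2 <= Mk}.
  move=> j; have [Mk Mk0 h] := time_normy_ae (X_kappaP z j).2.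
  exists (Mk ^+ 2); apply: ae_imp h _ => t ht tT; have := ht tT.
  by rewrite /= lee_fin => k; rewrite -(real_normK (num_real (X_kappa z j t))) ler_pXn2r// nnegrE.
have Lq : L2 (mu \x m)%E (ext T Omega q).
  have MkP' := ae_forall_ord MkP.
  apply: (L2_ext mO (M := Num.sqrt (p0 + p1 * (My + \sum_j Mk j))) mq).
  have h := ae_imp2 yM MkP' (fun t a b => conj a b).
  apply: ae_imp2 qle h _ => t qt [yt kt] tT; have [Lqt le] := qt tT.
  rewrite L2norm_ip// lee_fin ler_wsqrtr// (le_trans le)// lerD2l ler_wpM2l// lerD//.
    by have [] := yt tT.
  by apply: ler_sum => j _; exact: kt.
have rep := representative_ae mO yH zL zy.
(* The estimates are carried out for continuous representatives, at every time, and return to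
   [kappa_j] almost everywhere. *)
have /choice[c cP] : forall j, exists c : R -> R, [/\ {within `[0, T], continuous c},
    ae_time T (fun t => c t = X_kappa z j t), c 0 = kappa0 j &
    forall t, 0 <= t <= T -> c t = c 0 + \int[mu]_(s in `]0, t[) X_dkappa z j s].
  by move=> j; exact: (scalar_increment T_gt0 (X_dkappaP z j) (X_dkappaE z j) (kinit j)).
have ck : {ae mu, forall t : R, forall j, `]0, T[%classic t -> c j t = X_kappa z j t}.
  by apply: ae_forall_ord => j; have [] := cP j.
pose E t := ip m (zr t \_ Omega) (zr t \_ Omega).
have LzO t : 0 <= t <= T -> L2 m (zr t \_ Omega).
  by move=> tT; apply: in_L2_restrict => //; apply: zL; rewrite /= in_itv.
have yE : {ae mu, forall t : R, `]0, T[%classic t -> L2 m (X_y z t \_ Omega) /\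
    ip m (X_y z t \_ Omega) (X_y z t \_ Omega) = E t}.
  apply: ae_imp rep _ => t rt; rewrite /= in_itv/= => tT; have [Lyt zyt] := rt tT.
  have tT' : 0 <= t <= T by case/andP: tT => /ltW -> /ltW ->.
  have [mzt _] := LzO t tT'; have [myt _] := Lyt.
  by split => //; rewrite /E; apply/esym/ip_ae_eq.
pose es t := ip m (ystar t \_ Omega) (ystar t \_ Omega).
pose Gb b := \sum_i ip (mu \x m)%E (gcomp b Omega (X_grad z) i) (gcomp b Omega (X_grad z) i).
have [yk_le kap_le] : E 0 <= R0 ^+ 2 /\ forall j, c j 0 ^+ 2 <= R0 ^+ 2.
  have Ly0 := in_L2_restrict mO y0L.
  have T00 : (0 : R) <= 0 <= T by apply/andP; split => //; exact: ltW.
  have zy0 := L2norm_sub0 (LzO _ T00) Ly0 z0.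
  have -> : E 0 = ip m (y0 \_ Omega) (y0 \_ Omega).
    have [mz _] := LzO 0 T00; have [my _] := Ly0; exact: ip_ae_eq.
  have S0 : 0 <= \sum_(j < J) kappa0 j ^+ 2 by apply: sumr_ge0 => j _; exact: sqr_ge0.
  have I0 := ip_ge0 m (y0 \_ Omega).
  have : ip m (y0 \_ Omega) (y0 \_ Omega) + \sum_(j < J) kappa0 j ^+ 2 <= R0 ^+ 2.
    move: X0; rewrite /X0norm (L2norm_sqr Ly0) -EFinD /= lee_fin => h.
    rewrite -[leLHS]sqr_sqrtr ?addr_ge0// ler_pXn2r// nnegrE ?sqrtr_ge0//; exact: ltW.
  move=> h; split => //; first by apply: le_trans h; rewrite lerDl.
  move=> j; have [_ _ -> _] := cP j; apply: le_trans h.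
  rewrite (bigD1 j)//= addrCA lerDl addr_ge0// sumr_ge0// => i _; exact: sqr_ge0.
have weak' : forall phi H, in_L2H1 T Omega phi H ->
    \int[mu]_(t in `]0, T[) (X_dy z t (phi t) +
      D * \int[m]_(x in Omega) dotv (X_grad z t x) (H t x) - L2inner Omega (q t) (phi t)) = 0.
  exact: weakY.
have energy b : 0 < b <= T -> E b + 2 * D * Gb b <= E 0 +
    \int[mu]_(t in `]0, b[) ip m (q t \_ Omega) (q t \_ Omega) + \int[mu]_(t in `]0, b[) E t.
  exact: (energy_estimate mO T_gt0 (ltW D_gt0) (X_yP z).1 Ly mG LG yH mq Lq (X_dyP z) (X_dyE z)
    weak' zL zC zy).
have Gb0 b : 0 <= Gb b by apply: sumr_ge0 => i _; exact: ip_ge0.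
have [VM GM PM KM] : [/\ forall t, 0 <= t <= T -> E t + \sum_j c j t ^+ 2 <= M, Gb T <= M,
      \int[mu]_(t in `]0, T[) ip m (q t \_ Omega) (q t \_ Omega) <= M &
      forall j, \int[mu]_(t in `]0, T[) (X_dkappa z j t ^+ 2) <= M].
  apply: (bound E Gb (fun t => ip m (q t \_ Omega) (q t \_ Omega)) es c (X_dkappa z)).
  - exact: (continuous_energy mO zL zC).
  - by move=> t _; exact: ip_ge0.
  - by move=> t _; exact: Gb0.
  - exact: integrable_ip_ext Lq.
  - exact: integrable_ip_ext Lys.
  - by move=> t; exact: ip_ge0.
  - by rewrite (time_norm2_L2norm mO ysL ysE).
  - by move=> j; have [] := cP j.
  - by move=> j; exact: in_Lp2_L2 (X_dkappaP z j).
  - by move=> j; have [] := cP j.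
  - exact: energy.
  - have h := ae_imp2 yE ck (fun t a b => conj a b).
    apply: ae_imp2 qle h _ => t qt [yt kt] tT; have [_ le] := qt tT.
    have [_ <-] := yt tT; apply: le_trans le _.
    by under [X in _ <= _ + _ * (_ + X)]eq_bigr do rewrite kt//.
  (* The differential equation, now valid at almost every time, expresses [kappa_j'] through [W_j]
     and [kappa_j]. *)
  - move=> j; have mW := measurable_thermostat mO u j wL (X_yP z).1 ysL.1.
    have ode := weak_scalar_ode (X_kappaP z j).1 (X_dkappaP z j).1 mW (weakK j).
    have h := ae_imp2 yE ck (fun t a b => conj a b).
    have h2 := ae_imp2 h ysM (fun t a b => conj a b).
    apply: ae_imp2 ode h2 _ => t odet [[yt kt] yst] tT.
    have [Lyt yEt] := yt tT; have [Lyst _] := yst tT.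
    have Wle := thermostat_le mO (ltW RU_gt0) uRU wL w_0 j Lyt Lyst.
    rewrite yEt -/(es t) -/A -/B in Wle.
    have kS : X_kappa z j t ^+ 2 <= \sum_j c j t ^+ 2.
      rewrite (bigD1 j)//= kt// lerDl sumr_ge0// => i _; exact: sqr_ge0.
    have -> : X_dkappa z j t = (beta j)^-1 * (W_ w u j (X_y z t) (ystar t) - X_kappa z j t).
      by rewrite -odet// mulKf// gt_eqF.
    have -> : q0 + q1 * (E t + es t + \sum_j c j t ^+ 2) =
        Bm * (4 * A ^+ 2 + (8 * B ^+ 2 + 2) * (E t + es t + \sum_j c j t ^+ 2)).
      by rewrite /q0 /q1; ring.
    rewrite exprMn.
    have E0 : 0 <= E t by exact: ip_ge0.
    have es0 : 0 <= es t by exact: ip_ge0.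
    apply: ler_pM => //; [exact: sqr_ge0|exact: sqr_ge0|].
    have B0 := sqr_ge0 B; have k0 := sqr_ge0 (X_kappa z j t).
    move: Wle kS k0; set W := W_ _ _ _ _ _; set k := X_kappa z j t; set S := \sum_j _.
    move: (E t) (es t) E0 es0 => e s e0 s0 Wle kS k0.
    have := sqr_ge0 (W + k); have := mulr_ge0 B0 (le_trans k0 kS); nra.
  - exact: yk_le.
  - exact: kap_le.
have S0 t : 0 <= \sum_j c j t ^+ 2 by apply: sumr_ge0 => j _; exact: sqr_ge0.
apply: X2norm_le.
- apply: time_normy_le; first exact: sqrtr_ge0.
  apply: ae_imp yE _ => t yt tT; have [Lyt yEt] := yt tT.
  rewrite L2norm_ip// gee0_abs ?lee_fin ?sqrtr_ge0// yEt ler_wsqrtr//.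
  move: tT; rewrite /= in_itv/= => /andP[/ltW t0 /ltW tT].
  by apply: le_trans (VM t _); rewrite ?t0// lerDl.
- by rewrite gradE lee_fin ler_wsqrtr.
- apply: le_trans (dual_time_norm_le mO T_gt0 LG Lq (X_dyP z) weak') _.
  rewrite lee_fin ler_wsqrtr// lerD//.
    by rewrite ip_ext_Rintegral// ler_wpM2l.
  by rewrite ler_wpM2l// mulr_ge0// sqr_ge0.
move=> j; rewrite [leRHS]EFinD; apply: leeD.
  apply: time_normy_le; first exact: sqrtr_ge0.
  apply: ae_imp ck _ => t kt tT.
  rewrite /= lee_fin -kt// -sqrtr_sqr ler_wsqrtr//.
  move: tT; rewrite /= in_itv/= => /andP[/ltW t0 /ltW tT].
  apply: le_trans (VM t _); last by rewrite t0.
  apply: (@le_trans _ _ (\sum_j c j t ^+ 2)); last by rewrite lerDr ip_ge0.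
  by rewrite (bigD1 j)//= lerDl sumr_ge0// => i _; exact: sqr_ge0.
apply: (@le_trans _ _ (Num.sqrt (\int[mu]_(t in `]0, T[) (X_dkappa z j t ^+ 2)))%:E).
  apply: time_norm2_le.
  - by move=> t _; exact: sqr_ge0.
  - by have [] := L2_integrable_oo T_gt0 (in_Lp2_L2 (X_dkappaP z j)).
  - by apply: aeW => t _; rewrite /= lee_fin sqrtr_sqr.
by rewrite lee_fin ler_wsqrtr.
Qed.
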